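(* Fix an integer $r \ge 2$ and a parameter vector $\theta = (\mu, \sigma, \xi)$ with $\mu \in \mathbb{R}$, $\sigma > 0$, $\xi \in \mathbb{R}$. Let $(X_{i1}, \ldots, X_{ir})$, $i = 1, \ldots, n$, be independent and identically distributed random vectors, each following the GEV$_r(\mu,\sigma,\xi)$ distribution, and assume that the null hypothesis $H_0^{(r-1)}$ holds, i.e. that the $r-1$ largest order statistics $(X_{i1},\ldots,X_{i,r-1})$ follow the GEV$_{r-1}(\mu,\sigma,\xi)$ distribution. Let $z_{ij} = (X_{ij} - \mu)/\sigma$ and $$Y_{ir}(\theta) = -\log\sigma - (1+\xi z_{ir})^{-1/\xi} + (1+\xi z_{i,r-1})^{-1/\xi} - \Bigl(\frac{1}{\xi}+1\Bigr)\log(1+\xi z_{ir}),$$ (for $\xi = 0$ interpreted as its limit $\xi \to 0$, namely $-\log\sigma - e^{-z_{ir}} + e^{-z_{i,r-1}} - z_{ir}$). Let $\bar Y_r = \frac1n\sum_{i=1}^n Y_{ir}(\theta)$, $S_{Y_r}^2 = \frac{1}{n-1}\sum_{i=1}^n (Y_{ir}(\theta) - \bar Y_r)^2$, $\eta_r = -\log\sigma - 1 + (1+\xi)\psi(r)$, where $\psi(x) = \frac{d}{dx}\log\Gamma(x)$ is the digamma function, and $$T_n^{(r)}(\theta) = \sqrt{n}\,(\bar Y_r - \eta_r)/S_{Y_r}.$$ Then $T_n^{(r)}(\theta)$ converges in distribution to $N(0,1)$ as $n \to \infty$.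
   Context: The GEV$_r(\mu,\sigma,\xi)$ distribution (limiting joint distribution of the $r$ largest order statistics of a sample) is the distribution on $\{(x_1,\ldots,x_r): x_1 > x_2 > \cdots > x_r,\ 1+\xi z_j > 0 \text{ for all } j\}$, $z_j = (x_j-\mu)/\sigma$, with density $$f_r(x_1,\ldots,x_r \mid \mu,\sigma,\xi) = \sigma^{-r}\exp\Big\{-(1+\xi z_r)^{-1/\xi} - \Bigl(\frac1\xi + 1\Bigr)\sum_{j=1}^r \log(1+\xi z_j)\Big\},$$ with the case $\xi = 0$ understood as the limit $\xi\to 0$, i.e. $\sigma^{-r}\exp\{-e^{-z_r} - \sum_{j=1}^r z_j\}$. For $r=1$ this is the generalized extreme value (GEV) distribution. The quantity $Y_{ir}(\theta)$ is the difference of the GEV$_r$ and GEV$_{r-1}$ log-likelihood contributions of block $i$. *)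

(* Defs.v *)
From HB Require Import structures.
From mathcomp Require Import all_boot all_order all_algebra.
From mathcomp Require Import all_classical all_reals all_analysis.
Set Implicit Arguments. Unset Strict Implicit. Unset Printing Implicit Defensive.
Import Order.TTheory GRing.Theory Num.Theory.
Import numFieldNormedType.Exports.
Local Open Scope classical_set_scope.
Local Open Scope ring_scope.

Section Defs.
Context {R : realType}.

Definition Gamma (x : R) : R :=
  Rintegral lebesgue_measure `]0%R, +oo[%classic (fun t => t `^ (x - 1) * expR (- t)).

Definition digamma (x : R) : R := derive1 (fun y => ln (Gamma y)) x.

(** Iterated Lebesgue integral over R^n (n-tuples), integrating the first
    coordinate outermost. For non-negative measurable integrands this is the
    integral against Lebesgue measure on R^n (Tonelli). *)
Fixpoint tint (n : nat) : (n.-tuple R -> \bar R) -> \bar R :=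
  match n return (n.-tuple R -> \bar R) -> \bar R with
  | 0 => fun g => g [tuple]
  | n'.+1 => fun g =>
      (\int[lebesgue_measure]_x tint (fun t : n'.-tuple R => g (cons_tuple x t)))%E
  end.

(** Density of GEV_r(mu, sigma, xi) at x = (x_1, ..., x_r) (x_j = nth 0 x (j-1)),
    zero outside the support {x_1 > ... > x_r, 1 + xi z_j > 0}. *)
Definition gev_r_pdf (r : nat) (mu sigma xi : R) (x : r.-tuple R) : R :=
  let z := fun j : nat => (nth 0 x j - mu) / sigma in
  if `[< (forall i j : nat, (i < j < r)%N -> nth 0 x j < nth 0 x i) /\
         (forall j : nat, (j < r)%N -> 0 < 1 + xi * z j) >]
  then
    if xi == 0 then
      sigma ^- r * expR (- expR (- z r.-1) - \sum_(j < r) z j)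
    else
      sigma ^- r * expR (- (1 + xi * z r.-1) `^ (- xi^-1)
                         - (xi^-1 + 1) * \sum_(j < r) ln (1 + xi * z j))
  else 0.

Definition has_gev_r_law d (T : measurableType d) (P : probability T R)
    (r : nat) (mu sigma xi : R) (X : T -> r.-tuple R) : Prop :=
  forall A : set (r.-tuple R), measurable A ->
    P (X @^-1` A) = tint (fun t => ((\1_A t) * gev_r_pdf mu sigma xi t)%:E).

Definition mutually_independent d (T : measurableType d) (P : probability T R)
    (n : nat) (X : nat -> T -> n.-tuple R) : Prop :=
  forall (s : seq nat) (A : nat -> set (n.-tuple R)), uniq s ->
    (forall i, i \in s -> measurable (A i)) ->
    P (\bigcap_(i in [set i | i \in s]) (X i @^-1` A i)) =
    (\prod_(i <- s) P (X i @^-1` A i))%E.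

(** Convergence in distribution of real random variables Z_n to the law Q:
    cdf convergence at every continuity point of the cdf of Q. *)
Definition cvg_in_distribution d (T : measurableType d) (P : probability T R)
    (Z : nat -> T -> R) (Q : set R -> \bar R) : Prop :=
  forall x : R, Q [set x] = 0%E ->
    (fun n => P [set w | Z n w <= x]) @ \oo --> Q `]-oo, x]%classic.

(** Y_{ir}(theta) as a function of x_{i,r-1} (xp) and x_{ir} (x). *)
Definition Yfun (mu sigma xi : R) (xp x : R) : R :=
  let zp := (xp - mu) / sigma in
  let z := (x - mu) / sigma in
  if xi == 0 then - ln sigma - expR (- z) + expR (- zp) - z
  else - ln sigma - (1 + xi * z) `^ (- xi^-1) + (1 + xi * zp) `^ (- xi^-1)
       - (xi^-1 + 1) * ln (1 + xi * z).

Definition eta_r (r : nat) (sigma xi : R) : R :=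
  - ln sigma - 1 + (1 + xi) * digamma r%:R.

Definition Tstat (T : Type) (r : nat) (mu sigma xi : R)
    (X : nat -> T -> r.-tuple R) (n : nat) (w : T) : R :=
  let Y := fun i => Yfun mu sigma xi (nth 0 (X i w) r.-2) (nth 0 (X i w) r.-1) in
  let Ybar := n%:R^-1 * \sum_(i < n) Y i in
  let S2 := (n.-1)%:R^-1 * \sum_(i < n) (Y i - Ybar) ^+ 2 in
  Num.sqrt n%:R * (Ybar - eta_r r sigma xi) / Num.sqrt S2.

End Defs.

(* Main.v *)
(* Put [u_j = (1 + xi z_j)^(-1/xi)], or [u_j = exp(- z_j)] when [xi = 0]. In
   these coordinates the GEV_r density says that [u_1 < ... < u_r] are the first
   [r] points of a unit Poisson process; in particular [u_r] has the Gamma law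
   of shape [r], so that [E u_r = r] and [E (ln u_r) = psi(r)]. Since
     [Y_r = - ln sigma - u_r + u_{r-1} + (1 + xi) ln u_r],
   the hypothesis on the [r - 1] largest order statistics gives
   [E Y_r = - ln sigma - r + (r - 1) + (1 + xi) psi(r) = eta_r]. All moments of
   [Y_r] are finite, and [Y_r] is not almost surely constant because [u_r] is
   arbitrarily small with positive probability. The claim is then the central
   limit theorem for Studentized means. It follows from Lindeberg's replacement
   of the summands by Gaussian ones, one at a time, inside a smooth bounded test
   function; logistic functions serve as smooth approximations of indicators of
   half-lines. The sample variance is handled by a law of large numbers proved
   by the same replacement. *)
Require Import Defs.
From HB Require Import structures.
From mathcomp Require Import all_boot all_order all_algebra.
From mathcomp Require Import all_classical all_reals all_analysis.
From mathcomp Require Import measurable_realfun measurable_fun_approximation.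
From mathcomp Require Import lra ring.
Import Order.TTheory GRing.Theory Num.Theory.
Import numFieldNormedType.Exports.
Local Open Scope classical_set_scope.
Local Open Scope ring_scope.
Set Implicit Arguments. Unset Strict Implicit. Unset Printing Implicit Defensive.

(** * Change of variables *)

(** The moments use only two marginals: [u_r] is Gamma of shape [r] and, by the hypothesis on the
    [r - 1] largest, [u_{r-1}] is Gamma of shape [r - 1]. Linearity gives the mean and a convexity
    bound gives the fourth moment, so no joint law of the two is computed. The joint density returns
    only for the almost sure order [0 < u_{r-1} < u_r], used for non-degeneracy. Each marginal comes
    from an iterated integral over [u_1 < ... < u_r]: Cauchy's formula for repeated integration
    collapses the inner points to the weight [u ^+ (r - 1) / (r - 1)!]. The Gaussian replacements
    are not adjoined to the probability space. Replacing a summand means convolving the test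
    function with a normal law instead of with the law of the summand, and the [n]-fold convolution
    of [N(0, 1/n)] is exactly [N(0, 1)]. Each replacement costs a term of order [n ^ (-3/2)]. Fourth
    moments are needed because the sample variance averages squares, and the law of large numbers
    obtained by replacement asks for second moments of what is averaged. *)

Section weighted_image.
Context d1 d2 (X : measurableType d1) (Y : measurableType d2) (R : realType).
Variables (m : {measure set X -> \bar R}) (n : {measure set Y -> \bar R}).
Variables (w : X -> R) (phi : X -> Y).
Hypothesis w0 : forall x, 0 <= w x.
Hypothesis mw : measurable_fun setT w.
Hypothesis mphi : measurable_fun setT phi.
Hypothesis nE : forall A, measurable A ->
  n A = (\int[m]_x (w x * \1_A (phi x))%:E)%E.

Import HBNNSimple.
Local Open Scope ereal_scope.

(** The hypothesis [nE] is the case of indicators; linearity gives simple functions and monotone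
    convergence the rest. The lemma serves densities ([phi] the identity), image measures ([w = 1])
    and changes of variable alike. *)
Lemma ge0_integral_weighted_image (g : Y -> \bar R) :
  measurable_fun setT g -> (forall y, 0 <= g y) ->
  \int[n]_y g y = \int[m]_x ((w x)%:E * g (phi x)).
Proof.
move=> mg g0.
pose h := nnsfun_approx measurableT mg.
transitivity (limn (fun k => \int[n]_y (h k y)%:E)).
  rewrite -monotone_convergence//.
  - apply: eq_integral => y _; apply/esym/cvg_lim => //.
    exact: cvg_nnsfun_approx.
  - by move=> k; exact/measurable_EFinP/measurable_funP.
  - by move=> k y _; rewrite lee_fin.
  - by move=> y _ a b ab; rewrite lee_fin; exact/lefP/nd_nnsfun_approx.
have mk k : measurable_fun setT (fun x => (w x * h k (phi x))%:E).
  apply/measurable_EFinP/measurable_funM => //.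
  exact: measurableT_comp.
transitivity (limn (fun k => \int[m]_x (w x * h k (phi x))%:E)); last first.
  rewrite -monotone_convergence//.
  - apply: eq_integral => x _; apply/cvg_lim => //.
    under eq_fun do rewrite EFinM.
    by apply: cvgeZl => //; exact: cvg_nnsfun_approx.
  - by move=> k x _; rewrite lee_fin mulr_ge0.
  - move=> x _ a b ab; rewrite lee_fin ler_wpM2l//.
    exact/lefP/nd_nnsfun_approx.
congr (limn _); apply/funext => k.
transitivity (\sum_(r \in range (h k))
    \int[n]_y (r * \1_(h k @^-1` [set r]) y)%:E).
  under eq_integral do rewrite fimfunE -fsumEFin//.
  rewrite ge0_integral_fsum//.
  - by move=> y; exact/measurable_EFinP/measurable_funM.
  - by move=> y x _; rewrite nnfun_muleindic_ge0.
transitivity (\sum_(r \in range (h k))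
    \int[m]_x (w x * (r * \1_(h k @^-1` [set r]) (phi x)))%:E); last first.
  rewrite -ge0_integral_fsum//; last 2 first.
  - move=> r; apply/measurable_EFinP/measurable_funM => //.
    by apply: measurable_funM => //; apply: measurableT_comp.
  - move=> r x _; rewrite EFinM mule_ge0 ?lee_fin//.
    by have := nnfun_muleindic_ge0 (h k) r (phi x); rewrite lee_fin.
  apply: eq_integral => x _.
  by rewrite [in RHS]fimfunE fsumEFin// mulr_fsumr.
apply: eq_fsbigr => r rh.
rewrite integralZl_indic_nnsfun// integral_indic// setIT nE//.
have r0 : (0 <= r)%R by move: rh; rewrite inE => -[y _ <-].
rewrite -ge0_integralZl_EFin//; last 2 first.
- by move=> x _; rewrite lee_fin mulr_ge0.
- apply/measurable_EFinP/measurable_funM => //.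
  by apply: measurableT_comp.
by apply: eq_integral => x _; rewrite -EFinM mulrCA.
Qed.

End weighted_image.

Section law.
Context d (T : measurableType d) (R : realType) (P : probability T R).
Variables (V : T -> R) (mV : measurable_fun setT V).

Let mV' : measurable_fun setT (V : T -> measurableTypeR R). Proof. exact: mV. Qed.

Let V_mixin := isMeasurableFun.Build _ _ T (measurableTypeR R) V mV'.
Let V_pack : {mfun T >-> measurableTypeR R} := HB.pack V V_mixin.

Definition law : probability (measurableTypeR R) R := distribution P V_pack.

Lemma ge0_integral_law (f : R -> \bar R) :
  measurable_fun setT f -> (forall v, 0 <= f v)%E ->
  (\int[law]_v f v = \int[P]_w f (V w))%E.
Proof. by move=> mf f0; rewrite ge0_integral_distribution. Qed.

Lemma integral_law (f : R -> \bar R) : measurable_fun setT f ->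
  P.-integrable setT (f \o V) ->
  (\int[law]_v f v = \int[P]_w f (V w))%E.
Proof. by move=> mf intf; rewrite integral_distribution. Qed.

End law.

Section weighted_image_measure.
Context d1 d2 (X : measurableType d1) (Y : measurableType d2) (R : realType).
Variables (m : {measure set X -> \bar R}) (w : X -> R) (phi : X -> Y).
Hypothesis w0 : forall x, 0 <= w x.
Hypothesis mw : measurable_fun setT w.
Hypothesis mphi : measurable_fun setT phi.

(** The image under [phi] of the measure of density [w] with respect to [m]. *)
Definition weighted_image (A : set Y) : \bar R :=
  (\int[m]_(x in phi @^-1` A) (w x)%:E)%E.

Let weighted_image0 : weighted_image set0 = 0%E.
Proof. by rewrite /weighted_image preimage_set0 integral_set0. Qed.

Let weighted_image_ge0 A : (0 <= weighted_image A)%E.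
Proof. by apply: integral_ge0 => x _; rewrite lee_fin. Qed.

Let measurable_phi A : measurable A -> measurable (phi @^-1` A).
Proof. by move=> mA; rewrite -[X in measurable X]setTI; exact: mphi. Qed.

Let weighted_image_sigma_additive : semi_sigma_additive weighted_image.
Proof.
move=> F mF tF mUF; rewrite /weighted_image preimage_bigcup.
rewrite ge0_integral_bigcup//.
- apply: is_cvg_ereal_nneg_natsum_cond => k _ _.
  by apply: integral_ge0 => x _; rewrite lee_fin.
- by move=> k; exact: measurable_phi.
- apply/measurable_EFinP; exact: measurable_funTS.
- by move=> x _; rewrite lee_fin.
- apply/trivIsetP => /= i j _ _ ij; rewrite -preimage_setI.
  by move/trivIsetP : tF => /(_ _ _ _ _ ij) ->//; rewrite preimage_set0.
Qed.

HB.instance Definition _ := isMeasure.Build _ _ _ weighted_image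
  weighted_image0 weighted_image_ge0 weighted_image_sigma_additive.

Definition weighted_image_measure : {measure set Y -> \bar R} := weighted_image.

Lemma weighted_imageE A : measurable A ->
  weighted_image A = (\int[m]_x (w x * \1_A (phi x))%:E)%E.
Proof.
move=> mA; rewrite /weighted_image integral_mkcond.
by apply: eq_integral => x _; rewrite epatch_indic/= -EFinM.
Qed.

End weighted_image_measure.

Section decreasing_substitution.
Context {R : realType}.
Notation leb := (@lebesgue_measure R).
Variables (D : set R) (w L psi : R -> R).
Hypothesis mw : measurable_fun setT w.
Hypothesis mL : measurable_fun setT L.
Hypothesis w0 : forall x, 0 <= w x.
Hypothesis wD : forall x, ~ D x -> w x = 0.
Hypothesis psiD : forall v, D (psi v).
Hypothesis psiK : forall v, L (psi v) = v.
Hypothesis LK : forall x, D x -> psi (L x) = x.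
Hypothesis psi_dec : forall a b, a < b -> psi b < psi a.
Hypothesis D_itv : forall a b x, psi b <= x <= psi a -> D x.
Hypothesis dL : forall x, D x -> is_derive x 1 L (- w x).
Hypothesis cw : forall x, D x -> {for x, continuous w}.

(** Within [D] the preimage of []a, b]] is [[psi b, psi a[], because [L] decreases with inverse
    [psi]. There [- L] is a primitive of [w], and its increment is [b - a]. *)
Let image_itv a b : a < b -> weighted_image leb w L `]a, b] = (b - a)%:E.
Proof.
move=> ab; rewrite /weighted_image.
have -> : (\int[leb]_(x in L @^-1` `]a, b]) (w x)%:E =
           \int[leb]_(x in `[psi b, psi a[) (w x)%:E)%E.
  rewrite integral_mkcond [RHS]integral_mkcond; apply: eq_integral => x _.
  rewrite !patchE.
  (* The weight vanishes off [D], so the two domains of integration need only agree on [D]. *)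
  have [Dx|nDx] := pselect (D x); last by rewrite wD//; case: ifP; case: ifP.
  congr (if _ then _ else _); apply/idP/idP.
  - rewrite !inE/= !in_itv/= => /andP[aL Lb].
    rewrite -(LK Dx) psi_dec// andbT.
    by move: Lb; rewrite le_eqVlt => /predU1P[->//|/psi_dec/ltW].
  - rewrite !inE/= !in_itv/= => /andP[bx xa]; apply/andP; split.
      rewrite ltNge; apply/negP => La; move: xa; apply/negP; rewrite -leNgt.
      rewrite -(LK Dx).
      by move: La; rewrite le_eqVlt => /predU1P[->//|/psi_dec/ltW].
    rewrite leNgt; apply/negP => /psi_dec; rewrite LK// => xb.
    by move: bx; rewrite leNgt xb.
have pba := psi_dec ab.
have Dcc x : psi b <= x <= psi a -> D x by exact: D_itv.
rewrite integral_itv_bndo_bndc; last first.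
  by apply/measurable_EFinP; exact: measurable_funTS.
have dNL x : D x -> is_derive x 1 (- L) (w x).
  by move=> Dx; have := dL Dx => ?; rewrite -[w x]opprK; exact: is_deriveN.
have cNL x : D x -> {for x, continuous (- L)}.
  move=> Dx; apply/differentiable_continuous/derivable1_diffP.
  by have [] := dNL _ Dx.
rewrite (@continuous_FTC2 _ w (- L))//.
- by rewrite !fctE !psiK -EFinB opprK addrC.
- apply: continuous_in_subspaceT => x; rewrite inE/= in_itv/= => /Dcc.
  exact: cw.
- split.
  + move=> x; rewrite in_itv/= => /andP[/ltW bx /ltW xa].
    by have [] := dNL x (Dcc _ (introT andP (conj bx xa))).
  + by apply: cvg_at_right_filter; apply: cNL.
  + by apply: cvg_at_left_filter; apply: cNL.
- move=> x; rewrite in_itv/= => /andP[/ltW bx /ltW xa].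
  have Dx := Dcc _ (introT andP (conj bx xa)).
  by rewrite derive1E; have := dNL _ Dx => ?; rewrite derive_val.
Qed.

(** By [image_itv] the image of [w dx] under [L] gives half-open intervals their length, hence is
    Lebesgue measure by uniqueness. *)
Lemma ge0_decreasing_substitution (g : R -> \bar R) :
  measurable_fun setT g -> (forall v, (0 <= g v)%E) ->
  (\int[leb]_v g v = \int[leb]_x ((w x)%:E * g (L x)))%E.
Proof.
move=> mg g0; apply: ge0_integral_weighted_image => // A mA.
rewrite -weighted_imageE//.
pose n := @weighted_image_measure _ _ (measurableTypeR R) (measurableTypeR R) R
  leb w L w0 mw mL.
have nE : forall B, ocitv B -> leb B = n B; last exact: (lebesgue_measure_unique nE mA).
move=> _ [[a b] _ <-].
have [ab|ba] := ltP a b; last by rewrite set_itv_ge ?measure0// bnd_simp -leNgt.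
have -> : n `]a, b]%classic = (b - a)%:E by exact: image_itv.
by rewrite lebesgue_measure_itv/= lte_fin ab EFinB.
Qed.

End decreasing_substitution.

Section restricted_image.
Context d1 d2 (X : measurableType d1) (Y : measurableType d2) (R : realType).
Variables (m : {measure set X -> \bar R}) (E : set X) (phi : X -> Y).
Hypothesis mE : measurable E.
Hypothesis mphi : measurable_fun setT phi.

Let indic0 x : 0 <= (\1_E x : R). Proof. by []. Qed.

Let mindic : measurable_fun setT (\1_E : X -> R).
Proof. exact: measurable_indic. Qed.

(** With [m] a probability, [E] an event and [p] its probability, [restricted_image] and
    [scaled_image] coincide when [phi] is independent of [E]. Writing both sides as measures lets
    independence be checked on rectangles only. *)
Definition restricted_image : {measure set Y -> \bar R} :=
  weighted_image_measure m indic0 mindic mphi.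

Lemma restricted_imageE A : measurable A ->
  restricted_image A = m ((phi @^-1` A) `&` E).
Proof.
move=> mA; rewrite /restricted_image/= /weighted_image integral_indic//.
  by rewrite setIC.
by rewrite -[X in measurable X]setTI; exact: mphi.
Qed.

End restricted_image.

Section scaled_image.
Context d1 d2 (X : measurableType d1) (Y : measurableType d2) (R : realType).
Variables (m : {measure set X -> \bar R}) (p : R) (phi : X -> Y).
Hypothesis p0 : 0 <= p.
Hypothesis mphi : measurable_fun setT phi.

Definition scaled_image : {measure set Y -> \bar R} :=
  weighted_image_measure m (fun=> p0) (measurable_cst p) mphi.

Lemma scaled_imageE A : measurable A ->
  scaled_image A = (p%:E * m (phi @^-1` A))%E.
Proof.
move=> mA; rewrite /scaled_image/= /weighted_image.
rewrite -[LHS]/(\int[m]_(x in phi @^-1` A) (cst p%:E x))%E integral_cst//.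
by rewrite -[X in measurable X]setTI; exact: mphi.
Qed.

End scaled_image.

Section product_measure_ext.
Context d1 d2 (X : measurableType d1) (Y : measurableType d2) (R : realType).
Local Open Scope ereal_scope.

(** Rectangles are stable under intersection, generate the product sigma-algebra and include the
    whole space, which has finite measure. *)
Lemma eq_measure_rectangles (m1 m2 : {measure set (X * Y) -> \bar R}) :
  m1 setT < +oo ->
  (forall A B, measurable A -> measurable B -> m1 (A `*` B) = m2 (A `*` B)) ->
  forall C, measurable C -> m1 C = m2 C.
Proof.
move=> m1oo mE C mC.
pose G : set (set (X * Y)) :=
  [set C | exists A, measurable A /\ exists B, measurable B /\ C = A `*` B].
have GI : setI_closed G.
  move=> /= _ _ [X1 [mX1 [X2 [mX2 ->]]]] [Y1 [mY1 [Y2 [mY2 ->]]]].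
  rewrite -setXI; exists (X1 `&` Y1); split; first exact: measurableI.
  by exists (X2 `&` Y2); split => //; exact: measurableI.
apply: (measure_unique G (fun=> setT)) => //.
- rewrite measurable_prod_measurableType //; congr (<<s _ >>).
  rewrite predeqE => D; split => [[A mA [B mB <-]]|[A [mA [B [mB ->]]]]].
    by exists A; split => //; exists B.
  by exists A => //; exists B.
- by move=> n; exists setT; split => //; exists setT; split => //; rewrite setXTT.
- by apply/seteqP; split => // x _; exists 0%N.
- by move=> _ [A [mA [B [mB ->]]]]; exact: mE.
Qed.

End product_measure_ext.

(** Derivatives are assembled below from the calculus rules, which give point-free functions and raw
    values; this lemma recasts both. *)
Lemma is_derive1_ext (R : realType) (f g : R -> R) (x df dg : R) :
  is_derive x 1 f df -> f =1 g -> df = dg -> is_derive x 1 g dg.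
Proof. by move=> + /funext <- <-. Qed.

(** * The substitution that straightens the GEV law *)

Section gev_substitution.
Context {R : realType}.
Notation leb := (@lebesgue_measure R).
Variables (mu sigma xi : R).

Let z x := (x - mu) / sigma.

(* the logarithm of [(1 + xi * z) `^ (- xi^-1)], resp. of [expR (- z)] *)
Definition gev_log x :=
  if xi == 0 then - ((x - mu) / sigma)
  else - (xi^-1 * ln (1 + xi * ((x - mu) / sigma))).

Definition gev_supp x := 0 < 1 + xi * ((x - mu) / sigma).

(** Minus the derivative of [gev_log] on the support, that is [1 / (sigma * (1 + xi * z))]. The
    exponential form covers [xi = 0] and merges with [gev_u = expR gev_log] into a single
    exponential. *)
Definition gev_rate x :=
  if gev_supp x then sigma^-1 * expR (xi * gev_log x) else 0.

Definition gev_log_inv v :=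
  if xi == 0 then mu - sigma * v
  else mu + sigma * ((expR (- (xi * v)) - 1) / xi).

Hypothesis sigma0 : 0 < sigma.

Let sigman0 : sigma != 0. Proof. by rewrite gt_eqF. Qed.

Let ln_gev x : gev_supp x -> xi * gev_log x = - ln (1 + xi * z x).
Proof.
rewrite /gev_supp /gev_log; have [->|xi0] := eqVneq xi 0.
  by rewrite !mul0r addr0 ln1 oppr0.
by move=> _; rewrite mulrN mulrA divff// mul1r.
Qed.

Let expR_gev x : gev_supp x -> expR (xi * gev_log x) = (1 + xi * z x)^-1.
Proof. by move=> Dx; rewrite ln_gev// expRN lnK. Qed.

Let gev_inv v : 1 + xi * z (gev_log_inv v) = expR (- (xi * v)).
Proof.
rewrite /z /gev_log_inv; have [->|xi0] := eqVneq xi 0.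
  by rewrite !mul0r addr0 oppr0 expR0.
by field; rewrite xi0 sigman0.
Qed.

Lemma measurable_gev_log : measurable_fun setT gev_log.
Proof.
rewrite /gev_log; have [_|_] := eqVneq xi 0.
  apply: measurableT_comp => //; apply: measurable_funM => //.
  by apply: measurable_funB => //.
apply: measurableT_comp => //; apply: measurable_funM => //.
apply: (measurableT_comp (@measurable_ln R)); apply: measurable_funD => //.
apply: measurable_funM => //; apply: measurable_funM => //.
by apply: measurable_funB => //.
Qed.

Lemma measurable_gev_rate : measurable_fun setT gev_rate.
Proof.
apply: measurable_fun_ifT => //.
  apply: measurable_fun_ltr => //; apply: measurable_funD => //.
  apply: measurable_funM => //; apply: measurable_funM => //.
  by apply: measurable_funB => //.
apply: measurable_funM => //; apply: (measurableT_comp (@measurable_expR R)).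
by apply: measurable_funM => //; exact: measurable_gev_log.
Qed.

Lemma gev_rate_ge0 x : 0 <= gev_rate x.
Proof.
rewrite /gev_rate; case: ifP => // _.
by rewrite mulr_ge0// ?expR_ge0// invr_ge0 ltW.
Qed.

Let is_derive_gev_log x : gev_supp x ->
  is_derive x 1 gev_log (- (sigma^-1 * (1 + xi * z x)^-1)).
Proof.
rewrite /gev_log /gev_supp => Dx.
have dz : is_derive x 1 z sigma^-1.
  apply: (is_derive1_ext (is_deriveZ sigma^-1
    (is_deriveB (is_derive_id x 1) (is_derive_cst mu x 1)))) => /=.
    by move=> y; rewrite /z mulrC.
  by rewrite subr0 /GRing.scale/= mulr1.
have [xi0|xi0] := eqVneq xi 0.
  rewrite xi0 mul0r addr0 invr1 mulr1.
  exact: (is_derive1_ext (is_deriveN dz)).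
have d1 : is_derive x 1 (fun y => 1 + xi * z y) (xi / sigma).
  have d0 := is_deriveD (is_derive_cst (1 : R) x 1) (is_deriveZ xi dz).
  by apply: (is_derive1_ext d0); rewrite ?add0r.
have d2 : is_derive x 1 (fun y => ln (1 + xi * z y))
    ((1 + xi * z x)^-1 * (xi / sigma)).
  exact: (@is_derive1_comp _ (@ln R) (fun y => 1 + xi * z y) x _ _
    (is_derive1_ln Dx) d1).
have d3 := is_deriveN (is_deriveZ xi^-1 d2).
apply: (is_derive1_ext d3) => //; rewrite /GRing.scale/=.
by field; rewrite xi0 sigman0/= andbT; rewrite /z in Dx *; lra.
Qed.

Let gev_rateE x : gev_supp x -> gev_rate x = sigma^-1 * (1 + xi * z x)^-1.
Proof. by move=> Dx; rewrite /gev_rate Dx expR_gev. Qed.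

Lemma gev_log_invK x : gev_supp x -> gev_log_inv (gev_log x) = x.
Proof.
move=> Dx; have := ln_gev Dx; rewrite /gev_log_inv.
case: ifPn => [xi0 _|xi0 ->].
  by rewrite /gev_log xi0 mulrN opprK mulrC divfK// addrC subrK.
by rewrite opprK lnK// /z; field; rewrite xi0.
Qed.

Lemma gev_log_inv_dec a b : a < b -> gev_log_inv b < gev_log_inv a.
Proof.
move=> ab; rewrite /gev_log_inv; case: ifPn => [xi0|xi0].
    by rewrite ltrD2l ltrN2 ltr_pM2l.
  rewrite ltrD2l ltr_pM2l// !mulrBl ltrD2r.
  have [xi1|xi1|/eqP] := ltgtP xi 0; last by rewrite (negbTE xi0).
    by rewrite ltr_nM2r ?invr_lt0// ltr_expR ltrN2 ltr_nM2l.
  by rewrite ltr_pM2r ?invr_gt0// ltr_expR ltrN2 ltr_pM2l.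
Qed.

Lemma gev_log_lt x y : gev_supp x -> gev_supp y ->
  (gev_log x < gev_log y) = (y < x).
Proof.
move=> Dx Dy; have dec := gev_log_inv_dec.
apply/idP/idP => [/dec|yx]; first by rewrite !gev_log_invK.
rewrite ltNge le_eqVlt; apply/negP => /predU1P[|/dec].
  by move/(congr1 gev_log_inv); rewrite !gev_log_invK// => yx'; rewrite yx' ltxx in yx.
by rewrite !gev_log_invK// ltNge ltW.
Qed.

Lemma ge0_gev_substitution (g : R -> \bar R) :
  measurable_fun setT g -> (forall v, (0 <= g v)%E) ->
  (\int[leb]_v g v = \int[leb]_x ((gev_rate x)%:E * g (gev_log x)))%E.
Proof.
move=> mg g0.
apply: (@ge0_decreasing_substitution _ gev_supp gev_rate gev_log gev_log_inv) => //.
- exact: measurable_gev_rate.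
- exact: measurable_gev_log.
- exact: gev_rate_ge0.
- by move=> x /negP Dx; rewrite /gev_rate ifN.
- by move=> v; rewrite /gev_supp [X in _ < X]gev_inv expR_gt0.
- move=> v; rewrite /gev_log; case: ifPn => [xi0|xi0].
    by rewrite /gev_log_inv xi0; field.
  by rewrite [X in ln X]gev_inv expRK mulrN opprK mulrA mulVf// mul1r.
- exact: gev_log_invK.
- exact: gev_log_inv_dec.
(* [1 + xi * z] is monotone in [x], in a direction given by the sign of [xi], so one of the two end
   points already forces [x] into the support. *)
- move=> a b x /andP[bx xa].
  have h c : 0 < 1 + xi * z (gev_log_inv c) by rewrite gev_inv expR_gt0.
  have [xi0|xi0] := leP 0 xi.
    apply: (lt_le_trans (h b)); rewrite lerD2l ler_wpM2l// ler_pM2r ?invr_gt0//.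
    by rewrite lerD2r.
  apply: (lt_le_trans (h a)); rewrite lerD2l ler_nM2l// ler_pM2r ?invr_gt0//.
  by rewrite lerD2r.
- by move=> x Dx; rewrite gev_rateE//; exact: is_derive_gev_log.
- move=> x Dx.
  have cL : {for x, continuous gev_log}.
    apply/differentiable_continuous/derivable1_diffP.
    by have [] := is_derive_gev_log Dx.
  have cz : {for x, continuous (fun y => 1 + xi * z y)}.
    apply: cvgD; first exact: cvg_cst.
    apply: cvgM; first exact: cvg_cst.
    apply: cvgM; last exact: cvg_cst.
    by apply: cvgB; [exact: cvg_id|exact: cvg_cst].
  rewrite /prop_for /continuous_at /gev_rate Dx.
  have : sigma^-1 * expR (xi * gev_log y) @[y --> x] -->
         sigma^-1 * expR (xi * gev_log x).
    apply: cvgM; first exact: cvg_cst.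
    apply: (@cvg_comp _ _ _ (fun y => xi * gev_log y) expR); last first.
      exact: continuous_expR.
    by apply: cvgM; first exact: cvg_cst.
  (* The support is open, so the test in [gev_rate] is true near [x]. *)
  apply: cvg_trans; apply: near_eq_cvg.
  have nD := cvgr_gt _ cz 0 Dx.
  near=> y; rewrite ifT//; near: y.
  exact: nD.
Unshelve. all: by end_near. Qed.

End gev_substitution.

Section lebesgue_substitutions.
Context {R : realType}.
Notation leb := (@lebesgue_measure R).
Local Open Scope ereal_scope.

(** For [mu = c], [sigma = 1], [xi = 0] the map [gev_log] is the reflection [x -> c - x], of rate
    one. *)
Lemma ge0_integral_reflect (c : R) (g : R -> \bar R) :
  measurable_fun setT g -> (forall v, 0 <= g v) ->
  \int[leb]_x g (c - x)%R = \int[leb]_v g v.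
Proof.
move=> mg g0; rewrite (ge0_gev_substitution c 0 ltr01 mg g0).
apply: eq_integral => x _.
rewrite /gev_rate /gev_supp /gev_log !mul0r addr0 ltr01 eqxx !invr1 expR0.
by rewrite mulr1 mul1e mulr1 opprB.
Qed.

(** A translation is a composition of two reflections. *)
Lemma ge0_integral_shift (c : R) (g : R -> \bar R) :
  measurable_fun setT g -> (forall v, 0 <= g v) ->
  \int[leb]_x g (x + c)%R = \int[leb]_v g v.
Proof.
move=> mg g0; rewrite -[RHS](ge0_integral_reflect c mg g0).
pose h x := g (c - x)%R.
have mh : measurable_fun setT h.
  by apply: measurableT_comp => //; exact: measurable_funB.
transitivity (\int[leb]_x h (0 - x)%R).
  by apply: eq_integral => x _; rewrite /h sub0r opprK addrC.
exact: (ge0_integral_reflect 0 mh (fun v => g0 _)).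
Qed.

(** For [mu = sigma = xi = 1] the support is [0 < x], [gev_log] is [- ln] and the rate is [x^-1]; a
    reflection corrects the sign. *)
Lemma ge0_integral_expR (g : R -> \bar R) :
  measurable_fun setT g -> (forall v, 0 <= g v) ->
  \int[leb]_(u in `]0%R, +oo[) g u = \int[leb]_v ((expR v)%:E * g (expR v)).
Proof.
move=> mg g0.
have mh : measurable_fun setT (fun v => (expR v)%:E * g (expR v)).
  apply: emeasurable_funM; first exact/measurable_EFinP.
  exact: measurableT_comp.
have h0 v : 0 <= (expR v)%:E * g (expR v).
  by rewrite mule_ge0// lee_fin expR_ge0.
rewrite -(ge0_integral_reflect 0 mh h0).
pose h v := (expR (0 - v))%:E * g (expR (0 - v)).
have mh' : measurable_fun setT h.
  by apply: (measurableT_comp mh); exact: measurable_funB.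
rewrite [RHS](ge0_gev_substitution 1 1 ltr01 mh')//; last by move=> v; exact: h0.
rewrite /h.
rewrite integral_mkcond; apply: eq_integral => x _; rewrite patchE.
rewrite /gev_rate /gev_supp /gev_log oner_eq0 !mul1r !invr1 !mulr1 !mul1r.
rewrite addrC subrK sub0r mem_setE in_itv/= andbT.
case: ifPn => [x0|_]; last by rewrite mul0e.
rewrite opprK muleA -EFinM -expRD addNr expR0 mul1e lnK//.
Qed.

End lebesgue_substitutions.

(** * Moments of the normal distribution *)

Section normal_moments.
Context {R : realType}.
Notation leb := (@lebesgue_measure R).

Lemma ge0_integral_normal_prob (m s : R) (f : R -> \bar R) :
  measurable_fun setT f -> (forall x, 0 <= f x)%E ->
  (\int[normal_prob m s]_x f x = \int[leb]_x (f x * (normal_pdf m s x)%:E))%E.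
Proof.
move=> mf f0.
rewrite (@ge0_integral_weighted_image _ _ _ _ _ leb (normal_prob m s)
  (normal_pdf m s) idfun)//.
- by apply: eq_integral => x _; rewrite muleC.
- exact: normal_pdf_ge0.
- exact: measurable_normal_pdf.
- exact: measurable_id.
- move=> A mA; rewrite /normal_prob/= [LHS]integral_mkcond; apply: eq_integral => x _.
  by rewrite epatch_indic/= EFinM muleC.
Qed.

Lemma normal_peak_gt0E (s : R) : 0 < s ->
  normal_peak s = (s * Num.sqrt (pi *+ 2))^-1.
Proof.
move=> s0; rewrite /normal_peak; congr (_^-1).
by rewrite -mulrnAr sqrtrM ?sqr_ge0// sqrtr_sqr gtr0_norm.
Qed.

Let sqrt2pi : Num.sqrt (pi *+ 2) != 0 :> R.
Proof. by rewrite gt_eqF// sqrtr_gt0 pmulrn_lgt0// pi_gt0. Qed.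

Lemma normal_pdf_gt0E (m s x : R) : 0 < s -> normal_pdf m s x =
  (s * Num.sqrt (pi *+ 2))^-1 * expR (- (x - m) ^+ 2 / (s ^+ 2 *+ 2)).
Proof.
by move=> s0; rewrite normal_pdfE ?gt_eqF// normal_peak_gt0E.
Qed.

Lemma normal_pdfN (s x : R) : 0 < s -> normal_pdf 0 s (- x) = normal_pdf 0 s x.
Proof. by move=> s0; rewrite !normal_pdf_gt0E// !subr0 sqrrN. Qed.

(* completing the square in [y] *)
Lemma normal_pdf_conv (s1 s2 s y z : R) : 0 < s1 -> 0 < s2 -> 0 < s ->
  s ^+ 2 = s1 ^+ 2 + s2 ^+ 2 ->
  normal_pdf 0 s1 y * normal_pdf 0 s2 (z - y) =
  normal_pdf 0 s z * normal_pdf (z * s1 ^+ 2 / s ^+ 2) (s1 * s2 / s) y.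
Proof.
move=> s10 s20 s0 sE.
have s'0 : 0 < s1 * s2 / s by rewrite divr_gt0// mulr_gt0.
rewrite !normal_pdf_gt0E// [in LHS]mulrACA [in RHS]mulrACA -!expRD !subr0.
congr (_ * expR _).
  by field; rewrite sqrt2pi !gt_eqF.
rewrite !exprMn !exprVn sE; field.
by rewrite -sE expf_neq0 !gt_eqF.
Qed.

(** Variances add under convolution. After the shift [z -> z - y] and Tonelli, [normal_pdf_conv]
    leaves a normal density in [y], which integrates to one. *)
Lemma ge0_normal_prob_conv (s1 s2 s : R) (f : R -> \bar R) (x : R) :
  0 < s1 -> 0 < s2 -> 0 < s -> s ^+ 2 = s1 ^+ 2 + s2 ^+ 2 ->
  measurable_fun setT f -> (forall x, 0 <= f x)%E ->
  (\int[normal_prob 0 s1]_y \int[normal_prob 0 s2]_z f (x + y + z)%R =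
   \int[normal_prob 0 s]_z f (x + z)%R)%E.
Proof.
move=> s10 s20 s0 sE mf f0.
have mfx (c : R) : measurable_fun setT (fun z => f (c + z)%R).
  by apply: (measurableT_comp mf); exact: measurable_funD.
have mpdf (m t : R) : measurable_fun setT (fun z => (normal_pdf m t z)%:E).
  by apply/measurable_EFinP; exact: measurable_normal_pdf.
pose F (p : R * R) := (f (x + p.2)%R *
  (normal_pdf 0 s1 p.1 * normal_pdf 0 s2 (p.2 - p.1))%:E)%E.
have mF : measurable_fun setT F.
  apply: emeasurable_funM; first by apply: (measurableT_comp (mfx x)).
  apply/measurable_EFinP; apply: measurable_funM.
    by apply: (measurableT_comp (measurable_normal_pdf _ _)).
  apply: (measurableT_comp (measurable_normal_pdf _ _)) => //.
  exact: measurable_funB.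
have F0 p : (0 <= F p)%E.
  by rewrite mule_ge0// lee_fin mulr_ge0// normal_pdf_ge0.
have inner (y : R) : (\int[normal_prob 0 s2]_z f (x + y + z)%R *
    (normal_pdf 0 s1 y)%:E = \int[leb]_z F (y, z))%E.
  rewrite ge0_integral_normal_prob//.
  rewrite -(ge0_integral_shift (- y) (g := fun z => f (x + y + z)%R *
    (normal_pdf 0 s2 z)%:E)%E)//; last 2 first.
  - by apply: emeasurable_funM.
  - by move=> z; rewrite mule_ge0// lee_fin normal_pdf_ge0.
  rewrite muleC -ge0_integralZl//; last 3 first.
  - apply: emeasurable_funM.
      apply: (measurableT_comp (mfx _)); exact: measurable_funB.
    apply/measurable_EFinP; apply: (measurableT_comp (measurable_normal_pdf _ _)).
    exact: measurable_funB.
  - by move=> z _; rewrite mule_ge0// lee_fin normal_pdf_ge0.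
  - by rewrite lee_fin normal_pdf_ge0.
  apply: eq_integral => z _; rewrite /F/= muleCA -EFinM.
  by congr (f _ * _)%E; rewrite addrACA subrr addr0 addrC.
rewrite ge0_integral_normal_prob//; last 2 first.
- pose G (p : R * R) := f (x + p.1 + p.2)%R.
  have mG : measurable_fun setT G.
    apply: (measurableT_comp mf); apply: measurable_funD => //.
    by apply: measurable_funD.
  have := measurable_fun_fubini_tonelli_F (m2 := normal_prob 0 s2) G mG.
  by apply => p; exact: f0.
- by move=> y; apply: integral_ge0.
under eq_integral do rewrite inner.
transitivity (\int[leb]_z \int[leb]_y F (y, z))%E.
  exact: (fubini_tonelli (m1 := leb) (m2 := leb) F mF F0).
rewrite ge0_integral_normal_prob//; apply: eq_integral => z _.
rewrite /F/=.
under eq_integral do rewrite (normal_pdf_conv _ _ s10 s20 s0 sE).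
rewrite ge0_integralZl//; last 2 first.
- apply/measurable_EFinP; apply: measurable_funM => //.
  exact: measurable_normal_pdf.
- by move=> y _; rewrite lee_fin mulr_ge0// normal_pdf_ge0.
congr (_ * _)%E.
under eq_integral do rewrite EFinM.
rewrite ge0_integralZl//; last 3 first.
- exact: mpdf.
- by move=> y _; rewrite lee_fin normal_pdf_ge0.
- by rewrite lee_fin normal_pdf_ge0.
by rewrite integral_normal_pdf mule1.
Qed.

Variable s : R.
Hypothesis s0 : 0 < s.

Let p := normal_pdf 0 s.
Let p_ge0 x : 0 <= p x. Proof. exact: normal_pdf_ge0. Qed.
Let sn0 : s != 0. Proof. by rewrite gt_eqF. Qed.
Let cp : continuous p. Proof. exact: continuous_normal_pdf. Qed.
Let mp : measurable_fun setT p. Proof. exact: measurable_normal_pdf. Qed.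
Let mE (f : R -> R) : measurable_fun setT f ->
  measurable_fun setT (fun x : R => (f x)%:E).
Proof. by move=> mf; exact/measurable_EFinP. Qed.

Let mem_ge0 (y : R) : (y \in [set x : R | 0 <= x]) = (0 <= y).
Proof. by apply/idP/idP; rewrite inE. Qed.

Let is_derive_p (x : R) : is_derive x 1 (fun y => - p y) (x / s ^+ 2 * p x).
Proof.
pose c : R := - (s ^+ 2 *+ 2)^-1.
have d1 := is_deriveZ c (is_deriveX 2 (is_derive_id x (1 : R))).
have d2 := @is_derive1_comp _ (@expR R) (c \*: (id : R -> R) ^+ 2) x _ _
    (is_derive_expR _) d1.
have d3 := is_deriveN (is_deriveZ ((s * Num.sqrt (pi *+ 2))^-1) d2).
apply: (is_derive1_ext d3) => [y|].
  rewrite /p normal_pdf_gt0E// !fctE subr0; congr (- (_ * expR _)).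
  by rewrite -[LHS]/(c * y ^+ 2) /c mulNr mulrC mulNr.
rewrite /p normal_pdf_gt0E// !fctE subr0 /GRing.scale/= /c.
rewrite (_ : - x ^+ 2 / (s ^+ 2 *+ 2) = - (s ^+ 2 *+ 2)^-1 * x ^+ 2).
  by move: (expR _) => e; field; rewrite sn0 sqrt2pi.
by rewrite mulrC mulrN mulNr.
Qed.

Let p_cvg0 : - p x @[x --> +oo] --> (0 : R).
Proof.
rewrite -oppr0; apply: cvgN.
(* Since [(x / s - s) ^+ 2 >= 0], the exponent of the density is at most [s ^+ 2 / 2 - x]; the
   constant part goes into [C]. *)
pose C := (s * Num.sqrt (pi *+ 2))^-1 * expR (s ^+ 2 / 2).
have C0 : C * expR (- x) @[x --> +oo] --> (0 : R).
  by rewrite -[0](mulr0 C); apply: cvgM; [exact: cvg_cst|exact: cvgr_expR].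
apply: (squeeze_cvgr _ (cvg_cst 0) C0); near=> x.
rewrite p_ge0/= /p normal_pdf_gt0E// subr0 /C -mulrA -expRD.
rewrite ler_wpM2l ?ler_expR//.
  by rewrite invr_ge0 mulr_ge0// ltW.
rewrite -subr_ge0.
have -> : s ^+ 2 / 2 - x - - x ^+ 2 / (s ^+ 2 *+ 2) = (x / s - s) ^+ 2 / 2.
  by field.
by rewrite divr_ge0// sqr_ge0.
Unshelve. all: by end_near. Qed.

(** The integrand is the derivative of [- p], and [p] vanishes at infinity. It is nonnegative only
    on the half-line [0 <= t], whence the alternative. *)
Let tail_p (y : R) : (\int[leb]_(t in `]y, +oo[) (t / s ^+ 2 * p t)%:E = (p y)%:E)%E
  \/ y < 0.
Proof.
have [y0|] := leP 0 y; [left|by right].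
have cq : continuous (fun t : R => t / s ^+ 2 * p t).
  move=> t; apply: cvgM; last exact: cp.
  by apply: cvgM; [exact: cvg_id|exact: cvg_cst].
have cF x : {for x, continuous (fun y => - p y)}.
  by apply/differentiable_continuous/derivable1_diffP; have [] := is_derive_p x.
rewrite integral_itv_obnd_cbnd; last first.
  by apply/measurable_EFinP/measurable_funTS; exact: continuous_measurable_fun.
rewrite (@ge0_continuous_FTC2y _ _ (fun y => - p y) y 0)//.
- by rewrite -EFinB sub0r opprK.
- move=> x yx; rewrite mulr_ge0// divr_ge0 ?exprn_ge0 ?(ltW s0)//.
  exact: le_trans yx.
- exact: continuous_subspaceT.
- by move=> x _; have [] := is_derive_p x.
- by apply: cvg_at_right_filter; exact: cF.
- by move=> x _; rewrite derive1E; have := is_derive_p x => ?; rewrite derive_val.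
Qed.

Lemma normal_prob_ge0_half (f : R -> R) : continuous f -> (forall x, 0 <= f x) ->
  f =1 f \o -%R ->
  (\int[normal_prob 0 s]_x (f x)%:E =
   2%:E * \int[leb]_(x in [set x | (0 <= x)%R]) (f x * p x)%:E)%E.
Proof.
move=> cf f0 ef.
rewrite ge0_integral_normal_prob//; last first.
  by apply: mE; exact: continuous_measurable_fun.
transitivity (\int[leb]_x (f x * p x)%:E)%E; first by apply: eq_integral.
rewrite (@ge0_symfun_integralT _ (fun x => f x * p x))//.
- by move=> x; rewrite mulr_ge0.
- by move=> x; apply: cvgM; [exact: cf|exact: cp].
- by move=> x /=; rewrite /p normal_pdfN// ef.
Qed.

(** Tonelli replaces integration by parts. Integrate [q t = t / s ^+ 2 * p t] over [0 <= y < t]: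
    integrating [t] first leaves [p y], of mass one half on the half-line; integrating [y] first
    leaves [t * q t = t ^+ 2 / s ^+ 2 * p t]. *)
Lemma normal_prob_sqr : (\int[normal_prob 0 s]_x (x ^+ 2)%:E = (s ^+ 2)%:E)%E.
Proof.
have s20 : 0 < s ^+ 2 by rewrite exprn_gt0.
rewrite (@normal_prob_ge0_half (fun x => x ^+ 2)); first last.
- by move=> x /=; rewrite sqrrN.
- by move=> x; exact: sqr_ge0.
- exact: exprn_continuous.
pose q t := t / s ^+ 2 * p t.
have mq : measurable_fun setT q.
  by apply: measurable_funM => //; apply: measurable_funM.
pose F (z : R * R) := if 0 <= z.1 < z.2 then (q z.2)%:E else 0%E.
have mF : measurable_fun setT F.
  apply: measurable_fun_ifT => //.
    apply: measurable_and; first exact: measurable_fun_ler.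
    exact: measurable_fun_ltr.
  by apply/measurable_EFinP; exact: (measurableT_comp mq).
have F0 z : (0 <= F z)%E.
  rewrite /F; case: ifP => // /andP[z1 z2].
  by rewrite lee_fin mulr_ge0// divr_ge0 ?(ltW s20)// (le_trans z1) ?ltW.
have e1 : (\int[leb]_y \int[leb]_t F (y, t) = (2^-1)%:E)%E.
  have e1 : (2%:E * \int[leb]_(x in [set x | (0 <= x)%R]) (cst 1%R x * p x)%:E = 1)%E.
    rewrite -(@normal_prob_ge0_half (cst 1))//; last exact: cst_continuous.
    transitivity (\int[normal_prob 0 s]_x (cst 1%E x))%E => //.
    by rewrite integral_cst// mul1e; exact: (@probability_setT _ _ _ (normal_prob 0 s)).
  rewrite -[RHS]mule1 -[X in _ = (_ * X)%E]e1 muleA -EFinM mulVf// mul1e.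
  rewrite [RHS]integral_mkcond; apply: eq_integral => y _.
  rewrite patchE mem_ge0 /F/=; have [y0|y0] := leP 0 y; last first.
    by rewrite integral0_eq.
  rewrite mul1r; have [<-|] := tail_p y; last by rewrite ltNge y0.
  rewrite [RHS]integral_mkcond; apply: eq_integral => t _.
  by rewrite patchE mem_setE in_itv/= andbT.
have e2 : (\int[leb]_y \int[leb]_t F (y, t) = (s ^- 2)%:E *
   \int[leb]_(x in [set x | (0 <= x)%R]) (x ^+ 2 * p x)%:E)%E.
  have -> : (\int[leb]_y \int[leb]_t F (y, t) = \int[leb]_t \int[leb]_y F (y, t))%E.
    exact: (fubini_tonelli (m1 := leb) (m2 := leb) F mF F0).
  have mD : measurable ([set x | (0 <= x)%R] : set (measurableTypeR R)).
    by rewrite -set_itvcy; exact: measurable_itv.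
  rewrite -ge0_integralZl//; last 3 first.
  - apply/measurable_EFinP/measurable_funTS/measurable_funM => //.
    by move=> x _; rewrite lee_fin mulr_ge0// sqr_ge0.
  - by rewrite lee_fin invr_ge0 ltW.
  rewrite [RHS]integral_mkcond; apply: eq_integral => t _.
  rewrite patchE mem_ge0 /F/=.
  transitivity (\int[leb]_(y in `[0%R, t[) (q t)%:E)%E.
    rewrite [RHS]integral_mkcond; apply: eq_integral => y _.
    by rewrite patchE mem_setE in_itv.
  rewrite integral_cst//= lebesgue_measure_itv/= lte_fin.
  case: (ltgtP 0 t) => [t0|t0|<-].
  - by rewrite -EFinB subr0 -!EFinM; congr (_%:E); rewrite /q; field.
  - by rewrite mule0.
  - by rewrite mule0 expr0n/= mul0r mule0.
rewrite e1 in e2.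
have : ((s ^+ 2)%:E * (2^-1)%:E = (s ^+ 2)%:E * ((s ^- 2)%:E *
   \int[leb]_(x in [set x | (0 <= x)%R]) (x ^+ 2 * p x)%:E))%E by rewrite -e2.
rewrite muleA -[(_ * (s ^- 2)%:E)%E]EFinM mulfV ?gt_eqF// mul1e => <-.
by rewrite -!EFinM mulrCA mulfV ?mulr1.
Qed.

(** Only the order [s ^+ 3] matters. The factor [|x| ^+ 3] is absorbed by doubling the standard
    deviation: the integrand is at most [30 * s ^+ 3] times the density of [N(0, (2 s)^2)]. *)
Lemma normal_prob_norm3 :
  (\int[normal_prob 0 s]_x (`|x| ^+ 3)%:E <= (30 * s ^+ 3)%:E)%E.
Proof.
have s20 : 0 < 2 * s by rewrite mulr_gt0.
have mn : measurable_fun setT (fun x : R => `|x| ^+ 3).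
  by apply: measurable_funX; exact: normr_measurable.
rewrite ge0_integral_normal_prob//; last exact: mE.
apply: (@le_trans _ _ (\int[leb]_x ((30 * s ^+ 3)%:E * (normal_pdf 0 (2 * s) x)%:E))%E); last first.
  rewrite ge0_integralZl//; first by rewrite integral_normal_pdf mule1.
  - by apply: mE; exact: measurable_normal_pdf.
  - by move=> x _; rewrite lee_fin normal_pdf_ge0.
  - by rewrite lee_fin mulr_ge0// exprn_ge0// ltW.
apply: ge0_le_integral => //.
- by move=> x _; rewrite mule_ge0 ?lee_fin ?exprn_ge0.
- by apply: emeasurable_funM; exact: mE.
- by apply: measurable_funeM; apply: mE; exact: measurable_normal_pdf.
move=> x _; rewrite -!EFinM lee_fin /p !normal_pdf_gt0E// !subr0.
pose w := `|x| / s; have w0 : 0 <= w by rewrite divr_ge0// ltW.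
have xw : `|x| = s * w by rewrite /w mulrC divfK.
have x2 : x ^+ 2 = (s * w) ^+ 2 by rewrite -xw real_normK// num_real.
rewrite xw x2.
have -> : - (s * w) ^+ 2 / (s ^+ 2 *+ 2) = - (w ^+ 2 / 2) by field.
have -> : - (s * w) ^+ 2 / ((2 * s) ^+ 2 *+ 2) = - (w ^+ 2 / 8) by field.
have e0 : 0 < expR (- (w ^+ 2 / 2)) by exact: expR_gt0.
have -> : expR (- (w ^+ 2 / 8)) = expR (- (w ^+ 2 / 2)) * expR (3 * w ^+ 2 / 8).
  by rewrite -expRD; congr expR; field.
have hw := @expR_ge1Dxn R (3 * w ^+ 2 / 8) 1.
have h1 : 1 + (3 * w ^+ 2 / 8) ^+ 2 / 2 <= expR (3 * w ^+ 2 / 8).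
  by apply: hw; rewrite divr_ge0// mulr_ge0// sqr_ge0.
have h2 : w ^+ 3 <= 1 + w ^+ 4 by nra.
(* The constant 15 works because [15 * 9 / 128 > 1]; the ratio 2 of the two peaks turns it into
   30. *)
have h3 : w ^+ 3 <= 15 * expR (3 * w ^+ 2 / 8).
  apply: (le_trans h2).
  have w4 : 0 <= w ^+ 4 by rewrite exprn_ge0.
  have e4 : (3 * w ^+ 2 / 8) ^+ 2 / 2 = 9 / 128 * w ^+ 4 by field.
  rewrite e4 in h1; lra.
have c0 : 0 < (s * Num.sqrt (pi *+ 2))^-1.
  by rewrite invr_gt0 mulr_gt0// lt_neqAle eq_sym sqrt2pi sqrtr_ge0.
have -> : (2 * s * Num.sqrt (pi *+ 2))^-1 = (s * Num.sqrt (pi *+ 2))^-1 / 2.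
  by field; rewrite sqrt2pi.
have s3 : 0 < s ^+ 3 by rewrite exprn_gt0.
rewrite exprMn.
have -> : 30 * s ^+ 3 * ((s * Num.sqrt (pi *+ 2))^-1 / 2 *
    (expR (- (w ^+ 2 / 2)) * expR (3 * w ^+ 2 / 8))) =
  s ^+ 3 * (15 * expR (3 * w ^+ 2 / 8)) *
    ((s * Num.sqrt (pi *+ 2))^-1 * expR (- (w ^+ 2 / 2))).
  by field; rewrite sqrt2pi.
by rewrite ler_pM2r ?mulr_gt0// ler_pM2l.
Qed.

(** Reflection exchanges the positive and negative parts. Their common integral is finite, by
    [x <= 1 + x ^+ 2], so the difference is really zero. *)
Lemma normal_prob_mean0 : (\int[normal_prob 0 s]_x x%:E = 0)%E.
Proof.
have mx : measurable_fun setT (fun x : R => x%:E) by exact: mE.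
have fin : (\int[normal_prob 0 s]_x (fun x : R => x%:E)^\+%E x \is a fin_num)%E.
  rewrite ge0_fin_numE; last by apply: integral_ge0.
  apply: (@le_lt_trans _ _ (\int[normal_prob 0 s]_x (1%:E + (x ^+ 2)%:E))%E).
    apply: ge0_le_integral => //.
    - exact: measurable_funepos.
    - by apply: mE; apply: measurable_funD => //; exact: measurable_funX.
    - move=> x _; rewrite funeposE -EFinD -[X in maxe _ X]/(0%:E).
      rewrite -EFin_max lee_fin ge_max; apply/andP; split; nra.
  rewrite ge0_integralD//; last 2 first.
  - by move=> x _; rewrite lee_fin sqr_ge0.
  - by apply: mE; exact: measurable_funX.
  have -> : (\int[normal_prob 0 s]_x 1%:E = 1)%E.
    transitivity (\int[normal_prob 0 s]_x (cst 1%E x))%E => //.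
    by rewrite integral_cst// mul1e; exact: (@probability_setT _ _ _ (normal_prob 0 s)).
  by rewrite normal_prob_sqr -EFinD ltry.
rewrite integralE.
suff <- : (\int[normal_prob 0 s]_x (fun x : R => x%:E)^\+%E x =
           \int[normal_prob 0 s]_x (fun x : R => x%:E)^\-%E x)%E.
  by rewrite subee.
rewrite !ge0_integral_normal_prob//; last 2 first.
- exact: measurable_funeneg.
- exact: measurable_funepos.
rewrite -(ge0_integral_reflect 0 (g := fun x => (fun x : R => x%:E)^\+%E x *
   (normal_pdf 0 s x)%:E)%E)//; last 2 first.
- apply: emeasurable_funM; first exact: measurable_funepos.
  exact: mE.
- by move=> x; rewrite mule_ge0// lee_fin.
apply: eq_integral => x _; rewrite sub0r normal_pdfN//.
by rewrite funeposE funenegE EFinN.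
Qed.

End normal_moments.

(** * Lindeberg's replacement argument *)

Section taylor_bounds.
Context {R : realType}.
Implicit Types (f g : R -> R) (x h K : R).

Lemma mean_value_bound g (g' : R -> R) K h : (forall t : R, is_derive t 1 g (g' t)) ->
  (forall t : R, `|t| <= `|h| -> `|g' t| <= K) -> `|g h - g 0| <= K * `|h|.
Proof.
move=> dg g'K.
have cg : continuous g.
  by move=> t; apply/differentiable_continuous/derivable1_diffP; have [] := dg t.
have [h0|h0|<-] := ltgtP 0 h; last by rewrite subrr normr0 mulr0.
- have [c /[!in_itv]/= /andP[c0 ch]] := MVT h0 (fun x _ => dg x) (continuous_subspaceT cg).
  rewrite subr0 => ->; rewrite normrM ler_wpM2r// g'K//.
  by rewrite !gtr0_norm// ltW.
- have [c /[!in_itv]/= /andP[c0 ch]] := MVT h0 (fun x _ => dg x) (continuous_subspaceT cg).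
  rewrite sub0r distrC => ->; rewrite normrM normrN ler_wpM2r// g'K//.
  by rewrite !ltr0_norm// lerN2 ltW.
Qed.

Let is_derive_shift f (f' : R -> R) (x t : R) : (forall y : R, is_derive y 1 f (f' y)) ->
  is_derive t 1 (fun t : R => f (x + t)) (f' (x + t)).
Proof.
move=> df.
have d0 := is_deriveD (is_derive_cst (x : R) t 1) (is_derive_id t (1 : R)).
have d1 := @is_derive1_comp _ f (fun t : R => x + t) t _ _ (df (x + t)) d0.
by apply: (is_derive1_ext d1) => //; rewrite add0r mulr1.
Qed.

Lemma taylor1_bound f f1 K x h : (forall y : R, is_derive y 1 f (f1 y)) ->
  (forall y, `|f1 y| <= K) -> `|f (x + h) - f x| <= K * `|h|.
Proof.
move=> df f1K.
have := @mean_value_bound (fun t : R => f (x + t)) _ K h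
  (fun t => is_derive_shift x t df) (fun t _ => f1K _).
by rewrite addr0.
Qed.

(** The mean value theorem is applied to the remainder, whose derivative is bounded by the previous
    order. This loses the factorial in the constant, which is harmless here. *)
Lemma taylor2_bound f f1 f2 K x h : (forall y : R, is_derive y 1 f (f1 y)) ->
  (forall y : R, is_derive y 1 f1 (f2 y)) ->
  (forall y, `|f2 y| <= K) -> `|f (x + h) - f x - f1 x * h| <= K * `|h| ^+ 2.
Proof.
move=> df df1 f2K.
have dg (t : R) : is_derive t 1 (fun t : R => f (x + t) - f1 x * t) (f1 (x + t) - f1 x).
  have d := is_deriveB (is_derive_shift x t df)
    (is_deriveZ (f1 x) (is_derive_id t (1 : R))).
  by apply: (is_derive1_ext d) => //; rewrite /GRing.scale/= mulr1.
have K0 : 0 <= K by apply: le_trans (f2K 0).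
have := @mean_value_bound _ _ (K * `|h|) h dg.
rewrite addr0 mulr0 subr0 expr2 mulrA addrAC; apply => t th.
by apply: (le_trans (taylor1_bound x t df1 f2K)); rewrite ler_wpM2l.
Qed.

Lemma taylor3_bound f f1 f2 f3 K x h : (forall y : R, is_derive y 1 f (f1 y)) ->
  (forall y : R, is_derive y 1 f1 (f2 y)) -> (forall y : R, is_derive y 1 f2 (f3 y)) ->
  (forall y, `|f3 y| <= K) ->
  `|f (x + h) - f x - f1 x * h - f2 x * (h ^+ 2 / 2)| <= K * `|h| ^+ 3.
Proof.
move=> df df1 df2 f3K.
have dg (t : R) : is_derive t 1 (fun t : R => f (x + t) - f1 x * t - f2 x * (t ^+ 2 / 2))
    (f1 (x + t) - f1 x - f2 x * t).
  have d1 := is_deriveB (is_derive_shift x t df)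
    (is_deriveZ (f1 x) (is_derive_id t (1 : R))).
  have d := is_deriveB d1
    (is_deriveZ (f2 x) (is_deriveZ (2^-1 : R) (is_deriveX 2 (is_derive_id t (1 : R))))).
  apply: (is_derive1_ext d) => [y|].
    by rewrite !fctE; congr (_ - _ * _); exact: mulrC.
  by rewrite /GRing.scale/=; field.
have K0 : 0 <= K by apply: le_trans (f3K 0).
have := @mean_value_bound _ _ (K * `|h| ^+ 2) h dg.
rewrite addr0 !mulr0 expr0n/= mul0r mulr0 !subr0.
have -> : f (x + h) - f x - f1 x * h - f2 x * (h ^+ 2 / 2) =
  f (x + h) - f1 x * h - f2 x * (h ^+ 2 / 2) - f x by ring.
rewrite (_ : K * `|h| ^+ 3 = K * `|h| ^+ 2 * `|h|); last by rewrite -mulrA -exprSr.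
apply => t th.
apply: (le_trans (taylor2_bound x t df1 df2 f3K)); rewrite ler_wpM2l//.
by rewrite lerXn2r// nnegrE.
Qed.

End taylor_bounds.

(** * Logistic test functions *)

Section logistic.
Context {R : realType}.
Variables (k c : R).
Hypothesis k0 : 0 < k.

(** This curve decreases from 1 to 0 around [c]. As [s' = - k * s * (1 - s)], all derivatives are
    polynomials in [s] and are bounded by powers of the steepness [k]. *)
Definition logistic (x : R) : R := (1 + expR (k * (x - c)))^-1.

Let s := logistic.
Let e0 x : 0 < expR (k * (x - c)). Proof. exact: expR_gt0. Qed.

Lemma logistic_gt0 x : 0 < s x.
Proof. by rewrite invr_gt0 addr_gt0. Qed.

Lemma logistic_lt1 x : s x < 1.
Proof. by rewrite invf_lt1 ?addr_gt0// ltrDl. Qed.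

Definition logistic1 x := - k * (s x * (1 - s x)).
Definition logistic2 x := k ^+ 2 * (s x * (1 - s x) * (1 - 2 * s x)).
Definition logistic3 x :=
  - k ^+ 3 * (s x * (1 - s x) * (1 - 6 * s x * (1 - s x))).

Lemma is_derive_logistic (x : R) : is_derive x 1 s (logistic1 x).
Proof.
have d0 : is_derive x 1 (fun y : R => k * (y - c)) k.
  have d := is_deriveZ k
    (is_deriveB (is_derive_id x (1 : R)) (is_derive_cst (c : R) x 1)).
  by apply: (is_derive1_ext d) => //; rewrite subr0 /GRing.scale/= mulr1.
have d1 := @is_derive1_comp _ (@expR R) (fun y : R => k * (y - c)) x _ _
  (is_derive_expR _) d0.
have d2 := is_deriveD (is_derive_cst (1 : R) x 1) d1.
have n0 : (cst (1:R) + (expR \o (fun y : R => k * (y - c)))) x != 0.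
  by rewrite gt_eqF// !fctE addr_gt0.
have d3 := is_deriveV n0 d2.
apply: (is_derive1_ext d3) => //.
rewrite /logistic1 /s /logistic /GRing.scale/= !fctE add0r.
by field; rewrite gt_eqF// addr_gt0.
Qed.

Lemma is_derive_logistic1 (x : R) : is_derive x 1 logistic1 (logistic2 x).
Proof.
have d := is_derive_logistic x.
have d1 := is_deriveZ (- k) (is_deriveM d (is_deriveB (is_derive_cst (1 : R) x 1) d)).
apply: (is_derive1_ext d1) => //.
by rewrite /logistic2 /logistic1 /GRing.scale/= !fctE; ring.
Qed.

Lemma is_derive_logistic2 (x : R) : is_derive x 1 logistic2 (logistic3 x).
Proof.
have d := is_derive_logistic x.
have d1 := is_deriveM d (is_deriveB (is_derive_cst (1 : R) x 1) d).
have d2 := is_deriveB (is_derive_cst (1 : R) x 1) (is_deriveZ (2 : R) d).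
have d3 := is_deriveZ (k ^+ 2) (is_deriveM d1 d2).
apply: (is_derive1_ext d3) => //.
rewrite /logistic3 /logistic1 /GRing.scale/= !fctE.
by rewrite -[(2 \*: s) x]/(2 * s x); ring.
Qed.

Let s01 x : 0 <= s x * (1 - s x) <= 4^-1.
Proof.
have := logistic_gt0 x; have := logistic_lt1 x.
rewrite -/s; move: (s x) => u u1 u0; apply/andP; split.
  by rewrite mulr_ge0// ?subr_ge0 ltW.
rewrite -subr_ge0 (_ : _ - _ = (u - 2^-1) ^+ 2) ?sqr_ge0//.
by field.
Qed.

Lemma logistic1_le x : `|logistic1 x| <= k.
Proof.
rewrite normrM normrN (gtr0_norm k0) ler_piMr// ?ltW//.
by have /andP[? ?] := s01 x; rewrite ger0_norm//; lra.
Qed.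

Lemma logistic2_le x : `|logistic2 x| <= k ^+ 2.
Proof.
rewrite normrM ger0_norm ?sqr_ge0// ler_piMr// ?sqr_ge0//.
rewrite normrM mulr_ile1//.
  by have /andP[? ?] := s01 x; rewrite ger0_norm//; lra.
have := logistic_gt0 x; have := logistic_lt1 x.
by rewrite ler_norml; lra.
Qed.

Lemma logistic3_le x : `|logistic3 x| <= k ^+ 3.
Proof.
have k30 : 0 <= k ^+ 3 by rewrite exprn_ge0// ltW.
rewrite normrM normrN (ger0_norm k30) ler_piMr//.
have /andP[? ?] := s01 x.
rewrite normrM mulr_ile1//; first by rewrite ger0_norm//; lra.
by rewrite ler_norml -mulrA; lra.
Qed.

Lemma measurable_logistic : measurable_fun setT logistic.
Proof.
apply: continuous_measurable_fun => x.
by apply/differentiable_continuous/derivable1_diffP; have [] := is_derive_logistic x.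
Qed.

Lemma measurable_logistic1 : measurable_fun setT logistic1.
Proof.
apply: continuous_measurable_fun => x.
by apply/differentiable_continuous/derivable1_diffP; have [] := is_derive_logistic1 x.
Qed.

Lemma measurable_logistic2 : measurable_fun setT logistic2.
Proof.
apply: continuous_measurable_fun => x.
by apply/differentiable_continuous/derivable1_diffP; have [] := is_derive_logistic2 x.
Qed.

End logistic.

Section bounded_integrals.
Context d (T : measurableType d) (R : realType) (P : probability T R).

Lemma bounded_integrable (f : T -> R) (M : R) : measurable_fun setT f ->
  (forall x, `|f x| <= M) -> P.-integrable setT (EFin \o f).
Proof.
move=> mf fM; apply: (@le_integrable _ _ _ P setT measurableT _ (cst M%:E)).
- exact/measurable_EFinP.
- by move=> x _; rewrite /= lee_fin (le_trans (fM x))// ler_norm.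
- by apply: finite_measure_integrable_cst.
Qed.

Lemma Rintegral_cst1 (c : R) : \int[P]_x c = c.
Proof.
have PT : fine (P [set: T]) = 1 by rewrite (@probability_setT _ _ _ P).
by rewrite Rintegral_cst// [X in _ * X]PT mulr1.
Qed.

Lemma Rintegral_bounded (f : T -> R) (M : R) : measurable_fun setT f ->
  (forall x, `|f x| <= M) -> `|\int[P]_x f x| <= M.
Proof.
move=> mf fM.
apply: le_trans (le_normr_Rintegral measurableT (bounded_integrable mf fM)) _.
have mn : measurable_fun setT (fun x => `|f x|) by exact: measurableT_comp.
rewrite -[leRHS]Rintegral_cst1; apply: le_Rintegral => //.
- by apply: (@bounded_integrable _ M) => // x; rewrite normr_id.
- by apply: (@bounded_integrable _ `|M|).
Qed.

End bounded_integrals.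

(** * Averaging a test function over one summand *)

Section averaging.
Context {R : realType}.
Notation RR := (measurableTypeR R).
Implicit Types (nu : probability RR R) (F : R -> R).

(** The expectation of [F] after one independent increment of law [nu] from the position [x]. *)
Definition average nu F (x : R) : R := \int[nu]_y F (x + y).

Lemma measurable_shift F (x : R) : measurable_fun setT F ->
  measurable_fun setT (fun y : R => F (x + y)).
Proof. by move=> mF; apply: (measurableT_comp mF); exact: measurable_funD. Qed.

Lemma average_norm_le nu F M : measurable_fun setT F ->
  (forall x, `|F x| <= M) -> forall x, `|average nu F x| <= M.
Proof.
move=> mF FM x; apply: (@Rintegral_bounded _ RR) => //.
exact: measurable_shift.
Qed.

Lemma average_itv nu F : measurable_fun setT F ->
  (forall x, 0 <= F x <= 1) -> forall x, 0 <= average nu F x <= 1.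
Proof.
move=> mF F01 x.
have Fn y : `|F y| <= 1 by have /andP[? ?] := F01 y; rewrite ger0_norm.
rewrite (le_trans (ler_norm _) (average_norm_le nu mF Fn x)) andbT.
by apply: Rintegral_ge0 => y _; have /andP[] := F01 (x + y).
Qed.

Lemma EFin_average nu F M x : measurable_fun setT F -> (forall x, `|F x| <= M) ->
  (average nu F x)%:E = (\int[nu]_y (F (x + y))%:E)%E.
Proof.
move=> mF FM; rewrite /average /Rintegral fineK//.
apply: integrable_fin_num => //.
by apply: (@bounded_integrable _ RR _ _ _ M) => //; exact: measurable_shift.
Qed.

Lemma measurable_average nu F M : measurable_fun setT F ->
  (forall x, `|F x| <= M) -> measurable_fun setT (average nu F).
Proof.
move=> mF FM.
(* Adding the bound [M] makes the integrand nonnegative, so that Tonelli gives measurability. *)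
pose H (p : R * R) := (F (p.1 + p.2) + M)%:E.
have mH : measurable_fun setT H.
  apply/measurable_EFinP; apply: measurable_funD => //.
  by apply: (measurableT_comp mF); exact: measurable_funD.
have H0 p : (0 <= H p)%E.
  by rewrite lee_fin; have := FM (p.1 + p.2); rewrite ler_norml; lra.
have mG := measurable_fun_fubini_tonelli_F (m2 := nu) H mH H0.
have -> : average nu F = (fun x => fine (fubini_F nu H x) - M).
  apply/funext => x; rewrite /fubini_F /H/= -[fine _]/(\int[nu]_y (F (x + y) + M)).
  rewrite (@RintegralD _ RR)//.
  - by rewrite Rintegral_cst1 addrK.
  - by apply: (@bounded_integrable _ RR _ _ _ M) => //; exact: measurable_shift.
  - exact: finite_measure_integrable_cst.
by apply: measurable_funB => //; apply: measurableT_comp.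
Qed.

(** [F1] and [F2] stand for the first two derivatives, but only the Taylor inequality is recorded.
    This makes the class stable under averaging without differentiating under an integral. *)
Record taylor3 (M K : R) (F F1 F2 : R -> R) : Prop := Taylor3 {
  taylor3_m0 : measurable_fun setT F;
  taylor3_m1 : measurable_fun setT F1;
  taylor3_m2 : measurable_fun setT F2;
  taylor3_b0 : forall x, `|F x| <= M;
  taylor3_b1 : forall x, `|F1 x| <= M;
  taylor3_b2 : forall x, `|F2 x| <= M;
  taylor3_rem : forall x h,
    `|F (x + h) - F x - F1 x * h - F2 x * (h ^+ 2 / 2)| <= K * `|h| ^+ 3 }.

(** The remainder is linear in [(F, F1, F2)] and its bound is uniform in [x], so it can be
    integrated over the translations with the same constants. *)
Lemma average_taylor3 nu M K F F1 F2 : taylor3 M K F F1 F2 ->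
  taylor3 M K (average nu F) (average nu F1) (average nu F2).
Proof.
move=> [m0 m1 m2 b0 b1 b2 rem]; split; try exact: average_norm_le.
- exact: measurable_average b0.
- exact: measurable_average b1.
- exact: measurable_average b2.
move=> x h.
have i (G : R -> R) (mG : measurable_fun setT G) (bG : forall x, `|G x| <= M) z c :
    nu.-integrable setT (fun y : R => (c * G (z + y))%:E).
  under eq_fun do rewrite EFinM.
  apply: integrableZl => //.
  by apply: (@bounded_integrable _ RR _ _ _ M) => //; exact: measurable_shift.
have i1 (G : R -> R) (mG : measurable_fun setT G) (bG : forall x, `|G x| <= M) z :
    nu.-integrable setT (fun y : R => (G (z + y))%:E).
  by apply: (@bounded_integrable _ RR _ _ _ M) => //; exact: measurable_shift.
have e (G : R -> R) (mG : measurable_fun setT G) (bG : forall x, `|G x| <= M) c :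
    average nu G x * c = \int[nu]_y (c * G (x + y)).
  rewrite mulrC /average RintegralZl//; exact: i1.
have -> : average nu F (x + h) - average nu F x - average nu F1 x * h -
   average nu F2 x * (h ^+ 2 / 2) = \int[nu]_y (F (x + h + y) - F (x + y) -
     h * F1 (x + y) - (h ^+ 2 / 2) * F2 (x + y)).
  rewrite !e// /average.
  have j1 : nu.-integrable setT (fun y : R => (F (x + h + y) - F (x + y))%:E).
    by under eq_fun do rewrite EFinB; apply: integrableB => //; exact: i1.
  have j2 : nu.-integrable setT (fun y : R => (F (x + h + y) - F (x + y) - h * F1 (x + y))%:E).
    by under eq_fun do rewrite EFinB; apply: integrableB => //; exact: i.
  rewrite RintegralB//; last exact: i.
  rewrite RintegralB//; last exact: i.
  by rewrite RintegralB//; exact: i1.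
apply: (@Rintegral_bounded _ RR).
  apply: measurable_funB; last by apply: measurable_funM => //; exact: measurable_shift.
  apply: measurable_funB; last by apply: measurable_funM => //; exact: measurable_shift.
  by apply: measurable_funB; exact: measurable_shift.
move=> y; rewrite [h * _]mulrC [h ^+ 2 / 2 * _]mulrC [x + h + y]addrAC.
exact: rem.
Qed.

(** The third absolute moment is only bounded by [rho], so that the crude estimate for the normal
    law fits. *)
Record centered nu (v rho : R) : Prop := Centered {
  centered_int : nu.-integrable setT (fun y : R => (`|y| ^+ 3)%:E);
  centered_mean : (\int[nu]_y y%:E = 0)%E;
  centered_var : (\int[nu]_y (y ^+ 2)%:E = v%:E)%E;
  centered_abs3 : (\int[nu]_y (`|y| ^+ 3)%:E <= rho%:E)%E }.

Let exp_le_1D3 (u : R) : 0 <= u -> u <= 1 + u ^+ 3 /\ u ^+ 2 <= 1 + u ^+ 3.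
Proof.
move=> u0; have u3 : 0 <= u ^+ 3 by rewrite exprn_ge0.
have [u1|/ltW u1] := leP u 1.
  have u2 : u ^+ 2 <= 1 by rewrite exprn_ile1.
  by split; lra.
have h1 : u ^+ 1 <= u ^+ 3 by rewrite ler_weXn2l.
have h2 : u ^+ 2 <= u ^+ 3 by rewrite ler_weXn2l.
by rewrite expr1 in h1; split; lra.
Qed.

Lemma centered_int12 nu v rho : centered nu v rho ->
  nu.-integrable setT (fun y : R => y%:E) /\
  nu.-integrable setT (fun y : R => (y ^+ 2)%:E).
Proof.
move=> [i3 _ _ _].
have i4 : nu.-integrable setT (fun y : R => (1 + `|y| ^+ 3)%:E).
  under eq_fun do rewrite EFinD.
  by apply: integrableD => //; exact: finite_measure_integrable_cst.
split; apply: (le_integrable _ _ _ i4) => //.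
- exact/measurable_EFinP.
- move=> y _; rewrite lee_fin [leRHS]ger0_norm; last first.
    by rewrite addr_ge0// exprn_ge0.
  by have [] := exp_le_1D3 (normr_ge0 y).
- by apply/measurable_EFinP; exact: measurable_funX.
- move=> y _; rewrite lee_fin [leRHS]ger0_norm; last first.
    by rewrite addr_ge0// exprn_ge0.
  rewrite normrX.
  by have [] := exp_le_1D3 (normr_ge0 y).
Qed.

(** Integrating the Taylor expansion, the linear term vanishes and the quadratic one depends on [nu]
    only through [v]. Two laws with the same variance thus have averages of [F] differing by third
    moments only. *)
Lemma average_approx nu v rho M K F F1 F2 : 0 <= K -> centered nu v rho ->
  taylor3 M K F F1 F2 ->
  forall x, `|average nu F x - F x - F2 x * (v / 2)| <= K * rho.
Proof.
move=> K0 c [m0 m1 m2 b0 b1 b2 rem] x.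
have [i1 i2] := centered_int12 c.
have [i3 e1 e2 e3] := c.
have i0 : nu.-integrable setT (fun y : R => (F (x + y))%:E).
  by apply: (@bounded_integrable _ RR _ _ _ M) => //; exact: measurable_shift.
have ic (a : R) : nu.-integrable setT (fun y : R => a%:E).
  exact: finite_measure_integrable_cst.
have iZ1 : nu.-integrable setT (fun y : R => (F1 x * y)%:E).
  by under eq_fun do rewrite EFinM; apply: integrableZl.
have iZ2 : nu.-integrable setT (fun y : R => (F2 x / 2 * y ^+ 2)%:E).
  by under eq_fun do rewrite EFinM; apply: integrableZl.
have iZ3 : nu.-integrable setT (fun y : R => (K * `|y| ^+ 3)%:E).
  by under eq_fun do rewrite EFinM; apply: integrableZl.
have j1 : nu.-integrable setT (fun y : R => (F (x + y) - F x)%:E).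
  by under eq_fun do rewrite EFinB; apply: integrableB.
have j2 : nu.-integrable setT (fun y : R => (F (x + y) - F x - F1 x * y)%:E).
  by under eq_fun do rewrite EFinB; apply: integrableB.
have j3 : nu.-integrable setT
    (fun y : R => (F (x + y) - F x - F1 x * y - F2 x / 2 * y ^+ 2)%:E).
  by under eq_fun do rewrite EFinB; apply: integrableB.
have -> : average nu F x - F x - F2 x * (v / 2) =
  \int[nu]_y (F (x + y) - F x - F1 x * y - F2 x / 2 * y ^+ 2).
  rewrite RintegralB// RintegralB// RintegralB//; last exact: ic.
  rewrite (@Rintegral_cst1 _ RR _ nu) !RintegralZl// /Rintegral e1 e2 /= mulr0 subr0; congr (_ - _).
  by field.
apply: le_trans (le_normr_Rintegral measurableT j3) _.
apply: (@le_trans _ _ (\int[nu]_y (K * `|y| ^+ 3))).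
  apply: le_Rintegral => //.
    by have := integrable_norm j3.
  by move=> y _; rewrite [F2 x / 2 * _]mulrAC -mulrA; exact: rem.
rewrite RintegralZl// ler_wpM2l// -lee_fin /Rintegral fineK//.
exact: integrable_fin_num.
Qed.

(** One order lower, the increment is compared with the zero increment, and the error is governed by
    the second moment. *)
Lemma average_approx_lip nu v K F F1 M : 0 <= K ->
  nu.-integrable setT (fun y : R => y%:E) ->
  nu.-integrable setT (fun y : R => (y ^+ 2)%:E) ->
  (\int[nu]_y y%:E = 0)%E -> (\int[nu]_y (y ^+ 2)%:E <= v%:E)%E ->
  measurable_fun setT F -> (forall x, `|F x| <= M) ->
  (forall x h, `|F (x + h) - F x - F1 x * h| <= K * `|h| ^+ 2) ->
  forall x, `|average nu F x - F x| <= K * v.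
Proof.
move=> K0 i1 i2 e1 e2 m0 b0 rem x.
have i0 : nu.-integrable setT (fun y : R => (F (x + y))%:E).
  by apply: (@bounded_integrable _ RR _ _ _ M) => //; exact: measurable_shift.
have ic (a : R) : nu.-integrable setT (fun y : R => a%:E).
  exact: finite_measure_integrable_cst.
have iZ1 : nu.-integrable setT (fun y : R => (F1 x * y)%:E).
  by under eq_fun do rewrite EFinM; apply: integrableZl.
have iZ2 : nu.-integrable setT (fun y : R => (K * y ^+ 2)%:E).
  by under eq_fun do rewrite EFinM; apply: integrableZl.
have j1 : nu.-integrable setT (fun y : R => (F (x + y) - F x)%:E).
  by under eq_fun do rewrite EFinB; apply: integrableB.
have j2 : nu.-integrable setT (fun y : R => (F (x + y) - F x - F1 x * y)%:E).
  by under eq_fun do rewrite EFinB; apply: integrableB.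
have -> : average nu F x - F x = \int[nu]_y (F (x + y) - F x - F1 x * y).
  rewrite RintegralB// RintegralB//; last exact: ic.
  by rewrite (@Rintegral_cst1 _ RR _ nu) RintegralZl// /Rintegral e1 /= mulr0 subr0.
apply: le_trans (le_normr_Rintegral measurableT j2) _.
apply: (@le_trans _ _ (\int[nu]_y (K * y ^+ 2))).
  apply: le_Rintegral => //.
    by have := integrable_norm j2.
  by move=> y _; rewrite -[y ^+ 2]ger0_norm ?sqr_ge0// normrX; exact: rem.
rewrite RintegralZl// ler_wpM2l// -lee_fin /Rintegral fineK//.
exact: integrable_fin_num.
Qed.

End averaging.

Section lindeberg.
Context d (T : measurableType d) (R : realType) (P : probability T R).
Notation RR := (measurableTypeR R).
Variables (S : nat -> T -> R) (nu : probability RR R).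
Hypothesis mS : forall k, measurable_fun setT (S k).
Hypothesis S0 : forall w, S 0 w = 0.
Hypothesis SE : forall k (F : R -> R), measurable_fun setT F ->
  (forall x, 0 <= F x <= 1) ->
  \int[P]_w F (S k.+1 w) = \int[P]_w average nu F (S k w).

Let itv_norm (F : R -> R) : (forall x, 0 <= F x <= 1) -> forall x, `|F x| <= 1.
Proof. by move=> F01 x; have /andP[? ?] := F01 x; rewrite ger0_norm. Qed.

Let Rintegral_dist (F G : R -> R) k c : measurable_fun setT F ->
  measurable_fun setT G -> (forall x, `|F x| <= 1) -> (forall x, `|G x| <= 1) ->
  (forall x, `|F x - G x| <= c) ->
  `|\int[P]_w F (S k w) - \int[P]_w G (S k w)| <= c.
Proof.
move=> mF mG F1 G1 FG.
have mFS : measurable_fun setT (F \o S k) by exact: measurableT_comp.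
have mGS : measurable_fun setT (G \o S k) by exact: measurableT_comp.
rewrite -RintegralB//; last 2 first.
- by apply: (@bounded_integrable _ _ _ _ _ 1) => // w; exact: F1.
- by apply: (@bounded_integrable _ _ _ _ _ 1) => // w; exact: G1.
by apply: Rintegral_bounded => [|w]; [exact: measurable_funB|exact: FG].
Qed.

(** The last increment is replaced first. What remains is a shorter sum tested against
    [average tau F], which lies in the same class with the same constants; so the induction on [m]
    must range over all test functions. *)
Lemma lindeberg tau v rho1 rho2 M K F F1 F2 : 0 <= K ->
  centered nu v rho1 -> centered tau v rho2 -> taylor3 M K F F1 F2 ->
  (forall x, 0 <= F x <= 1) -> forall m,
  `|\int[P]_w F (S m w) - iter m (average tau) F 0| <= m%:R * (K * (rho1 + rho2)).
Proof.
move=> K0 cnu ctau + + m; elim: m F F1 F2 => [|m IH] F F1 F2 tF F01.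
  by under eq_Rintegral do rewrite S0; rewrite Rintegral_cst1 subrr normr0 mul0r.
have mF := taylor3_m0 tF; have Fn := itv_norm F01.
have mA nu' := measurable_average nu' mF Fn.
have A01 nu' := average_itv nu' mF F01.
rewrite SE// iterSr.
have h1 : `|\int[P]_w average nu F (S m w) - \int[P]_w average tau F (S m w)| <=
    K * (rho1 + rho2).
  apply: Rintegral_dist => //; try exact: itv_norm.
  move=> x; have a1 := average_approx K0 cnu tF x.
  have a2 := average_approx K0 ctau tF x.
  rewrite mulrDr; apply: le_trans (lerD a1 a2).
  rewrite -[X in _ <= _ + X]normrN; apply: le_trans (ler_normD _ _).
  by rewrite le_eqVlt; apply/orP; left; apply/eqP; congr (`|_|); ring.
have h2 := IH _ _ _ (average_taylor3 tau tF) (A01 tau).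
rewrite -natr1 mulrDl mul1r [leRHS]addrC.
exact: le_trans (ler_distD (\int[P]_w average tau F (S m w)) _ _) (lerD h1 h2).
Qed.

(** Each increment is replaced by zero at the cost [K * v]. The bound is useful when [v] is of order
    [m ^- 2], as for summands divided by [m]. *)
Lemma law_of_large_numbers (v K : R) (F F1 : R -> R) : 0 <= K ->
  nu.-integrable setT (fun y : R => y%:E) ->
  nu.-integrable setT (fun y : R => (y ^+ 2)%:E) ->
  (\int[nu]_y y%:E = 0)%E -> (\int[nu]_y (y ^+ 2)%:E <= v%:E)%E ->
  measurable_fun setT F -> (forall x, 0 <= F x <= 1) ->
  (forall x h, `|F (x + h) - F x - F1 x * h| <= K * `|h| ^+ 2) ->
  forall m, `|\int[P]_w F (S m w) - F 0| <= m%:R * (K * v).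
Proof.
move=> K0 i1 i2 e1 e2 mF F01 rem; elim => [|m IH].
  by under eq_Rintegral do rewrite S0; rewrite Rintegral_cst1 subrr normr0 mul0r.
have Fn := itv_norm F01.
have mA := measurable_average nu mF Fn.
have A01 := average_itv nu mF F01.
have h1 : `|\int[P]_w average nu F (S m w) - \int[P]_w F (S m w)| <= K * v.
  apply: Rintegral_dist => //; first exact: itv_norm.
  exact: (average_approx_lip K0 i1 i2 e1 e2 mF Fn rem).
rewrite SE// -natr1 mulrDl mul1r [leRHS]addrC.
exact: le_trans (ler_distD (\int[P]_w F (S m w)) _ _) (lerD h1 IH).
Qed.

End lindeberg.

Section normal_average.
Context {R : realType}.
Notation RR := (measurableTypeR R).

Lemma EFin_average2 (nu1 nu2 : probability RR R) (f : R -> R) (M x : R) :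
  measurable_fun setT f -> (forall x, `|f x| <= M) ->
  (average nu1 (average nu2 f) x)%:E =
  (\int[nu1]_y \int[nu2]_z (f (x + y + z))%:E)%E.
Proof.
move=> mf fn; rewrite (@EFin_average _ _ _ M); last 2 first.
- exact: measurable_average mf fn.
- exact: average_norm_le.
by apply: eq_integral => y _; rewrite (EFin_average _ _ mf fn).
Qed.

Lemma centered_normal (h : R) : 0 < h ->
  centered (normal_prob 0 h) (h ^+ 2) (30 * h ^+ 3).
Proof.
move=> h0; have n3 := normal_prob_norm3 h0; split => //.
- apply/integrableP; split.
    apply/measurable_EFinP; apply: measurable_funX; exact: normr_measurable.
  apply: le_lt_trans (ltry (30 * h ^+ 3)).
  apply: le_trans n3; apply: ge0_le_integral => //.
  + apply: measurableT_comp => //.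
    apply/measurable_EFinP; apply: measurable_funX; exact: normr_measurable.
  + by apply/measurable_EFinP; apply: measurable_funX; exact: normr_measurable.
  + by move=> x _; rewrite lee_fin ger0_norm// exprn_ge0.
- exact: normal_prob_mean0.
- exact: normal_prob_sqr.
Qed.

(** With [h = (Num.sqrt n%:R)^-1] and [n] iterations the right-hand side is the average over the
    standard normal law. *)
Lemma iter_average_normal (h : R) (f : R -> R) k : 0 < h ->
  measurable_fun setT f -> (forall x, 0 <= f x <= 1) ->
  iter k.+1 (average (normal_prob 0 h)) f =
  average (normal_prob 0 (Num.sqrt k.+1%:R * h)) f.
Proof.
move=> h0 mf f01.
have fn x : `|f x| <= 1 by have /andP[? ?] := f01 x; rewrite ger0_norm.
elim: k => [|k IH]; first by rewrite /= sqrtr1 mul1r.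
have s0 j : 0 < Num.sqrt j.+1%:R * h by rewrite mulr_gt0// sqrtr_gt0 ltr0n.
rewrite iterS IH; apply/funext => x; apply: EFin_inj.
have a1 := EFin_average2 (normal_prob 0 h) (normal_prob 0 (Num.sqrt k.+1%:R * h)) x mf fn.
have a2 := EFin_average (normal_prob 0 (Num.sqrt k.+2%:R * h)) x mf fn.
apply: (etrans a1); apply: esym; apply: (etrans a2); apply: esym.
apply: (ge0_normal_prob_conv x h0 (s0 k) (s0 k.+1) (f := EFin \o f)).
- have sq j : (Num.sqrt j%:R * h) ^+ 2 = j%:R * h ^+ 2.
    by rewrite exprMn sqr_sqrtr ?ler0n.
  rewrite (sq k.+2) [X in _ = _ + X](sq k.+1) -(natr1 k.+1) mulrDl mul1r.
  exact: addrC.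
- exact/measurable_EFinP.
- by move=> y; rewrite lee_fin; have /andP[] := f01 y.
Qed.

End normal_average.

(** * The central limit theorem for Studentized means *)

Section iid_sequences.
Context d (T : measurableType d) (R : realType) (P : probability T R).
Notation RR := (measurableTypeR R).

Record iid (W : nat -> T -> R) : Prop := Iid {
  iid_measurable : forall i, measurable_fun setT (W i);
  iid_indep : forall (s : seq nat) (A : nat -> set R), uniq s ->
    (forall i, i \in s -> measurable (A i)) ->
    P (\bigcap_(i in [set i | i \in s]) (W i @^-1` A i)) =
    (\prod_(i <- s) P (W i @^-1` A i))%E;
  iid_ident : forall i B, measurable B -> P (W i @^-1` B) = P (W 0 @^-1` B) }.

Lemma iid_comp W (g : R -> R) : measurable_fun setT g -> iid W ->
  iid (fun i w => g (W i w)).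
Proof.
move=> mg [mW iW eW]; have mgB B : measurable B -> measurable (g @^-1` B).
  by move=> mB; rewrite -[X in measurable X]setTI; exact: mg.
split.
- by move=> i; exact: (measurableT_comp mg).
- move=> s A us mA.
  by rewrite -(iW s (fun i => g @^-1` A i))// => i /mA; exact: mgB.
- by move=> i B mB; rewrite -[RHS](eW i (g @^-1` B))//; exact: mgB.
Qed.

Section partial_sums.
Variable W : nat -> T -> R.
Hypothesis iidW : iid W.

Let mW := iid_measurable iidW.
Let S k w := \sum_(i < k) W i w.

Let ev (s : seq nat) (A : nat -> set R) :=
  \bigcap_(i in [set i | i \in s]) (W i @^-1` A i).

Let mpre (V : T -> R) B : measurable_fun setT V -> measurable B ->
  measurable (V @^-1` B).
Proof. by move=> mV mB; rewrite -[X in measurable X]setTI; exact: mV. Qed.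

Let mev s A : (forall i, i \in s -> measurable (A i)) -> measurable (ev s A).
Proof.
move=> mA; apply: fin_bigcap_measurable; first exact: finite_seq.
by move=> i /= /mA; exact: mpre.
Qed.

Lemma measurable_partial_sum k : measurable_fun setT (S k).
Proof. by apply: measurable_sum => i; exact: mW. Qed.

Let mS := measurable_partial_sum.

Let pair k w : RR * RR := (S k w, W k w).

Let mpair k : measurable_fun setT (pair k).
Proof. by apply/measurable_fun_pairP; split; [exact: mS|exact: mW]. Qed.

Let ev_cons k s A : ev (k :: s) A = (W k @^-1` A k) `&` ev s A.
Proof.
rewrite /ev; apply/seteqP; split => [w h|w [h1 h2] i /=].
  split; first by apply: h; rewrite /= mem_head.
  by move=> i /= js; apply: h; rewrite /= in_cons js orbT.
by rewrite in_cons => /predU1P[->//|]; exact: h2.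
Qed.

Let pairX k (A B : set R) : pair k @^-1` (A `*` B) = (S k @^-1` A) `&` (W k @^-1` B).
Proof. by []. Qed.

Let Pfin A : measurable A -> P A \is a fin_num.
Proof. by move=> mA; exact: fin_num_measure. Qed.

(** Independence is assumed for events on single variables; here it is extended to a partial sum and
    the later variables. In the inductive step [S k.+1] is a function of the pair [(S k, W k)]. On
    rectangles, the event on [W k] joins the list [s] and the induction hypothesis applies, which is
    why all lists of later indices are allowed. *)
Let indep_sum k s (A : nat -> set R) B : uniq s -> (forall i, i \in s -> (k <= i)%N) ->
  (forall i, i \in s -> measurable (A i)) -> measurable B ->
  P ((S k @^-1` B) `&` ev s A) = (P (S k @^-1` B) * P (ev s A))%E.
Proof.
elim: k s A B => [|k IH] s A B us ks mA mB.
  have -> : S 0 @^-1` B = if `[< B 0 >] then setT else set0.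
    apply/seteqP; rewrite /S; split => w /=; rewrite big_ord0; case: asboolP => //.
  case: asboolP => _; first by rewrite setTI probability_setT mul1e.
  by rewrite set0I measure0 mul0e.
have mE := mev mA.
pose p := fine (P (ev s A)); have p0 : 0 <= p by exact: fine_ge0.
pose m1 := restricted_image P mE (mpair k).
pose m2 := scaled_image P p0 (mpair k).
pose C : set (RR * RR) := [set z | B (z.1 + z.2)].
have mC : measurable C.
  rewrite -[C]setTI; apply: (measurable_funD measurable_fst measurable_snd) => //.
have knots : k \notin s by apply/negP => /ks; rewrite ltnn.
have ks' i : i \in s -> (k <= i)%N by move/ks/ltnW.
have m12 : m1 C = m2 C.
  apply: eq_measure_rectangles => //.
    rewrite /m1 restricted_imageE// preimage_setT setTI.
    exact: le_lt_trans (probability_le1 P mE) (ltry 1).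
  move=> A1 B1 mA1 mB1.
  rewrite /m1 /m2 restricted_imageE ?scaled_imageE; [|exact: measurableX|exact: measurableX].
  rewrite !pairX -setIA.
  (* The family [A] overridden at the new index [k], which does not occur in [s]. *)
  pose A' i := if i == k then B1 else A i.
  have mA' i : i \in k :: s -> measurable (A' i).
    by rewrite /A' in_cons; case: eqVneq => //= _ /mA.
  have evE : ev s A' = ev s A.
    apply: eq_bigcapr => i /= js; rewrite /A'; case: eqP => // ik.
    by rewrite -ik js in knots.
  have ev1 : (W k @^-1` B1) `&` ev s A = ev (k :: s) A'.
    by rewrite ev_cons evE /A' eqxx.
  have us' : uniq (k :: s) by rewrite /= knots.
  have E1 : P ((S k @^-1` A1) `&` ev (k :: s) A') =
      (P (S k @^-1` A1) * P (ev (k :: s) A'))%E.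
    by apply: IH => // i; rewrite in_cons => /predU1P[->//|/ks'].
  have E2 : P (ev (k :: s) A') = (P (W k @^-1` B1) * P (ev s A))%E.
    rewrite /ev (iid_indep iidW)// big_cons -(iid_indep iidW)//; last first.
      by move=> i js; apply: mA'; rewrite in_cons js orbT.
    by rewrite -/(ev s A') evE /A' eqxx.
  have E3 : P ((S k @^-1` A1) `&` (W k @^-1` B1)) =
      (P (S k @^-1` A1) * P (W k @^-1` B1))%E.
    have := IH [:: k] (fun=> B1) A1.
    rewrite ev_cons /ev set_nil bigcap_set0 setIT => -> //.
    by move=> i; rewrite inE => /eqP ->.
  rewrite ev1; apply: (etrans E1); rewrite E2.
  apply: (etrans _ (congr1 (fun z => p%:E * z)%E (esym E3))).
  by rewrite /p fineK ?Pfin// muleA muleC.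
have SkE w : S k.+1 w = S k w + W k w by rewrite /S big_ord_recr.
have preC : S k.+1 @^-1` B = pair k @^-1` C.
  by apply/seteqP; split => w; rewrite /= SkE.
rewrite preC -[LHS](restricted_imageE P mE (mpair k) mC).
rewrite -[LHS]/(m1 C) m12 /m2 scaled_imageE// muleC /p fineK// Pfin//.
Qed.

Let indep_pair k (A B : set R) : measurable A -> measurable B ->
  P ((S k @^-1` A) `&` (W k @^-1` B)) = (P (S k @^-1` A) * P (W k @^-1` B))%E.
Proof.
move=> mA mB; have := @indep_sum k [:: k] (fun=> B) A.
rewrite ev_cons /ev set_nil bigcap_set0 setIT => -> //.
by move=> i; rewrite inE => /eqP ->.
Qed.

(** The pair [(S k, W k)] has a product law, by agreement on rectangles, so Tonelli integrates out
    [W k]. This is the one-step hypothesis [SE] of the replacement argument. *)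
Lemma Rintegral_partial_sum k (F : R -> R) : measurable_fun setT F ->
  (forall x, 0 <= F x <= 1) ->
  \int[P]_w F (S k.+1 w) = \int[P]_w average (law P (mW 0)) F (S k w).
Proof.
move=> mF F01.
have Fn x : `|F x| <= 1 by have /andP[? ?] := F01 x; rewrite ger0_norm.
pose nuS := law P (mS k); pose nuW := law P (mW 0).
pose m1 := scaled_image P ler01 (mpair k).
have m1E C : measurable C -> (nuS \x nuW)%E C = m1 C.
  apply: product_measure_unique => A B mA mB.
  rewrite /m1 scaled_imageE ?mul1e; last exact: measurableX.
  rewrite pairX.
  apply: (etrans (indep_pair k mA mB)).
  by congr (_ * _)%E; exact: (iid_ident iidW).
pose G (z : RR * RR) := (F (z.1 + z.2))%:E.
have mG : measurable_fun setT G.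
  apply/measurable_EFinP; apply: (measurableT_comp mF).
  exact: measurable_funD.
have G0 z : (0 <= G z)%E by rewrite lee_fin; have /andP[] := F01 (z.1 + z.2).
rewrite /Rintegral; congr fine.
transitivity (\int[m1]_z G z)%E.
  rewrite (@ge0_integral_weighted_image _ _ _ _ _ P m1 (cst 1) (pair k))//.
  - apply: eq_integral => w _; rewrite mul1e /G /pair/=.
    by rewrite /S big_ord_recr.
  - by move=> A mA; rewrite -weighted_imageE//; exact: mpair.
transitivity (\int[(nuS \x nuW)%E]_z G z)%E.
  by apply: eq_measure_integral => A mA _; exact: (esym (m1E A mA)).
rewrite (fubini_tonelli1 (m1 := nuS) (m2 := nuW) G mG G0) /fubini_F.
transitivity (\int[nuS]_x (average nuW F x)%:E)%E.
  by apply: eq_integral => x _; rewrite (EFin_average _ _ mF Fn).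
rewrite ge0_integral_law//.
- by apply/measurable_EFinP; exact: measurable_average mF Fn.
- by move=> x; rewrite lee_fin; have /andP[] := average_itv nuW mF F01 x.
Qed.

End partial_sums.
End iid_sequences.

(** * From smooth test functions to distribution functions *)

Section logistic_sandwich.
Context {R : realType}.

(** The steepness is uniform in the location [c], so one [k] serves a bound from either side. *)
Lemma logistic_step (delta eta : R) : 0 < delta -> 0 < eta ->
  exists2 k, 0 < k & forall c x,
    (x <= c - delta -> 1 - eta <= logistic k c x) /\
    (c + delta <= x -> logistic k c x <= eta).
Proof.
(* This makes [k * delta = eta^-1], and [expR y >= 1 + y] then suffices. *)
move=> d0 e0; pose k := (eta * delta)^-1.
have k0 : 0 < k by rewrite invr_gt0 mulr_gt0.
have kd : k * delta = eta^-1 by rewrite /k; field; rewrite !gt_eqF.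
have hk : eta^-1 <= expR (k * delta).
  by rewrite kd; have := expR_ge1Dx eta^-1; lra.
have hk' : expR (- (k * delta)) <= eta.
  by rewrite expRN -[leRHS]invrK lef_pV2// posrE ?invr_gt0// expR_gt0.
exists k => // c x; rewrite /logistic; split => h.
- have e1 : expR (k * (x - c)) <= eta.
    apply: le_trans hk'; rewrite ler_expR -mulrN ler_wpM2l ?(ltW k0)//; lra.
  have p0 : 0 < expR (k * (x - c)) by exact: expR_gt0.
  rewrite -[leRHS]mul1r ler_pdivlMr ?addr_gt0//; nra.
- have e1 : eta^-1 <= expR (k * (x - c)).
    apply: (le_trans hk); rewrite ler_expR ler_wpM2l ?(ltW k0)//; lra.
  have p0 : 0 < expR (k * (x - c)) by exact: expR_gt0.
  rewrite -[leRHS]invrK lef_pV2 ?posrE ?invr_gt0 ?addr_gt0//; lra.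
Qed.

End logistic_sandwich.

Section cdf_logistic.
Context d (T : measurableType d) (R : realType) (Q : probability T R).
Variable D : T -> R.
Hypothesis mD : measurable_fun setT D.

Definition prle (y : R) : R := fine (Q (D @^-1` `]-oo, y])).

Let mpre y : measurable (D @^-1` `]-oo, y]).
Proof. by rewrite -[X in measurable X]setTI; exact: mD. Qed.

Lemma prleE y : prle y = \int[Q]_w \1_(D @^-1` `]-oo, y]) w.
Proof. by rewrite /Rintegral integral_indic// setIT. Qed.

Let indicE01 y w : (\1_(D @^-1` `]-oo, y]) w : R) = (D w <= y)%R%:R.
Proof.
rewrite indicE; congr (_%:R); congr nat_of_bool.
by apply/idP/idP; rewrite inE /= in_itv.
Qed.

Let int_indic y : Q.-integrable setT (EFin \o (\1_(D @^-1` `]-oo, y]) : T -> R)).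
Proof.
apply: (@bounded_integrable _ _ _ _ _ 1).
  by apply: measurable_indic.
by move=> w; rewrite indicE01; case: (D w <= y)%R; rewrite ?normr1 ?normr0.
Qed.

Variables (k c delta eta : R).
Hypothesis k0 : 0 < k.
Hypothesis step1 : forall x : R, x <= c - delta -> 1 - eta <= logistic k c x.
Hypothesis step2 : forall x : R, c + delta <= x -> logistic k c x <= eta.

Let int_logistic : Q.-integrable setT (EFin \o (logistic k c \o D)).
Proof.
apply: (@bounded_integrable _ _ _ _ _ 1).
  by apply: (measurableT_comp (measurable_logistic k c)).
by move=> w; rewrite /= gtr0_norm ?logistic_gt0// ltW// logistic_lt1.
Qed.

Let int_cst : Q.-integrable setT (EFin \o (fun _ : T => eta)).
Proof. exact: finite_measure_integrable_cst. Qed.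

Lemma prle_le_logistic : 0 < eta ->
  prle (c - delta) <= \int[Q]_w logistic k c (D w) + eta.
Proof.
move=> e0; rewrite prleE -[X in _ <= _ + X](Rintegral_cst1 Q) -RintegralD//.
apply: le_Rintegral => //.
  exact: (integrableD measurableT int_logistic int_cst).
move=> w _; rewrite indicE01; have [h|_] /= := leP (D w) (c - delta).
  by have := step1 h; rewrite mulr1n; lra.
by have := logistic_gt0 k c (D w); rewrite mulr0n; lra.
Qed.

Lemma logistic_le_prle : 0 < eta ->
  \int[Q]_w logistic k c (D w) <= prle (c + delta) + eta.
Proof.
move=> e0; rewrite prleE -[X in _ <= _ + X](Rintegral_cst1 Q) -RintegralD//.
apply: le_Rintegral => //.
  exact: (integrableD measurableT (int_indic _) int_cst).
move=> w _; rewrite indicE01; have [_|/ltW h] /= := leP (D w) (c + delta); last first.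
  by have := step2 h; rewrite mulr0n; lra.
by have := logistic_lt1 k c (D w); rewrite mulr1n; lra.
Qed.

End cdf_logistic.

Section normal_cdf.
Context {R : realType}.

Definition normal_cdf (y : R) : R := fine (normal_prob 0 1 `]-oo, y]%classic).

(** The density is at most its peak. This quantitative continuity pays for the width of the logistic
    transition and, later, for the error in the Studentizing factor. *)
Lemma normal_cdf_lipschitz (y z : R) : y < z ->
  normal_cdf z <= normal_cdf y + normal_peak 1 * (z - y).
Proof.
move=> yz; pose N : probability (measurableTypeR R) R := normal_prob 0 1.
have mI (i : interval R) : measurable ([set` i] : set (measurableTypeR R)).
  exact: measurable_itv.
have e : N `]-oo, z]%classic = (N `]-oo, y]%classic + N `]y, z]%classic)%E.
  rewrite -measureU//; last first.
    apply/seteqP; split => // x [] /=; rewrite !in_itv/= => xy /andP[].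
    by rewrite ltNge xy.
  congr (N _); apply/seteqP; split => x /=; rewrite !in_itv/=.
    by move=> xz; case: (leP x y) => xy; [left|right; rewrite xz].
  by move=> [xy|/andP[]//]; rewrite (le_trans xy)// ltW.
have b : (N `]y, z]%classic <= (normal_peak 1 * (z - y))%:E)%E.
  rewrite /N/= /normal_prob.
  apply: (@le_trans _ _ (\int[lebesgue_measure]_(x in `]y, z]) (normal_peak (1 : R))%:E)%E).
    apply: ge0_le_integral => //.
    - by move=> x _; rewrite lee_fin normal_pdf_ge0.
    - by apply/measurable_EFinP/measurable_funTS; exact: measurable_normal_pdf.
    - by move=> x _; rewrite lee_fin normal_pdf_ub// oner_eq0.
  rewrite -[X in (X <= _)%E]/(\int[lebesgue_measure]_(x in `]y, z]) (cst (normal_peak (1 : R))%:E x))%E.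
  by rewrite integral_cst//= lebesgue_measure_itv/= lte_fin yz -EFinB -EFinM lee_fin.
have fE x : (normal_cdf x)%:E = N `]-oo, x]%classic.
  by rewrite fineK//; exact: (fin_num_measure N).
rewrite -lee_fin fE e; apply: le_trans (leeD2l _ b) _.
by rewrite -fE -EFinD.
Qed.

End normal_cdf.

Section limit_theorems.
Context d (T : measurableType d) (R : realType) (P : probability T R).
Variable W : nat -> T -> R.
Hypothesis iidW : iid P W.
Hypothesis meanW : (\int[P]_w (W 0 w)%:E = 0)%E.

Let mW := iid_measurable iidW.

Definition scaled_sum (a : R) n w := a * \sum_(i < n) W i w.

Lemma measurable_scaled_sum a n : measurable_fun setT (scaled_sum a n).
Proof. by apply: measurable_funM => //; exact: (measurable_partial_sum iidW). Qed.

Let iidc a : iid P (fun i w => a * W i w).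
Proof. by apply: (iid_comp (g := fun x => a * x)) => //; exact: measurable_funM. Qed.

Let scaled_sumE a n w : scaled_sum a n w = \sum_(i < n) a * W i w.
Proof. by rewrite /scaled_sum mulr_sumr. Qed.

Let mc a := iid_measurable (iidc a) 0.

Hypothesis intW2 : P.-integrable setT (fun w => (W 0 w ^+ 2)%:E).

Let intW1 : P.-integrable setT (fun w => (W 0 w)%:E).
Proof.
have i4 : P.-integrable setT (fun w => (1 + W 0 w ^+ 2)%:E).
  under eq_fun do rewrite EFinD.
  by apply: integrableD => //; exact: finite_measure_integrable_cst.
apply: (le_integrable _ _ _ i4) => //; first exact/measurable_EFinP.
move=> w _; rewrite lee_fin [leRHS]ger0_norm ?addr_ge0 ?sqr_ge0//.
by rewrite ler_norml; apply/andP; split; nra.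
Qed.

Let law_int a (f : R -> R) : measurable_fun setT f ->
  P.-integrable setT (fun w => (f (a * W 0 w))%:E) ->
  (law P (mc a)).-integrable setT (fun y : R => (f y)%:E) /\
  (\int[law P (mc a)]_y (f y)%:E = \int[P]_w (f (a * W 0 w))%:E)%E.
Proof.
move=> mf fint; have mE : measurable_fun setT (fun y : R => (f y)%:E).
  exact/measurable_EFinP.
split; last by rewrite integral_law.
apply/integrableP; split => //.
rewrite (ge0_integral_law P (mc a) (f := fun y => `|(f y)%:E|%E))//.
  by have /integrableP[] := fint.
exact: measurableT_comp.
Qed.

Let law1 a : (law P (mc a)).-integrable setT (fun y : R => y%:E) /\
  (\int[law P (mc a)]_y y%:E = 0)%E.
Proof.
have i : P.-integrable setT (fun w => (a * W 0 w)%:E).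
  by under eq_fun do rewrite EFinM; apply: integrableZl.
have [h1 h2] := @law_int a id (@measurable_id _ _ _) i; split => //.
rewrite h2; under eq_integral do rewrite EFinM.
by rewrite integralZl// meanW mule0.
Qed.

Let law2 a : (law P (mc a)).-integrable setT (fun y : R => (y ^+ 2)%:E) /\
  (\int[law P (mc a)]_y (y ^+ 2)%:E =
   (a ^+ 2)%:E * \int[P]_w (W 0 w ^+ 2)%:E)%E.
Proof.
have m2 : measurable_fun setT (fun y : R => y ^+ 2) by exact: measurable_funX.
have i : P.-integrable setT (fun w => ((a * W 0 w) ^+ 2)%:E).
  by under eq_fun do rewrite exprMn EFinM; apply: integrableZl.
have [h1 h2] := law_int m2 i; split => //.
rewrite h2; under eq_integral do rewrite exprMn EFinM.
by rewrite integralZl.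
Qed.

Let partial_sum_step a : forall k (F : R -> R), measurable_fun setT F ->
  (forall x, 0 <= F x <= 1) ->
  \int[P]_w F (scaled_sum a k.+1 w) =
  \int[P]_w average (law P (mc a)) F (scaled_sum a k w).
Proof.
move=> k F mF F01; under eq_Rintegral do rewrite scaled_sumE.
under [RHS]eq_Rintegral do rewrite scaled_sumE.
exact: (Rintegral_partial_sum (iidc a)).
Qed.

(** The summands [W i / n] have second moment [v / n ^+ 2], so [n] replacements cost
    [k ^+ 2 * v / n]. The bound is one-sided; applying it to a function and to its opposite gives
    both sides. *)
Lemma lln_le (delta eps : R) : 0 < delta -> 0 < eps ->
  \forall n \near \oo, 1 - eps <= prle P (scaled_sum n%:R^-1 n) delta.
Proof.
move=> d0 e0.
(* A logistic centred at [delta / 2] with this half-width is nearly 1 at 0 and nearly 0 from [delta]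
   on. The three thirds of [eps] pay for its value at 0, the replacements, and the passage to the
   indicator. *)
have d20 : 0 < delta / 2 by rewrite divr_gt0.
have e30 : 0 < eps / 3 by rewrite divr_gt0.
have [k k0 hk] := logistic_step d20 e30.
have L01 x : 0 <= logistic k (delta / 2) x <= 1.
  by rewrite ltW ?logistic_gt0//= ltW// logistic_lt1.
pose v := fine (\int[P]_w (W 0 w ^+ 2)%:E)%E.
have vE : (\int[P]_w (W 0 w ^+ 2)%:E = v%:E)%E.
  by rewrite /v fineK//; exact: integrable_fin_num.
near=> n.
have n0 : (0 < n)%N by near: n; exact: nbhs_infty_gt.
have [i1 m1] := law1 n%:R^-1; have [i2 m2] := law2 n%:R^-1.
have m2' : (\int[law P (mc n%:R^-1)]_y (y ^+ 2)%:E <= (n%:R ^- 2 * v)%:E)%E.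
  by rewrite m2 vE -EFinM exprVn.
have K0 : 0 <= k ^+ 2 by exact: sqr_ge0.
have rem (x h : R) : `|logistic k (delta / 2) (x + h) - logistic k (delta / 2) x -
    logistic1 k (delta / 2) x * h| <= k ^+ 2 * `|h| ^+ 2.
  apply: (@taylor2_bound R (logistic k (delta / 2)) (logistic1 k (delta / 2))
    (logistic2 k (delta / 2))) => y.
  - exact: is_derive_logistic.
  - exact: is_derive_logistic1.
  - exact: logistic2_le.
have := @law_of_large_numbers _ T R P (scaled_sum n%:R^-1) _
  (measurable_scaled_sum n%:R^-1) _ (@partial_sum_step n%:R^-1) _ _
  (logistic k (delta / 2)) (logistic1 k (delta / 2)) K0 i1 i2 m1 m2'
  (measurable_logistic k _) L01
  rem n.
have S0 w : scaled_sum n%:R^-1 0 w = 0 by rewrite /scaled_sum big_ord0 mulr0.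
move=> /(_ S0).
have -> : n%:R * (k ^+ 2 * (n%:R ^- 2 * v)) = k ^+ 2 * v / n%:R.
  by field; rewrite pnatr_eq0 -lt0n.
have small : k ^+ 2 * v / n%:R <= eps / 3.
  rewrite ler_pdivrMr ?ltr0n// -ler_pdivrMl//.
  by near: n; exact: nbhs_infty_ger.
rewrite ler_norml => /andP[h1 _].
have [a1 _] := hk (delta / 2) 0.
have l0 : 1 - eps / 3 <= logistic k (delta / 2) 0 by apply: a1; rewrite subrr.
have := @logistic_le_prle _ T R P _ (measurable_scaled_sum n%:R^-1 n) k (delta / 2)
  (delta / 2) (eps / 3) (fun x => (hk _ x).2) e30.
by rewrite -splitr; lra.
Unshelve. all: by end_near. Qed.

Hypothesis intW3 : P.-integrable setT (fun w => (`|W 0 w| ^+ 3)%:E).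
Hypothesis varW : (\int[P]_w (W 0 w ^+ 2)%:E = 1)%E.

(** With [a = n ^ (-1/2)] each replacement costs at most [K * (rho + 30) * a ^+ 3], and [n] of them
    cost [K * (rho + 30) * a], which tends to zero. *)
Lemma clt_smooth M K F F1 F2 (eps : R) : 0 <= K -> taylor3 M K F F1 F2 ->
  (forall x, 0 <= F x <= 1) -> 0 < eps ->
  \forall n \near \oo,
    `|\int[P]_w F (scaled_sum (Num.sqrt n%:R)^-1 n w) -
      \int[normal_prob 0 1]_y F y| <= eps.
Proof.
move=> K0 tF F01 e0.
pose rho := fine (\int[P]_w (`|W 0 w| ^+ 3)%:E)%E.
have rhoE : (\int[P]_w (`|W 0 w| ^+ 3)%:E = rho%:E)%E.
  by rewrite /rho fineK//; exact: integrable_fin_num.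
have C0 : 0 <= K * (rho + 30).
  rewrite mulr_ge0// addr_ge0// -lee_fin -rhoE.
  by apply: integral_ge0 => w _; rewrite lee_fin exprn_ge0.
near=> n.
have n0 : (0 < n)%N by near: n; exact: nbhs_infty_gt.
have sn0 : 0 < Num.sqrt (n%:R : R) by rewrite sqrtr_gt0 ltr0n.
set a := (Num.sqrt n%:R)^-1.
have a0 : 0 < a by rewrite invr_gt0.
have a2 : a ^+ 2 = n%:R^-1 by rewrite /a exprVn sqr_sqrtr.
have [i1 m1] := law1 a; have [i2 m2] := law2 a.
have m3 : measurable_fun setT (fun y : R => `|y| ^+ 3).
  by apply: measurable_funX; exact: normr_measurable.
have i : P.-integrable setT (fun w => (`|a * W 0 w| ^+ 3)%:E).
  under eq_fun do rewrite normrM exprMn EFinM.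
  exact: integrableZl.
have [i3 e3] := law_int m3 i.
have cnu : centered (law P (mc a)) (a ^+ 2) (a ^+ 3 * rho).
  split => //; first by rewrite m2 varW mule1.
  rewrite e3; under eq_integral do rewrite normrM exprMn EFinM.
  by rewrite integralZl// rhoE -EFinM (gtr0_norm a0).
have ctau := centered_normal a0.
have S0 w : scaled_sum a 0 w = 0 by rewrite /scaled_sum big_ord0 mulr0.
have := lindeberg (measurable_scaled_sum a) S0 (@partial_sum_step a)
  K0 cnu ctau tF F01 n.
have mF := taylor3_m0 tF.
have -> : iter n (average (normal_prob 0 a)) F 0 = \int[normal_prob 0 1]_y F y.
  rewrite -(prednK n0) (iter_average_normal _ a0 mF F01) (prednK n0).
  rewrite mulfV ?gt_eqF// /average.
  by apply: eq_Rintegral => y _; rewrite add0r.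
move/le_trans; apply.
have -> : n%:R * (K * (a ^+ 3 * rho + 30 * a ^+ 3)) = K * (rho + 30) * a.
  rewrite (_ : a ^+ 3 = n%:R^-1 * a); last by rewrite exprSr a2.
  by field; rewrite pnatr_eq0 -lt0n.
rewrite /a ler_pdivrMr// -ler_pdivrMl//.
rewrite mulrC -(ger0_norm (divr_ge0 C0 (ltW e0))) -sqrtr_sqr ler_sqrt ?ler0n//.
by near: n; exact: nbhs_infty_ger.
Unshelve. all: by end_near. Qed.

End limit_theorems.

(** * Studentization *)

Section studentized_mean.
Context d (T : measurableType d) (R : realType) (P : probability T R).

Lemma taylor3_logistic (k c : R) : 0 < k ->
  taylor3 (1 + k + k ^+ 2) (k ^+ 3) (logistic k c) (logistic1 k c) (logistic2 k c).
Proof.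
move=> k0; have k20 : 0 <= k ^+ 2 by exact: sqr_ge0.
split.
- exact: measurable_logistic.
- exact: measurable_logistic1.
- exact: measurable_logistic2.
- move=> x; have := logistic_gt0 k c x; have := logistic_lt1 k c x => h1 h2.
  by rewrite gtr0_norm//; lra.
- by move=> x; have := logistic1_le c k0 x; lra.
- by move=> x; have := logistic2_le k c x; lra.
- move=> x h; apply: (@taylor3_bound R (logistic k c) (logistic1 k c)
    (logistic2 k c) (logistic3 k c)) => y.
  + exact: is_derive_logistic.
  + exact: is_derive_logistic1.
  + exact: is_derive_logistic2.
  + exact: logistic3_le.
Qed.

Let pr (A : set T) : R := fine (P A).

Let pr_subU (A B C : set T) : measurable A -> measurable B -> measurable C ->
  A `<=` B `|` C -> pr A <= pr B + pr C.
Proof.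
move=> mA mB mC ABC; have mBC : measurable (B `|` C) by exact: measurableU.
rewrite -lee_fin EFinD /pr !fineK; [|exact: fin_num_measure..].
apply: (@le_trans _ _ (P (B `|` C))); first by apply: le_measure; rewrite ?inE.
exact: measureU2.
Qed.

Let mle (Z : T -> R) y : measurable_fun setT Z -> measurable (Z @^-1` `]-oo, y]%classic).
Proof. by move=> mZ; rewrite -[X in measurable X]setTI; exact: mZ. Qed.

Let pr_gt (Z : T -> R) y : measurable_fun setT Z ->
  pr (~` (Z @^-1` `]-oo, y]%classic)) = 1 - prle P Z y.
Proof.
move=> mZ; have mA := mle y mZ; apply: EFin_inj.
rewrite /pr /prle EFinB !fineK ?fin_num_measure//; last exact: measurableC.
exact: probability_setC.
Qed.

(** A union bound in the manner of Slutsky: [D <= a] implies [E <= b] off four exceptional events.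
    Four, because two averages must be controlled from both sides. *)
Lemma prle_le_slack (D E Z1 Z2 Z3 Z4 : T -> R) a b k :
  measurable_fun setT D -> measurable_fun setT E ->
  measurable_fun setT Z1 -> measurable_fun setT Z2 ->
  measurable_fun setT Z3 -> measurable_fun setT Z4 ->
  (forall w, Z1 w <= k -> Z2 w <= k -> Z3 w <= k -> Z4 w <= k ->
    D w <= a -> E w <= b) ->
  prle P D a <= prle P E b + ((1 - prle P Z1 k + (1 - prle P Z2 k)) +
    ((1 - prle P Z3 k) + (1 - prle P Z4 k))).
Proof.
move=> mD mE m1 m2 m3 m4 DE.
pose C (Z : T -> R) := ~` (Z @^-1` `]-oo, k]%classic).
have mC (Z : T -> R) : measurable_fun setT Z -> measurable (C Z).
  by move=> mZ; apply: measurableC; exact: mle.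
have mU (Z Z' : T -> R) : measurable_fun setT Z -> measurable_fun setT Z' ->
    measurable (C Z `|` C Z').
  by move=> mZ mZ'; apply: measurableU; exact: mC.
have prU (Z Z' : T -> R) : measurable_fun setT Z -> measurable_fun setT Z' ->
    pr (C Z `|` C Z') <= (1 - prle P Z k) + (1 - prle P Z' k).
  move=> mZ mZ'; rewrite -!pr_gt//; apply: pr_subU => //; [exact: mU|exact: mC|exact: mC].
apply: (@le_trans _ _ (pr (E @^-1` `]-oo, b]%classic) +
    pr ((C Z1 `|` C Z2) `|` (C Z3 `|` C Z4)))).
  apply: pr_subU; [exact: mle|exact: mle|by apply: measurableU; exact: mU|].
  move=> w /=; rewrite !in_itv/= => Da.
  have [h1|h1] := leP (Z1 w) k; last first.
    by right; left; left; rewrite /C /= in_itv/=; apply/negP; rewrite -ltNge.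
  have [h2|h2] := leP (Z2 w) k; last first.
    by right; left; right; rewrite /C /= in_itv/=; apply/negP; rewrite -ltNge.
  have [h3|h3] := leP (Z3 w) k; last first.
    by right; right; left; rewrite /C /= in_itv/=; apply/negP; rewrite -ltNge.
  have [h4|h4] := leP (Z4 w) k; last first.
    by right; right; right; rewrite /C /= in_itv/=; apply/negP; rewrite -ltNge.
  by left; exact: DE.
rewrite lerD2l; apply: le_trans (lerD (prU _ _ m1 m2) (prU _ _ m3 m4)).
by apply: pr_subU => //; [apply: measurableU; exact: mU|exact: mU|exact: mU].
Qed.

Variable W : nat -> T -> R.
Hypothesis iidW : iid P W.
Hypothesis meanW : (\int[P]_w (W 0 w)%:E = 0)%E.
Hypothesis varW : (\int[P]_w (W 0 w ^+ 2)%:E = 1)%E.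
Hypothesis intW4 : P.-integrable setT (fun w => (W 0 w ^+ 4)%:E).

Let mW := iid_measurable iidW.

Let pow_le (u : R) : 0 <= u ->
  [/\ u <= 1 + u ^+ 4, u ^+ 2 <= 1 + u ^+ 4 & u ^+ 3 <= 1 + u ^+ 4].
Proof.
move=> u0; have u4 : 0 <= u ^+ 4 by rewrite exprn_ge0.
have [u1|/ltW u1] := leP u 1.
  have u2 : u ^+ 2 <= 1 by rewrite exprn_ile1.
  have u3 : u ^+ 3 <= 1 by rewrite exprn_ile1.
  by split; lra.
have h1 : u ^+ 2 <= u ^+ 4 by rewrite ler_weXn2l.
have h2 : u ^+ 3 <= u ^+ 4 by rewrite ler_weXn2l.
have h3 : u ^+ 1 <= u ^+ 4 by rewrite ler_weXn2l.
by rewrite expr1 in h3; split; lra.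
Qed.

Let norm4 (u : R) : `|u| ^+ 4 = u ^+ 4.
Proof. by rewrite -normrX ger0_norm// exprn_even_ge0. Qed.

Let int14 : P.-integrable setT (fun w => (1 + W 0 w ^+ 4)%:E).
Proof.
under eq_fun do rewrite EFinD.
by apply: integrableD => //; exact: finite_measure_integrable_cst.
Qed.

Let intW2 : P.-integrable setT (fun w => (W 0 w ^+ 2)%:E).
Proof.
apply: (le_integrable _ _ _ int14) => //.
  by apply/measurable_EFinP; exact: measurable_funX.
move=> w _; rewrite lee_fin normrX -norm4 [leRHS]ger0_norm ?addr_ge0 ?exprn_ge0//.
by have [] := pow_le (normr_ge0 (W 0 w)).
Qed.

Let intW1 : P.-integrable setT (fun w => (W 0 w)%:E).
Proof.
apply: (le_integrable _ _ _ int14) => //; first exact/measurable_EFinP.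
move=> w _; rewrite lee_fin -norm4 [leRHS]ger0_norm ?addr_ge0 ?exprn_ge0//.
by have [] := pow_le (normr_ge0 (W 0 w)).
Qed.

Let intW3 : P.-integrable setT (fun w => (`|W 0 w| ^+ 3)%:E).
Proof.
apply: (le_integrable _ _ _ int14) => //.
  apply/measurable_EFinP; apply: measurable_funX.
  by apply: (measurableT_comp (@normr_measurable R setT)).
move=> w _; rewrite lee_fin normrX normr_id -norm4 [leRHS]ger0_norm
  ?addr_ge0 ?exprn_ge0//.
by have [] := pow_le (normr_ge0 (W 0 w)).
Qed.

Let N : probability (measurableTypeR R) R := normal_prob 0 1.

Let D n := scaled_sum W (Num.sqrt n%:R)^-1 n.

Lemma clt_cdf (y eps : R) : 0 < eps ->
  \forall n \near \oo,
    normal_cdf y - eps <= prle P (D n) y <= normal_cdf y + eps.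
Proof.
move=> e0; pose p : R := normal_peak 1.
have p0 : 0 < p by rewrite normal_peak_gt0// oner_eq0.
(* Four errors of size [eta] arise: one smoothing for each of the two laws, the smooth limit
   theorem, and the displacement [2 * delta] of the normal distribution function. *)
pose eta := eps / 4; have eta0 : 0 < eta by rewrite divr_gt0.
pose delta := eps / (8 * p).
have d0 : 0 < delta by rewrite divr_gt0// mulr_gt0.
have pd : p * (delta + delta) = eta.
  by rewrite /delta /eta; field; rewrite gt_eqF.
have [k k0 hk] := logistic_step d0 eta0.
have L01 c x : 0 <= logistic k c x <= 1.
  by rewrite ltW ?logistic_gt0//= ltW// logistic_lt1.
have k30 : 0 <= k ^+ 3 by rewrite exprn_ge0// ltW.
near=> n.
have mD : measurable_fun setT (D n) by exact: (measurable_scaled_sum iidW).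
have mid : measurable_fun setT (idfun : measurableTypeR R -> R) by exact: measurable_id.
apply/andP; split.
(* The transition is centred so as to end at [y]; for the upper bound it begins there. *)
- pose c := y - delta.
  have h1 : `|\int[P]_w logistic k c (D n w) - \int[N]_y logistic k c y| <= eta.
    near: n; exact: (clt_smooth iidW meanW intW2 intW3 varW k30
      (taylor3_logistic c k0) (L01 c) eta0).
  have h2 := @logistic_le_prle _ T R P _ mD k c delta eta (fun x => (hk c x).2) eta0.
  have h3 := @prle_le_logistic _ _ R N _ mid k c delta eta (fun x => (hk c x).1) eta0.
  rewrite subrK in h2.
  have lt1 : c - delta < y by rewrite /c; lra.
  have h4 := normal_cdf_lipschitz lt1.
  have e1 : p * (y - (c - delta)) = eta by rewrite -pd /c; congr (_ * _); ring.
  rewrite -/p e1 in h4; move: h1; rewrite ler_norml => /andP[h5 h6].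
  rewrite -[prle N _ _]/(normal_cdf (c - delta)) in h3.
  rewrite /eta in h2 h3 h4 h5 h6 *; lra.
- pose c := y + delta.
  have h1 : `|\int[P]_w logistic k c (D n w) - \int[N]_y logistic k c y| <= eta.
    near: n; exact: (clt_smooth iidW meanW intW2 intW3 varW k30
      (taylor3_logistic c k0) (L01 c) eta0).
  have h2 := @prle_le_logistic _ T R P _ mD k c delta eta (fun x => (hk c x).1) eta0.
  have h3 := @logistic_le_prle _ _ R N _ mid k c delta eta (fun x => (hk c x).2) eta0.
  rewrite addrK in h2.
  have lt1 : y < c + delta by rewrite /c; lra.
  have h4 := normal_cdf_lipschitz lt1.
  have e1 : p * (c + delta - y) = eta by rewrite -pd /c; congr (_ * _); ring.
  rewrite -/p e1 in h4; move: h1; rewrite ler_norml => /andP[h5 h6].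
  rewrite -[prle N _ _]/(normal_cdf (c + delta)) in h3.
  rewrite /eta in h2 h3 h4 h5 h6 *; lra.
Unshelve. all: by end_near. Qed.

(** The fourth moment enters here: it gives [g (W 0)] a second moment even for quadratic [g]. *)
Let lln_comp (g : R -> R) (delta eps : R) : measurable_fun setT g ->
  (\int[P]_w (g (W 0 w))%:E = 0)%E -> (forall x, g x ^+ 2 <= 1 + x ^+ 4) ->
  0 < delta -> 0 < eps ->
  \forall n \near \oo,
    1 - eps <= prle P (scaled_sum (fun i w => g (W i w)) n%:R^-1 n) delta.
Proof.
move=> mg g0 g4 d0 e0; apply: (lln_le (iid_comp mg iidW)) => //.
apply: (le_integrable _ _ _ int14) => //.
  apply/measurable_EFinP; apply: measurable_funX.
  exact: (measurableT_comp mg).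
move=> w _; rewrite lee_fin [leLHS]ger0_norm ?sqr_ge0//.
by apply: (le_trans (g4 _)); exact: ler_norm.
Qed.

Definition student n w : R :=
  let m := scaled_sum W n%:R^-1 n w in
  Num.sqrt n%:R * m / Num.sqrt ((n.-1)%:R^-1 * \sum_(i < n) (W i w - m) ^+ 2).

Lemma measurable_student n : measurable_fun setT (student n).
Proof.
have mm := measurable_scaled_sum iidW n%:R^-1 n.
pose V w := (n.-1)%:R^-1 *
  \sum_(i < n) (W i w - scaled_sum W n%:R^-1 n w) ^+ 2.
(* The reciprocal is written as a power, whose measurability is known; a square root is nonnegative,
   so both agree, also at zero. *)
have -> : student n = (fun w => Num.sqrt n%:R * scaled_sum W n%:R^-1 n w *
    (Num.sqrt (V w) `^ (-1))).
  by apply/funext => w; rewrite powR_inv1 ?sqrtr_ge0.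
apply: measurable_funM; first exact: measurable_funM.
apply: (measurableT_comp (measurable_powR (-1))).
have ms : measurable_fun setT (@Num.sqrt R).
  by apply: continuous_measurable_fun; exact: sqrt_continuous.
apply: (measurableT_comp ms); apply: measurable_funM => //.
apply: measurable_sum => i; apply: measurable_funX.
by apply: measurable_funB => //; exact: mW.
Qed.

(** This expresses the sample variance through two averages of centred variables, [W ^+ 2 - 1] and
    [W], to which the law of large numbers applies. *)
Let sum_dev n w : (0 < n)%N ->
  \sum_(i < n) (W i w - scaled_sum W n%:R^-1 n w) ^+ 2 =
  n%:R * (1 + scaled_sum (fun i w => W i w ^+ 2 - 1) n%:R^-1 n w
    - scaled_sum W n%:R^-1 n w ^+ 2).
Proof.
move=> n0; have nn : n%:R != 0 :> R by rewrite pnatr_eq0 -lt0n.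
set b := scaled_sum W _ _ _; rewrite /scaled_sum sumrB.
have -> : \sum_(i < n) (1 : R) = n%:R by rewrite sumr_const card_ord.
have bE : \sum_(i < n) W i w = n%:R * b.
  by rewrite /b /scaled_sum mulrA mulfV// mul1r.
under eq_bigr do rewrite sqrrB.
rewrite big_split/= sumrB.
have -> : \sum_(i < n) W i w * b *+ 2 = (n%:R * b) * b *+ 2.
  by rewrite sumrMnl -mulr_suml bE.
have -> : \sum_(i < n) b ^+ 2 = n%:R * b ^+ 2.
  by rewrite sumr_const card_ord mulr_natl.
move: (\sum_(i < n) W i w ^+ 2) => Q; field.
exact: nn.
Qed.

Let sqrt_close (v k : R) : 0 <= k -> k < 1 -> 1 - k <= v -> v <= 1 + k ->
  [/\ 0 < Num.sqrt v, 1 - k <= Num.sqrt v & Num.sqrt v <= 1 + k].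
Proof.
move=> k0 k1 v1 v2; have v0 : 0 < v by lra.
have s0 : 0 < Num.sqrt v by rewrite sqrtr_gt0.
have sv : Num.sqrt v ^+ 2 = v by rewrite sqr_sqrtr// ltW.
split => //; rewrite leNgt; apply/negP => h; nra.
Qed.

Lemma student_cdf (x eps : R) : 0 < eps ->
  \forall n \near \oo,
    normal_cdf x - eps <= prle P (student n) x <= normal_cdf x + eps.
Proof.
move=> e0; pose p : R := normal_peak 1.
have p0 : 0 < p by rewrite normal_peak_gt0// oner_eq0.
(* At most six errors of size [eta] occur: four exceptional events, the limit theorem for [D], and a
   shift of the normal distribution function by [ga]. *)
pose eta := eps / 8; have eta0 : 0 < eta by rewrite divr_gt0.
pose ga := eta / p; have ga0 : 0 < ga by rewrite divr_gt0.
have pga : p * ga = eta by rewrite /ga mulrC divfK// gt_eqF.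
have nx : 0 <= `|x| by [].
(* If the denominator [q] of the statistic is within [k] of 1, the threshold [x * q] is within
   [k * |x| <= ga] of [x]; moreover [k < 1] keeps [q] positive. *)
pose k := ga / (ga + `|x| + 1).
have den0 : 0 < ga + `|x| + 1 by lra.
have k0 : 0 < k by rewrite divr_gt0.
have k1 : k < 1 by rewrite ltr_pdivrMr//; lra.
have kx : k * `|x| <= ga.
  rewrite /k mulrAC ler_pdivrMr// ler_wpM2l ?ltW//; lra.
have k40 : 0 < k / 4 by rewrite divr_gt0.
pose g1 (y : R) := y ^+ 2 - 1; pose g2 (y : R) := 1 - y ^+ 2.
have m2 : measurable_fun setT (fun y : R => y ^+ 2) by exact: measurable_funX.
have mg1 : measurable_fun setT g1 by apply: measurable_funB.
have mg2 : measurable_fun setT g2 by apply: measurable_funB.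
have mgN : measurable_fun setT (fun y : R => - y) by apply: measurable_funN.
have mid : measurable_fun setT (fun y : R => y) by [].
have i1 : P.-integrable setT (fun=> 1%:E) by exact: finite_measure_integrable_cst.
have I1 : (\int[P]_w (1 : R)%:E = 1)%E.
  transitivity (\int[P]_w (cst 1%E w))%E => //.
  by rewrite integral_cst// mul1e; exact: probability_setT.
have e1 : (\int[P]_w (g1 (W 0 w))%:E = 0)%E.
  under eq_integral do rewrite EFinB.
  by rewrite integralB// varW I1 subee.
have e2 : (\int[P]_w (g2 (W 0 w))%:E = 0)%E.
  under eq_integral do rewrite EFinB.
  by rewrite integralB// varW I1 subee.
have e3 : (\int[P]_w (- W 0 w)%:E = 0)%E.
  transitivity (\int[P]_w ((-1)%:E * (W 0 w)%:E))%E.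
    by apply: eq_integral => w _; rewrite -EFinM mulN1r.
  by rewrite integralZl// ?meanW ?mule0.
have b1 y : g1 y ^+ 2 <= 1 + y ^+ 4 by rewrite /g1; nra.
have b2 y : g2 y ^+ 2 <= 1 + y ^+ 4 by rewrite /g2; nra.
have b3 (y : R) : y ^+ 2 <= 1 + y ^+ 4.
  have [_ + _] := pow_le (normr_ge0 y).
  by rewrite norm4 -normrX ger0_norm ?sqr_ge0.
have b4 (y : R) : (- y) ^+ 2 <= 1 + y ^+ 4 by rewrite sqrrN.
near=> n.
have n1 : (1 < n)%N by near: n; exact: nbhs_infty_gt.
have n0 : (0 < n)%N by exact: ltn_trans n1.
(* This gives [n / (n - 1) <= 1 + k / 4], the bias factor of the sample variance. *)
have nk : 4 / k + 1 <= n%:R :> R by near: n; exact: nbhs_infty_ger.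
have l1 : 1 - eta <= prle P (scaled_sum (fun i w => g1 (W i w)) n%:R^-1 n) (k / 4).
  by near: n; exact: (lln_comp mg1 e1 b1 k40 eta0).
have l2 : 1 - eta <= prle P (scaled_sum (fun i w => g2 (W i w)) n%:R^-1 n) (k / 4).
  by near: n; exact: (lln_comp mg2 e2 b2 k40 eta0).
have l3 : 1 - eta <= prle P (scaled_sum (fun i w => W i w) n%:R^-1 n) (k / 4).
  by near: n; exact: (lln_comp mid meanW b3 k40 eta0).
have l4 : 1 - eta <= prle P (scaled_sum (fun i w => - W i w) n%:R^-1 n) (k / 4).
  by near: n; exact: (lln_comp mgN e3 b4 k40 eta0).
pose a := n%:R^-1 : R.
pose Z1 := scaled_sum (fun i w => g1 (W i w)) a n.
pose Z2 := scaled_sum (fun i w => g2 (W i w)) a n.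
pose Z3 := scaled_sum (fun i w => W i w) a n.
pose Z4 := scaled_sum (fun i w => - W i w) a n.
have mZ1 : measurable_fun setT Z1 := measurable_scaled_sum (iid_comp mg1 iidW) a n.
have mZ2 : measurable_fun setT Z2 := measurable_scaled_sum (iid_comp mg2 iidW) a n.
have mZ3 : measurable_fun setT Z3 := measurable_scaled_sum iidW a n.
have mZ4 : measurable_fun setT Z4 := measurable_scaled_sum (iid_comp mgN iidW) a n.
have mD : measurable_fun setT (D n) := measurable_scaled_sum iidW _ n.
have mT := measurable_student n.
(* Since [Z2 = - Z1] and [Z4 = - Z3], the four bounds are two-sided. The variance is then a factor
   in [[1, 1 + k / 4]] times a number in [[1 - k / 2, 1 + k / 4]], hence within [k] of 1. *)
have key w : Z1 w <= k / 4 -> Z2 w <= k / 4 -> Z3 w <= k / 4 -> Z4 w <= k / 4 ->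
    exists q, [/\ 0 < q, 1 - k <= q, q <= 1 + k & student n w = D n w / q].
  have Z2E : Z2 w = - Z1 w.
    rewrite /Z1 /Z2 /scaled_sum -mulrN -sumrN; congr (_ * _).
    by apply: eq_bigr => i _; rewrite /g1 /g2 opprB.
  have Z4E : Z4 w = - Z3 w by rewrite /Z3 /Z4 /scaled_sum -mulrN -sumrN.
  rewrite Z2E Z4E => z1 z2 z3 z4.
  pose V := (n.-1)%:R^-1 * \sum_(i < n) (W i w - scaled_sum W n%:R^-1 n w) ^+ 2.
  pose r : R := n%:R / (n.-1)%:R.
  have n1R : 0 < (n.-1)%:R :> R by rewrite ltr0n -ltnS prednK.
  have nE : n%:R = (n.-1)%:R + 1 :> R by rewrite natr1 prednK.
  have VE : V = r * (1 + Z1 w - Z3 w ^+ 2).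
    by rewrite /V sum_dev// mulrA [_^-1 * _]mulrC.
  have r1 : 1 <= r by rewrite ler_pdivlMr// mul1r nE; lra.
  have r2 : r <= 1 + k / 4.
    rewrite ler_pdivrMr// nE mulrDl mul1r lerD2l.
    have h : 4 / k <= (n.-1)%:R by rewrite nE in nk; lra.
    rewrite ler_pdivrMr// in h; lra.
  have z32 : Z3 w ^+ 2 <= k / 4 by nra.
  have z33 : 0 <= Z3 w ^+ 2 by exact: sqr_ge0.
  have c1 : 1 - k / 2 <= 1 + Z1 w - Z3 w ^+ 2 by lra.
  have c2 : 1 + Z1 w - Z3 w ^+ 2 <= 1 + k / 4 by lra.
  have V1 : 1 - k <= V by rewrite VE; nra.
  have V2 : V <= 1 + k by rewrite VE; nra.
  have [q0 q1 q2] := sqrt_close (ltW k0) k1 V1 V2.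
  exists (Num.sqrt V); split => //; rewrite /student -/V /D /scaled_sum mulrA.
  congr (_ * _ / _).
  have sn : Num.sqrt n%:R != 0 :> R by rewrite gt_eqF// sqrtr_gt0 ltr0n.
  apply: (mulfI sn); rewrite mulrA -expr2 sqr_sqrtr// !mulfV//.
  by rewrite pnatr_eq0 -lt0n.
have xk : - (k * `|x|) <= x * k <= k * `|x|.
  by rewrite -ler_norml normrM (gtr0_norm k0) mulrC.
have xq q : 1 - k <= q -> q <= 1 + k -> x - ga <= x * q <= x + ga.
  move=> q1 q2.
  have : `|x * (q - 1)| <= ga.
    rewrite normrM mulrC; apply: le_trans kx; rewrite ler_wpM2r//.
    by rewrite ler_norml; apply/andP; split; lra.
  rewrite ler_norml mulrBr mulr1 => /andP[? ?]; apply/andP; split; lra.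
have u1 : prle P (student n) x <= prle P (D n) (x + ga) +
    ((1 - prle P Z1 (k / 4) + (1 - prle P Z2 (k / 4))) +
     ((1 - prle P Z3 (k / 4)) + (1 - prle P Z4 (k / 4)))).
  apply: prle_le_slack => // w z1 z2 z3 z4.
  have [q [q0 q1 q2 ->]] := key w z1 z2 z3 z4.
  rewrite ler_pdivrMr// => /le_trans; apply.
  by have /andP[] := xq q q1 q2.
have u2 : prle P (D n) (x - ga) <= prle P (student n) x +
    ((1 - prle P Z1 (k / 4) + (1 - prle P Z2 (k / 4))) +
     ((1 - prle P Z3 (k / 4)) + (1 - prle P Z4 (k / 4)))).
  apply: prle_le_slack => // w z1 z2 z3 z4 h.
  have [q [q0 q1 q2 ->]] := key w z1 z2 z3 z4.
  rewrite ler_pdivrMr//; apply: (le_trans h).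
  by have /andP[] := xq q q1 q2.
have /andP[_ d1] : normal_cdf (x + ga) - eta <= prle P (D n) (x + ga) <=
    normal_cdf (x + ga) + eta by near: n; exact: clt_cdf.
have /andP[d2 _] : normal_cdf (x - ga) - eta <= prle P (D n) (x - ga) <=
    normal_cdf (x - ga) + eta by near: n; exact: clt_cdf.
have x1 : x < x + ga by rewrite ltrDl.
have x2 : x - ga < x by rewrite gtrBl.
have c1 := normal_cdf_lipschitz x1; have c2 := normal_cdf_lipschitz x2.
rewrite (_ : x + ga - x = ga) -/p ?pga in c1; last by ring.
rewrite (_ : x - (x - ga) = ga) -/p ?pga in c2; last by ring.
by rewrite /eta in l1 l2 l3 l4 d1 d2 c1 c2 *; apply/andP; split; lra.
Unshelve. all: by end_near. Qed.

End studentized_mean.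

(** * The law of the last coordinate *)

Section iterated_tail_integral.
Context {R : realType}.
Notation leb := (@lebesgue_measure R).
Local Open Scope ereal_scope.
Variable g : R -> \bar R.
Hypothesis mg : measurable_fun setT g.
Hypothesis g0 : forall v, 0 <= g v.

(** The integral of [g u_n] over [a < u_1 < ... < u_n]. *)
Fixpoint tail_integral (n : nat) : R -> \bar R :=
  if n is n'.+1 then fun a => \int[leb]_(u in `]a, +oo[) tail_integral n' u
  else g.

Lemma tail_integral_ge0 n a : 0 <= tail_integral n a.
Proof. by elim: n a => [//|n IH] a /=; apply: integral_ge0. Qed.

Lemma measurable_tail_integral n : measurable_fun setT (tail_integral n).
Proof.
elim: n => [//|n IH] /=.
pose F (p : R * R) := if (p.1 < p.2)%R then tail_integral n p.2 else 0.
have mF : measurable_fun setT F.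
  apply: measurable_fun_ifT => //; first exact: measurable_fun_ltr.
  exact: measurableT_comp.
have F0 p : 0 <= F p by rewrite /F; case: ifP => // _; exact: tail_integral_ge0.
have := measurable_fun_fubini_tonelli_F (m2 := leb) F mF F0.
apply: eq_measurable_fun => a _; rewrite /fubini_F [RHS]integral_mkcond.
by apply: eq_integral => u _; rewrite patchE mem_setE in_itv/= andbT.
Qed.

Lemma integral_itvoo_exprB (a u : R) n : (a < u)%R ->
  \int[leb]_(w in `]a, u[) ((u - w) ^+ n / n`!%:R)%:E =
  ((u - a) ^+ n.+1 / n.+1`!%:R)%:E.
Proof.
move=> au.
have cf : continuous (fun w : R => (u - w) ^+ n / n`!%:R)%R.
  move=> w; apply: cvgM; last exact: cvg_cst.
  apply: (@continuous_comp _ _ _ (fun w : R => u - w)%R (fun v => v ^+ n)%R).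
    by apply: cvgB; [exact: cvg_cst|exact: cvg_id].
  exact: exprn_continuous.
have dF (w : R) : is_derive w 1%R (fun w : R => - ((u - w) ^+ n.+1 / n.+1`!%:R))%R
    ((u - w) ^+ n / n`!%:R)%R.
  have d1 := is_deriveB (is_derive_cst (u : R) w 1%R) (is_derive_id w 1%R).
  have d2 := is_deriveN (is_deriveZ (n.+1`!%:R^-1)%R (is_deriveX n.+1 d1)).
  apply: (is_derive1_ext d2) => [y|].
    by rewrite !fctE mulrC.
  rewrite /GRing.scale/= !fctE /= sub0r factS natrM.
  have n1 : (n.+1%:R != 0 :> R)%R by rewrite pnatr_eq0.
  have nf : (n`!%:R != 0 :> R)%R by rewrite pnatr_eq0 -lt0n fact_gt0.
  by move: (_ ^+ n)%R (n.+1%:R)%R n1 => A B B0; field; rewrite nf B0.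
rewrite integral_itv_obnd_cbnd; last first.
  by apply/measurable_EFinP; apply: measurable_funTS; exact: continuous_measurable_fun.
rewrite integral_itv_bndo_bndc; last first.
  by apply/measurable_EFinP; apply: measurable_funTS; exact: continuous_measurable_fun.
rewrite (@continuous_FTC2 _ _
  (fun w : R => - ((u - w) ^+ n.+1 / n.+1`!%:R))%R)//.
- by rewrite subrr expr0n/= mul0r oppr0 -EFinB sub0r opprK.
- exact: continuous_subspaceT.
- have cF w : {for w, continuous (fun w : R => - ((u - w) ^+ n.+1 / n.+1`!%:R))%R}.
    by apply/differentiable_continuous/derivable1_diffP; have [] := dF w.
  split; first by move=> w _; have [] := dF w.
  + by apply: cvg_at_right_filter; apply: cF.
  + by apply: cvg_at_left_filter; apply: cF.
- by move=> w _; rewrite derive1E; have := dF w => ?; rewrite derive_val.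
Qed.

(** Cauchy's formula for repeated integration: the weight is the volume of the ordered [n]-tuples
    between [a] and [u]. In the induction Tonelli moves the new outer variable inside, where
    [integral_itvoo_exprB] integrates it. *)
Lemma tail_integralE n a : tail_integral n.+1 a =
  \int[leb]_(u in `]a, +oo[) (g u * ((u - a) ^+ n / n`!%:R)%:E).
Proof.
elim: n a => [|n IH] a.
  by apply: eq_integral => u _; rewrite expr0 divr1 mule1.
rewrite -[LHS]/(\int[leb]_(w in `]a, +oo[) tail_integral n.+1 w).
under eq_integral do rewrite IH.
pose F (p : R * R) := if (a < p.1 < p.2)%R then
  g p.2 * ((p.2 - p.1) ^+ n / n`!%:R)%:E else 0.
have mF : measurable_fun setT F.
  apply: measurable_fun_ifT => //.
    by apply: measurable_and; apply: measurable_fun_ltr.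
  apply: emeasurable_funM; first exact: measurableT_comp.
  apply/measurable_EFinP; apply: measurable_funM => //.
  by apply: measurable_funX; exact: measurable_funB.
have F0 p : 0 <= F p.
  rewrite /F; case: ifP => // /andP[_ /ltW pp].
  by rewrite mule_ge0// lee_fin divr_ge0// exprn_ge0// subr_ge0.
transitivity (\int[leb]_w \int[leb]_u F (w, u)).
  rewrite integral_mkcond; apply: eq_integral => w _.
  rewrite patchE mem_setE in_itv/= andbT /F/=.
  have [aw|aw] := ltP a w; last first.
    by rewrite integral0_eq.
  rewrite integral_mkcond; apply: eq_integral => u _.
  by rewrite patchE mem_setE in_itv/= andbT.
transitivity (\int[leb]_u \int[leb]_w F (w, u)).
  exact: (fubini_tonelli (m1 := leb) (m2 := leb) F mF F0).
rewrite [RHS]integral_mkcond.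
apply: eq_integral => u _; rewrite patchE mem_setE in_itv/= andbT /F/=.
have [au|ua] := ltP a u; last first.
  rewrite integral0_eq// => w _; case: ifP => // /andP[/lt_trans/[apply]].
  by rewrite ltNge ua.
rewrite -integral_itvoo_exprB// -ge0_integralZl//; last 2 first.
- apply/measurable_EFinP; apply: measurable_funTS; apply: measurable_funM => //.
  by apply: measurable_funX; exact: measurable_funB.
- move=> w; rewrite /= in_itv/= => /andP[_ /ltW wu].
  by rewrite lee_fin divr_ge0// exprn_ge0// subr_ge0.
rewrite [RHS]integral_mkcond; apply: eq_integral => w _.
by rewrite patchE mem_setE in_itv/=.
Qed.

End iterated_tail_integral.

Section tint_theory.
Context {R : realType}.

Lemma eq_tint n (f g : n.-tuple R -> \bar R) : f =1 g -> tint f = tint g.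
Proof. by move=> /funext ->. Qed.

Lemma tint0 n : tint (fun _ : n.-tuple R => 0%E) = 0%E.
Proof. by elim: n => //= n IH; rewrite integral0_eq. Qed.

End tint_theory.

(** * The GEV density as nested integrals in the coordinates u *)

Section gev_chain.
Context {R : realType}.
Notation leb := (@lebesgue_measure R).
Variables (mu sigma xi : R).
Hypothesis sigma0 : 0 < sigma.

Definition gev_u x :=
  if xi == 0 then expR (- ((x - mu) / sigma))
  else (1 + xi * ((x - mu) / sigma)) `^ (- xi^-1).

(** Minus the derivative of [gev_u] on the support, so that [gev_density x dx] is [du]. *)
Definition gev_density x := gev_rate mu sigma xi x * gev_u x.

Let L := gev_log mu sigma xi.
Let supp := gev_supp mu sigma xi.

Lemma gev_uE x : supp x -> gev_u x = expR (L x).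
Proof.
rewrite /gev_u /L /gev_log => Dx; case: ifP => // _.
by rewrite /powR gt_eqF// mulNr.
Qed.

Lemma gev_u_gt0 x : supp x -> 0 < gev_u x.
Proof. by move=> /gev_uE ->; exact: expR_gt0. Qed.

Lemma gev_u_lt x y : supp x -> supp y -> (gev_u x < gev_u y) = (y < x).
Proof. by move=> Dx Dy; rewrite !gev_uE// ltr_expR gev_log_lt. Qed.

Lemma measurable_gev_u : measurable_fun setT gev_u.
Proof.
have mz : measurable_fun setT (fun x : R => (x - mu) / sigma).
  by apply: measurable_funM => //; exact: measurable_funB.
rewrite /gev_u; have [_|_] := eqVneq xi 0.
  by apply: (measurableT_comp (@measurable_expR R)); apply: measurableT_comp.
apply: (measurableT_comp (measurable_powR _)).
by apply: measurable_funD => //; exact: measurable_funM.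
Qed.

Lemma gev_density_ge0 x : 0 <= gev_density x.
Proof.
rewrite mulr_ge0// ?gev_rate_ge0// /gev_u.
by case: ifP => _; rewrite ?expR_ge0 ?powR_ge0.
Qed.

Lemma gev_density0 x : ~~ supp x -> gev_density x = 0.
Proof. by move=> Dx; rewrite /gev_density /gev_rate ifN// mul0r. Qed.

Lemma ge0_integral_gev_u (g : R -> \bar R) :
  measurable_fun setT g -> (forall v, 0 <= g v)%E ->
  (\int[leb]_(u in `]0%R, +oo[) g u =
   \int[leb]_x ((gev_density x)%:E * g (gev_u x)))%E.
Proof.
move=> mg g0; rewrite ge0_integral_expR// (ge0_gev_substitution mu xi sigma0).
- apply: eq_integral => x _; rewrite /gev_density.
  have [Dx|Dx] := boolP (supp x); first by rewrite gev_uE// EFinM muleA.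
  by rewrite /gev_rate ifN// !mul0r !mul0e.
- apply: emeasurable_funM; first exact/measurable_EFinP.
  exact: measurableT_comp.
- by move=> v; rewrite mule_ge0// lee_fin expR_ge0.
Qed.

Variable h : R -> R.
Hypothesis h0 : forall u, 0 <= h u.
Hypothesis mh : measurable_fun setT h.

(** The recursion follows that of [tint]: the previous coordinate [x0] is carried along, so the
    ordering is imposed one coordinate at a time. *)
Fixpoint gev_chain x0 (s : seq R) : R :=
  if s is x :: s' then (x < x0)%R%:R * gev_density x * gev_chain x s'
  else h (gev_u x0).

Lemma gev_chainE x0 s : gev_chain x0 s =
  (path >%R x0 s)%:R * (\prod_(y <- s) gev_density y) * h (gev_u (last x0 s)).
Proof.
elim: s x0 => [|x s IH] x0 /=; first by rewrite big_nil !mul1r.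
by rewrite IH big_cons -mulnb natrM; ring.
Qed.

Let tail n := tail_integral (EFin \o h) n.

Let mtail n : measurable_fun setT (tail n).
Proof.
apply: measurable_tail_integral; first exact/measurable_EFinP.
by move=> v; rewrite lee_fin.
Qed.

Let tail0 n a : (0 <= tail n a)%E.
Proof. by apply: tail_integral_ge0 => v; rewrite lee_fin. Qed.

(** The constant [c] receives the factor of the coordinate fixed by the outer integral, so that the
    induction hypothesis applies under that integral. The order [x < x0] becomes
    [gev_u x0 < gev_u x], that is, one more tail integral. *)
Lemma tint_gev_chain n (c x0 : R) : 0 <= c -> supp x0 ->
  tint (fun t : n.-tuple R => (c * gev_chain x0 t)%:E) =
  (c%:E * tail n (gev_u x0))%E.
Proof.
elim: n c x0 => [|n IH] c x0 c0 Dx0; first by rewrite /= EFinM.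
pose G (u : R) := (if (gev_u x0 < u)%R then c%:E * tail n u else 0)%E.
have mG : measurable_fun setT G.
  apply: measurable_fun_ifT => //; first exact: measurable_fun_ltr.
  exact: measurable_funeM.
have G0 v : (0 <= G v)%E by rewrite /G; case: ifP => // _; rewrite mule_ge0.
transitivity (\int[leb]_x ((gev_density x)%:E * G (gev_u x)))%E; last first.
  rewrite -ge0_integral_gev_u//.
  rewrite -[tail n.+1 _]/(\int[leb]_(u in `]gev_u x0, +oo[) tail n u)%E.
  rewrite -ge0_integralZl//; last exact: measurable_funTS (mtail n).
  rewrite [LHS]integral_mkcond [RHS]integral_mkcond; apply: eq_integral => u _.
  rewrite !patchE !mem_setE !in_itv/= !andbT /G.
  case: (ltP (gev_u x0) u) => xu; last by case: ifP.
  by rewrite (lt_trans _ xu)// gev_u_gt0.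
apply: eq_integral => x _.
transitivity (tint (fun t : n.-tuple R =>
    (c * ((x < x0)%R%:R * gev_density x) * gev_chain x t)%:E)).
  by apply: eq_tint => t; rewrite /= -!mulrA.
have [Dx|Dx] := boolP (supp x); last first.
  rewrite gev_density0// mul0e -(tint0 n); apply: eq_tint => t.
  by rewrite !(mulr0, mul0r).
rewrite IH//; last by rewrite mulr_ge0// mulr_ge0// gev_density_ge0.
rewrite /G gev_u_lt//; case: (x < x0).
  by rewrite mul1r mulrC EFinM muleA.
by rewrite !(mulr0, mul0r) mul0e mule0.
Qed.

Lemma tint_gev_density n :
  tint (fun t : n.+1.-tuple R =>
    (gev_density (thead t) * gev_chain (thead t) (behead t))%:E) =
  (\int[leb]_(u in `]0%R, +oo[) ((h u)%:E * (u ^+ n / n`!%:R)%:E))%E.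
Proof.
transitivity (tail n.+1 0); last first.
  have mE : measurable_fun setT (EFin \o h) by exact/measurable_EFinP.
  have hE v : (0 <= (EFin \o h) v)%E by rewrite lee_fin.
  rewrite /tail (tail_integralE mE hE).
  by under eq_integral do rewrite subr0.
rewrite -[tail n.+1 _]/(\int[leb]_(u in `]0%R, +oo[) tail n u)%E ge0_integral_gev_u//.
apply: eq_integral => x _.
transitivity (tint (fun t : n.-tuple R => (gev_density x * gev_chain x t)%:E)).
  by apply: eq_tint => t; rewrite theadE.
have [Dx|Dx] := boolP (supp x); first by rewrite tint_gev_chain// gev_density_ge0.
rewrite gev_density0// mul0e -(tint0 n); apply: eq_tint => t.
by rewrite mul0r.
Qed.

End gev_chain.

Section gev_law.
Context {R : realType}.
Notation leb := (@lebesgue_measure R).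
Variables (mu sigma xi : R).
Hypothesis sigma0 : 0 < sigma.

Let u := gev_u mu sigma xi.
Let L := gev_log mu sigma xi.
Let supp := gev_supp mu sigma xi.
Let dens := gev_density mu sigma xi.

Lemma gev_r_pdf_neq0 r (t : r.-tuple R) : gev_r_pdf mu sigma xi t != 0 ->
  (forall i j, (i < j < r)%N -> nth 0 t j < nth 0 t i) /\
  (forall j, (j < r)%N -> supp (nth 0 t j)).
Proof. by rewrite /gev_r_pdf; case: asboolP => //; rewrite eqxx. Qed.

(** Each factor [sigma^-1 * (1 + xi * z) ^ (- 1 - 1 / xi)] is a [gev_density]. The density is thus
    the Jacobian of the coordinates [u], restricted to ordered tuples, times [expR (- u_r)]. *)
Lemma gev_r_pdfE n (t : n.+1.-tuple R) : gev_r_pdf mu sigma xi t =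
  (sorted >%R t)%:R * (\prod_(y <- t) dens y) * expR (- u (nth 0 t n)).
Proof.
rewrite /gev_r_pdf; case: asboolP => [[Hs Hd]|nH]; last first.
  (* Off the support of the density, either the tuple is not decreasing or some factor [dens y]
     vanishes. *)
  have [st|nst] := boolP (sorted >%R t); last by rewrite !mul0r.
  have [Hd|/allPn[y yt Dy]] := boolP (all supp t); last first.
    by rewrite (big_rem y)//= [dens y]gev_density0// !(mul0r, mulr0).
  exfalso; apply: nH; split.
    move=> i j /andP[ij jn].
    have tr : transitive (>%R : rel R).
      by move=> a b c ba cb; exact: lt_trans cb ba.
    apply: (sorted_ltn_nth tr 0 st) => //; rewrite inE size_tuple//.
    exact: ltn_trans jn.
  by move=> j jn; apply: (allP Hd); rewrite mem_nth// size_tuple.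
have -> : sorted >%R t.
  apply/(sortedP 0) => i; rewrite size_tuple => iN.
  by apply: Hs; rewrite ltnSn.
rewrite mul1r.
have -> : \prod_(y <- t) dens y = \prod_(i < n.+1) dens (nth 0 t i).
  by rewrite (big_nth 0) size_tuple big_mkord.
have -> : \prod_(i < n.+1) dens (nth 0 t i) =
    sigma ^- n.+1 * expR (\sum_(i < n.+1) ((xi + 1) * L (nth 0 t i))).
  rewrite expR_sum -exprVn -[in sigma^-1 ^+ _](card_ord n.+1) -prodr_const.
  rewrite -big_split/=; apply: eq_bigr => i _.
  have Di : gev_supp mu sigma xi (nth 0 t i) by exact: Hd.
  rewrite /dens /gev_density /gev_rate Di gev_uE// -mulrA -expRD.
  by rewrite mulrDl mul1r.
rewrite -mulrA -expRD.
have [xi0|xi0] := eqVneq xi 0.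
  rewrite /u /gev_u xi0 eqxx; congr (_ * expR _); rewrite addrC; congr (_ + _).
  rewrite -sumrN; apply: eq_bigr => i _.
  by rewrite add0r mul1r /L /gev_log xi0 eqxx.
rewrite /u /gev_u (negbTE xi0); congr (_ * expR _); rewrite addrC; congr (_ + _).
rewrite mulr_sumr -sumrN; apply: eq_bigr => i _.
by rewrite /L /gev_log (negbTE xi0); field.
Qed.

(** The weight [v ^+ n / n!] of Cauchy's formula and the factor [expR (- v)] together are the Gamma
    density of shape [n + 1]. *)
Lemma tint_gev_r_pdf n (B : set R) : measurable B ->
  tint (fun t : n.+1.-tuple R =>
    (\1_B (u (nth 0 t n)) * gev_r_pdf mu sigma xi t)%:E) =
  (\int[leb]_(v in `]0%R, +oo[) (\1_B v * (v ^+ n * expR (- v) / n`!%:R))%:E)%E.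
Proof.
move=> mB; pose h v := \1_B v * expR (- v).
have h0 v : 0 <= h v by rewrite mulr_ge0// expR_ge0.
have mh : measurable_fun setT h.
  apply: measurable_funM; first exact: measurable_indic.
  by apply: (measurableT_comp (@measurable_expR R)).
transitivity (tint (fun t : n.+1.-tuple R =>
    (dens (thead t) * gev_chain mu sigma xi h (thead t) (behead t))%:E)); last first.
  rewrite (tint_gev_density mu xi sigma0 h0 mh); apply: eq_integral => v _.
  by rewrite -EFinM /h; congr (_%:E); ring.
apply: eq_tint => t; rewrite gev_r_pdfE gev_chainE /h.
case/tupleP: t => x t; rewrite theadE /=.
have -> : nth 0 (x :: t) n = last x t by rewrite (last_nth 0) size_tuple.
by rewrite big_cons; congr (_%:E); rewrite /u /dens; ring.
Qed.

End gev_law.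

(** * Gamma densities and moments of the last coordinate *)

Section gamma_density.
Context {R : realType}.
Notation leb := (@lebesgue_measure R).

(* the density of the Gamma distribution of shape [n + 1] *)
Definition gamma_pdf n (v : R) : R := v ^+ n * expR (- v) / n`!%:R.

Lemma gamma_pdf_ge0 n v : 0 < v -> 0 <= gamma_pdf n v.
Proof. by move=> /ltW v0; rewrite divr_ge0// mulr_ge0// ?expR_ge0// exprn_ge0. Qed.

Lemma measurable_gamma_pdf n : measurable_fun setT (gamma_pdf n).
Proof.
apply: measurable_funM => //; apply: measurable_funM => //.
by apply: (measurableT_comp (@measurable_expR R)).
Qed.

Lemma gamma_pdfS n v : v * gamma_pdf n v = n.+1%:R * gamma_pdf n.+1 v.
Proof.
rewrite /gamma_pdf factS natrM exprS.
have n1 : n.+1%:R != 0 :> R by rewrite pnatr_eq0.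
have nf : n`!%:R != 0 :> R by rewrite pnatr_eq0 -lt0n fact_gt0.
by move: (n.+1%:R) n1 => B B0; field; rewrite nf B0.
Qed.

Lemma integral_expRN_tail (a : R) :
  (\int[leb]_(u in `]a, +oo[) (expR (- u))%:E = (expR (- a))%:E)%E.
Proof.
have dF (x : R) : is_derive x 1 (fun y : R => - expR (- y)) (expR (- x)).
  have d1 := is_deriveNid x (1 : R).
  have d2 := @is_derive1_comp _ (@expR R) (fun y => - y) x _ _
    (is_derive_expR _) d1.
  by apply: (is_derive1_ext (is_deriveN d2)) => //; rewrite mulrN1 opprK.
have cF x : {for x, continuous (fun y : R => - expR (- y))}.
  by apply/differentiable_continuous/derivable1_diffP; have [] := dF x.
have ce : continuous (fun u : R => expR (- u)).
  move=> x; apply: (@continuous_comp _ _ _ (fun y : R => - y) expR).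
    exact: opp_continuous.
  exact: continuous_expR.
rewrite integral_itv_obnd_cbnd; last first.
  by apply/measurable_EFinP/measurable_funTS; exact: continuous_measurable_fun.
rewrite (@ge0_continuous_FTC2y _ _ (fun y : R => - expR (- y)) a 0).
- by rewrite -EFinB sub0r opprK.
- by move=> x _; exact: expR_ge0.
- exact: continuous_subspaceT.
- by rewrite -[0]oppr0; apply: cvgN; exact: cvgr_expR.
- by move=> x _; have [] := dF x.
- by apply: cvg_at_right_filter; exact: cF.
- by move=> x _; rewrite derive1E; have := dF x => ?; rewrite derive_val.
Qed.

(** Every iterated tail integral of [expR (- u)] is [expR (- a)]; at [a = 0], Cauchy's formula reads
    this as the mass of the Gamma density. *)
Lemma integral_gamma_pdf n :
  (\int[leb]_(v in `]0%R, +oo[) (gamma_pdf n v)%:E = 1)%E.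
Proof.
pose g := EFin \o (fun u : R => expR (- u)).
have mg : measurable_fun setT g.
  by apply/measurable_EFinP; apply: (measurableT_comp (@measurable_expR R)).
have g0 v : (0 <= g v)%E by rewrite lee_fin expR_ge0.
have tE k a : tail_integral g k a = (expR (- a))%:E.
  elim: k a => [//|k IH] a /=; rewrite -integral_expRN_tail.
  by apply: eq_integral => u _; rewrite IH.
transitivity (tail_integral g n.+1 0); last by rewrite tE oppr0 expR0.
rewrite (tail_integralE mg g0); apply: eq_integral => v _.
by rewrite -EFinM subr0 /gamma_pdf; congr (_%:E); ring.
Qed.

Lemma integrable_gamma_pdf n :
  leb.-integrable `]0%R, +oo[ (EFin \o gamma_pdf n).
Proof.
apply/integrableP; split.
  by apply/measurable_EFinP/measurable_funTS; exact: measurable_gamma_pdf.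
rewrite (_ : integral _ _ _ = \int[leb]_(v in `]0%R, +oo[) (gamma_pdf n v)%:E)%E.
  by rewrite integral_gamma_pdf ltry.
apply: eq_integral => v; rewrite inE/= in_itv/= andbT => v0.
by rewrite ger0_norm// gamma_pdf_ge0.
Qed.

End gamma_density.

Section gev_expectation.
Context {R : realType} d (T : measurableType d) (P : probability T R).
Notation leb := (@lebesgue_measure R).
Variables (mu sigma xi : R) (n : nat) (X : T -> n.+1.-tuple R).
Hypothesis sigma0 : 0 < sigma.
Hypothesis mX : measurable_fun setT (fun w => nth 0 (X w) n).
Hypothesis lawX : has_gev_r_law P mu sigma xi X.

Let V w := gev_u mu sigma xi (nth 0 (X w) n).

Lemma measurable_gev_last : measurable_fun setT V.
Proof. by apply: (measurableT_comp (measurable_gev_u mu sigma xi)). Qed.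

Let PV (B : set R) : measurable B -> P (V @^-1` B) =
  (\int[leb]_(v in `]0%R, +oo[) (\1_B v * gamma_pdf n v)%:E)%E.
Proof.
move=> mB; rewrite -(tint_gev_r_pdf mu xi sigma0 n mB).
pose A := (fun t : n.+1.-tuple R => gev_u mu sigma xi (nth 0 t n)) @^-1` B.
have mA : measurable A.
  rewrite -[A]setTI; apply: (measurableT_comp (measurable_gev_u mu sigma xi)) => //.
  have -> : (fun t : n.+1.-tuple R => nth 0 t n) = (@tnth _ _ ^~ ord_max).
    by apply/funext => t; rewrite (tnth_nth 0).
  exact: measurable_tnth.
by rewrite -[LHS]/(P (X @^-1` A)) lawX.
Qed.

Lemma ge0_expectation_gev_last (phi : R -> \bar R) :
  measurable_fun setT phi -> (forall v, 0 <= phi v)%E ->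
  (\int[P]_w phi (V w) =
   \int[leb]_(v in `]0%R, +oo[) (phi v * (gamma_pdf n v)%:E))%E.
Proof.
move=> mphi phi0; have mV := measurable_gev_last.
rewrite -(ge0_integral_law P mV mphi phi0).
pose w (v : R) : R := if 0 < v then gamma_pdf n v else 0.
have mw : measurable_fun setT w.
  apply: measurable_fun_ifT => //; first exact: measurable_fun_ltr.
  exact: measurable_gamma_pdf.
rewrite (@ge0_integral_weighted_image _ _ _ _ _ leb (law P mV) w idfun)//.
- rewrite [RHS]integral_mkcond; apply: eq_integral => v _.
  rewrite patchE mem_setE in_itv/= andbT /w muleC.
  by case: ifP => // _; rewrite mule0.
- by move=> v; rewrite /w; case: ifP => // /gamma_pdf_ge0.
- exact: measurable_id.
- move=> B mB; transitivity (P (V @^-1` B)) => //.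
  rewrite (PV mB) [LHS]integral_mkcond; apply: eq_integral => v _.
  rewrite patchE mem_setE in_itv/= andbT /w mulrC.
  by case: ifP => // _; rewrite mul0r.
Qed.

Lemma expectation_gev_last (phi : R -> R) : measurable_fun setT phi ->
  (\int[P]_w (phi (V w))%:E =
   \int[leb]_(v in `]0%R, +oo[) (phi v * gamma_pdf n v)%:E)%E.
Proof.
move=> mphi; rewrite integralE [RHS]integralE.
have mE : measurable_fun setT (EFin \o phi) by exact/measurable_EFinP.
have pE : {in `]0, +oo[, forall v, (fun v => (phi v * gamma_pdf n v)%:E)^\+%E v =
    ((EFin \o phi)^\+ v * (gamma_pdf n v)%:E)%E}.
  move=> v; rewrite in_itv/= andbT => /(gamma_pdf_ge0 n) v0.
  by rewrite !funeposE maxe_pMl// mul0e EFinM.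
have nE : {in `]0, +oo[, forall v, (fun v => (phi v * gamma_pdf n v)%:E)^\-%E v =
    ((EFin \o phi)^\- v * (gamma_pdf n v)%:E)%E}.
  move=> v; rewrite in_itv/= andbT => /(gamma_pdf_ge0 n) v0.
  by rewrite !funenegE maxe_pMl// mul0e EFinM mulNe.
congr (_ - _)%E.
  under [RHS]eq_integral => v.
    rewrite mem_setE => /pE ->; over.
  rewrite -ge0_expectation_gev_last//; last exact: measurable_funepos.
  by apply: eq_integral => w _; rewrite !funeposE.
under [RHS]eq_integral => v.
  rewrite mem_setE => /nE ->; over.
rewrite -ge0_expectation_gev_last//; last exact: measurable_funeneg.
by apply: eq_integral => w _; rewrite !funenegE.
Qed.

Lemma integrable_gev_last (phi : R -> R) : measurable_fun setT phi ->
  leb.-integrable `]0%R, +oo[ (fun v => (phi v * gamma_pdf n v)%:E) ->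
  P.-integrable setT (fun w => (phi (V w))%:E).
Proof.
move=> mphi /integrableP[_ phioo]; apply/integrableP; split.
  by apply/measurable_EFinP; apply: (measurableT_comp mphi); exact: measurable_gev_last.
rewrite (ge0_expectation_gev_last (phi := fun v => `|(phi v)%:E|%E))//; last first.
  by apply: measurableT_comp => //; exact/measurable_EFinP.
apply: le_lt_trans phioo; apply: ge0_le_integral => //.
- move=> v; rewrite /= in_itv/= andbT => /(gamma_pdf_ge0 n) v0.
  by rewrite mule_ge0.
- apply: measurable_funTS; apply: emeasurable_funM.
    by apply: measurableT_comp => //; exact/measurable_EFinP.
  by apply/measurable_EFinP; exact: measurable_gamma_pdf.
- apply: measurable_funTS; apply: measurableT_comp => //.
  by apply/measurable_EFinP/measurable_funM => //; exact: measurable_gamma_pdf.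
- move=> v; rewrite /= in_itv/= andbT => /(gamma_pdf_ge0 n) v0.
  by rewrite -EFinM lee_fin normrM (ger0_norm v0).
Qed.

End gev_expectation.

Section log_moments.
Context {R : realType}.
Notation leb := (@lebesgue_measure R).

Lemma integrable_gamma_pdfZ (c : R) n :
  leb.-integrable `]0%R, +oo[ (fun v : R => (c * gamma_pdf n v)%:E).
Proof.
have mD : measurable (`]0%R, +oo[%classic : set (measurableTypeR R)).
  exact: measurable_itv.
have h := integrableZl mD c (integrable_gamma_pdf n).
by apply: (eq_integrable mD _ _ _ h) => v _; rewrite /= EFinM.
Qed.

Lemma integral_id_gamma_pdf n :
  (\int[leb]_(v in `]0%R, +oo[) (v * gamma_pdf n v)%:E = n.+1%:R%:E)%E.
Proof.
transitivity (\int[leb]_(v in `]0%R, +oo[)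
    (n.+1%:R%:E * (gamma_pdf n.+1 v)%:E))%E.
  by apply: eq_integral => v _; rewrite gamma_pdfS.
rewrite integralZl//; last exact: integrable_gamma_pdf.
by rewrite integral_gamma_pdf mule1.
Qed.

Lemma gamma_pdfX k n : exists c : R, forall v : R,
  v ^+ k * gamma_pdf n v = c * gamma_pdf (k + n) v.
Proof.
elim: k => [|k [c IH]]; first by exists 1 => v; rewrite expr0.
by exists (c * (k + n).+1%:R) => v; rewrite exprS -mulrA IH mulrCA gamma_pdfS mulrA.
Qed.

Lemma integrable_exp_gamma_pdf k n :
  leb.-integrable `]0%R, +oo[ (fun v : R => (v ^+ k * gamma_pdf n v)%:E).
Proof.
have [c cE] := gamma_pdfX k n.
have h := integrable_gamma_pdfZ c (k + n).
by apply: (eq_integrable _ _ _ _ h) => // v _; rewrite cE.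
Qed.

Lemma gamma_pdfV n (v : R) : 0 < v ->
  v^-1 * gamma_pdf n.+1 v = n.+1%:R^-1 * gamma_pdf n v.
Proof.
move=> v0; apply: (mulfI (lt0r_neq0 v0)).
by rewrite mulrA mulfV ?gt_eqF// mul1r mulrCA gamma_pdfS mulrA mulVf ?mul1r.
Qed.

(** One term of the exponential series gives [|l| ^+ 4 / 4! <= expR |l|], and for [l = ln v] the
    right-hand side is [v] or [v^-1]. *)
Lemma ln_exp4_le (v : R) : 0 < v -> ln v ^+ 4 <= 24 * (v + v^-1).
Proof.
move=> v0; have h := expR_ge1Dxn 3 (normr_ge0 (ln v)).
have e1 : `|ln v| ^+ 4 = ln v ^+ 4 by rewrite -normrX ger0_norm// exprn_even_ge0.
have e2 : expR `|ln v| <= v + v^-1.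
  have vi : 0 < v^-1 by rewrite invr_gt0.
  have [l0|l0] := leP 0 (ln v); first by rewrite ger0_norm// lnK//; lra.
  by rewrite ltr0_norm// expRN lnK//; lra.
rewrite e1 in h; rewrite (_ : 4`! = 24)%N in h; last by [].
have h1 : ln v ^+ 4 / 24%:R <= v + v^-1 by lra.
by rewrite mulrC -ler_pdivrMr.
Qed.

(** Multiplying a Gamma density by [v] raises its shape and dividing lowers it. The latter uses
    shape at least two, whence the index [n.+1]. *)
Lemma integrable_ln_gamma_pdf n :
  leb.-integrable `]0%R, +oo[ (fun v : R => (ln v ^+ 4 * gamma_pdf n.+1 v)%:E).
Proof.
apply: (@le_integrable _ _ _ leb `]0%R, +oo[ _ _ (fun v =>
  (24 * n.+2%:R * gamma_pdf n.+2 v)%:E + (24 / n.+1%:R * gamma_pdf n v)%:E)%E) => //.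
- apply/measurable_EFinP/measurable_funTS; apply: measurable_funM; last exact: measurable_gamma_pdf.
  by apply: measurable_funX; exact: measurable_ln.
- move=> v; rewrite /= in_itv/= andbT => v0.
  rewrite lee_fin.
  have g0 := gamma_pdf_ge0 n.+1 v0.
  have -> : 24 * n.+2%:R * gamma_pdf n.+2 v + 24 / n.+1%:R * gamma_pdf n v =
     24 * (v + v^-1) * gamma_pdf n.+1 v.
    rewrite -mulrA -gamma_pdfS -[24 / _ * _]mulrA -(gamma_pdfV _ v0).
    by rewrite -mulrDr -mulrDl mulrA.
  rewrite [leLHS]normrM [leRHS]normrM !(ger0_norm g0) ler_wpM2r//.
  rewrite ger0_norm ?exprn_even_ge0//.
  by apply: le_trans (ler_norm _); exact: ln_exp4_le.
- by apply: integrableD => //; exact: integrable_gamma_pdfZ.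
Qed.

End log_moments.

(** * The digamma function as a logarithmic moment *)

Section digamma_integral.
Context {R : realType}.
Notation leb := (@lebesgue_measure R).
Variable n : nat.

Let f (x t : R) : R := t `^ (x - 1) * expR (- t).
(** The square root of [t], for [t > 0]. *)
Let p (t : R) : R := expR (ln t / 2).
(** This is [2 * t ^+ n * (1 + t) ^+ 2 * expR (- t)], the product of the bounds
    [t ^+ n * (p + p ^+ 3)] for the power and [2 * (p + p^-1)] for the logarithm, times
    [expR (- t)]. Only integer powers remain, so it is a combination of Gamma densities. *)
Let G0 (t : R) : R := 2 * (t ^+ n * expR (- t) + 2 * (t ^+ n.+1 * expR (- t))
  + t ^+ n.+2 * expR (- t)).
Let a : R := n.+2%:R.

Let p2 (t : R) : 0 < t -> p t ^+ 2 = t.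
Proof. by move=> t0; rewrite /p -expRM_natl mulrC divfK// lnK. Qed.

(** The exponent [x - 1] lies between [n + 1/2] and [n + 3/2]; one end bounds the power for [t >= 1]
    and the other for [t < 1]. *)
Let powR_le (x t : R) : 0 < t -> a - 2^-1 < x < a + 2^-1 ->
  t `^ (x - 1) <= t ^+ n * (p t + p t ^+ 3).
Proof.
move=> t0 /andP[]; rewrite /a -natr1 => xl xr.
rewrite /powR (gt_eqF t0).
have tn : t ^+ n = expR (n%:R * ln t) by rewrite expRM_natl lnK.
have -> : t ^+ n * (p t + p t ^+ 3) =
    expR ((n%:R + 2^-1) * ln t) + expR ((n%:R + 3 / 2) * ln t).
  rewrite mulrDr /p -expRM_natl tn -!expRD.
  by congr (expR _ + expR _); field.
rewrite -natr1 in xl xr.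
have [l0|l0] := leP 0 (ln t).
  apply: (@le_trans _ _ (expR ((n%:R + 3 / 2) * ln t))).
    by rewrite ler_expR ler_wpM2r//; lra.
  by rewrite lerDr expR_ge0.
apply: (@le_trans _ _ (expR ((n%:R + 2^-1) * ln t))).
  by rewrite ler_expR ler_nM2r//; lra.
by rewrite lerDl expR_ge0.
Qed.

Let ln_le (t : R) : 0 < t -> `|ln t| <= 2 * (p t + (p t)^-1).
Proof.
move=> t0; have h1 := expR_ge1Dx (ln t / 2).
have h2 := expR_ge1Dx (- (ln t / 2)).
have q0 : 0 < (p t)^-1 by rewrite invr_gt0 expR_gt0.
have p0 : 0 < p t by exact: expR_gt0.
rewrite expRN in h2; rewrite ler_norml; apply/andP; split.
  by rewrite /p in p0 q0 *; lra.
by rewrite /p in p0 q0 *; lra.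
Qed.

Let f_ge0 (x t : R) : 0 <= f x t.
Proof. by rewrite mulr_ge0 ?powR_ge0 ?expR_ge0. Qed.

Let fG (x t : R) : 0 < t -> a - 2^-1 < x < a + 2^-1 -> f x t <= G0 t.
Proof.
move=> t0 xI; have h := powR_le t0 xI; rewrite /f /G0.
have p0 : 0 < p t by exact: expR_gt0.
have e0 : 0 < expR (- t) by exact: expR_gt0.
have tn0 : 0 <= t ^+ n by rewrite exprn_ge0// ltW.
have -> : 2 * (t ^+ n * expR (- t) + 2 * (t ^+ n.+1 * expR (- t))
    + t ^+ n.+2 * expR (- t)) =
  t ^+ n * (2 * (1 + p t ^+ 2) ^+ 2) * expR (- t).
  by rewrite (p2 t0) !exprS; ring.
rewrite ler_pM2r//; apply: (le_trans h).
rewrite ler_wpM2l//; nra.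
Qed.

Let lnfG (x t : R) : 0 < t -> a - 2^-1 < x < a + 2^-1 -> `|ln t * f x t| <= G0 t.
Proof.
move=> t0 xI; have h := powR_le t0 xI; have l := ln_le t0.
have p0 : 0 < p t by exact: expR_gt0.
have e0 : 0 < expR (- t) by exact: expR_gt0.
have tn0 : 0 <= t ^+ n by rewrite exprn_ge0// ltW.
rewrite normrM (ger0_norm (f_ge0 _ _)) /f mulrA.
apply: (@le_trans _ _ (2 * (p t + (p t)^-1) * (t ^+ n * (p t + p t ^+ 3)) * expR (- t))).
  by rewrite ler_pM2r// ler_pM// powR_ge0.
rewrite le_eqVlt; apply/orP; left; apply/eqP.
have -> : 2 * (p t + (p t)^-1) * (t ^+ n * (p t + p t ^+ 3)) =
  2 * t ^+ n * (1 + p t ^+ 2) ^+ 2.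
  by field; rewrite gt_eqF.
by rewrite (p2 t0) /G0 !exprS; ring.
Qed.

Let G0E t : G0 t = 2 * n`!%:R * gamma_pdf n t
  + 4 * n.+1`!%:R * gamma_pdf n.+1 t + 2 * n.+2`!%:R * gamma_pdf n.+2 t.
Proof.
have F k (c : R) : c * k`!%:R * gamma_pdf k t = c * (t ^+ k * expR (- t)).
  rewrite /gamma_pdf; field.
  by rewrite pnatr_eq0 -lt0n fact_gt0.
by rewrite !F /G0; ring.
Qed.

(** The absolute value makes the dominating function nonnegative on the whole line, negative [t]
    included. *)
Let G (t : R) : R := `|G0 t|.

Let intG : leb.-integrable `]0%R, +oo[ (EFin \o G).
Proof.
apply: (@integrable_abse _ _ _ leb _ (EFin \o G0)).
rewrite (_ : EFin \o G0 = (fun t => (2 * n`!%:R * gamma_pdf n t)%:E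
  + (4 * n.+1`!%:R * gamma_pdf n.+1 t)%:E + (2 * n.+2`!%:R * gamma_pdf n.+2 t)%:E)%E).
  by apply: integrableD => //; [apply: integrableD => //|];
    exact: integrable_gamma_pdfZ.
by apply/funext => t; rewrite /= G0E.
Qed.

Let mf x : measurable_fun setT (f x).
Proof.
apply: measurable_funM; first exact: measurable_powR.
by apply: (measurableT_comp (@measurable_expR R)).
Qed.

Let intf (x : R) : x \in `]a - 2^-1, a + 2^-1[ -> leb.-integrable `]0%R, +oo[ (EFin \o f x).
Proof.
rewrite in_itv/= => xI.
apply: (le_integrable _ _ _ intG) => //.
  by apply/measurable_EFinP/measurable_funTS; exact: mf.
move=> t; rewrite /= in_itv/= andbT => t0.
by rewrite lee_fin /G normr_id ger0_norm// (le_trans (fG t0 xI))// ler_norm.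
Qed.

Let derf (x t : R) : 0 < t -> is_derive x 1 (f ^~ t) (ln t * f x t).
Proof.
move=> t0.
have d1 : is_derive x 1 (fun x : R => (x - 1) * ln t) (ln t).
  apply: (is_derive1_ext (is_deriveZ (ln t)
    (is_deriveB (is_derive_id x 1) (is_derive_cst (1 : R) x 1)))) => [y|].
    by rewrite mulrC.
  by rewrite subr0 /GRing.scale/= mulr1.
have d2 := @is_derive1_comp _ (@expR R) (fun x : R => (x - 1) * ln t) x _ _
    (is_derive_expR _) d1.
apply: (is_derive1_ext (is_deriveZ (expR (- t)) d2)) => [y|].
  by rewrite /f /powR gt_eqF//; exact: mulrC.
by rewrite /f /powR gt_eqF// /GRing.scale/=; ring.
Qed.

Let a_itv : a \in `]a - 2^-1, a + 2^-1[.
Proof. by rewrite in_itv/=; apply/andP; split; lra. Qed.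

Let d1f (x t : R) : 0 < t -> partial1of2 f x t = ln t * f x t.
Proof.
move=> t0; rewrite partial1of2E; have d := derf x t0.
by rewrite derive_val.
Qed.

Let G_ub (x t : R) : `]a - 2^-1, a + 2^-1[%classic x -> `]0%R, +oo[%classic t ->
  `|partial1of2 f x t| <= G t.
Proof.
rewrite /= !in_itv/= andbT => xI t0; rewrite d1f//.
by apply: (le_trans (lnfG t0 xI)); exact: ler_norm.
Qed.

Let derivf (x t : R) : `]a - 2^-1, a + 2^-1[%classic x -> `]0%R, +oo[%classic t ->
  derivable (f ^~ t) x 1.
Proof.
by rewrite /= !in_itv/= andbT => xI t0; have [] := derf x t0.
Qed.

Let f_a (t : R) : 0 < t -> f a t = n.+1`!%:R * gamma_pdf n.+1 t.
Proof.
move=> t0; rewrite /f /a /gamma_pdf -(natr1 n.+1) addrK powR_mulrn ?ltW//.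
by rewrite [RHS]mulrC divfK// pnatr_eq0 -lt0n fact_gt0.
Qed.

Lemma Gamma_nat : Gamma a = n.+1`!%:R.
Proof.
rewrite /Gamma -[RHS]mulr1.
transitivity (\int[leb]_(t in `]0%R, +oo[) (n.+1`!%:R * gamma_pdf n.+1 t))%R.
  by apply: eq_Rintegral => t; rewrite inE/= in_itv/= andbT => /f_a.
rewrite RintegralZl//; last exact: integrable_gamma_pdf.
by rewrite /Rintegral integral_gamma_pdf.
Qed.

(** Differentiation under the integral gives the derivative of [Gamma] at [a] as the integral of
    [ln t * f a t]. Division by [Gamma a = n.+1!] turns [f a] into the Gamma density of shape
    [a]. *)
Lemma digamma_nat :
  (\int[leb]_(v in `]0%R, +oo[) (ln v * gamma_pdf n.+1 v)%:E = (digamma a)%:E)%E.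
Proof.
have nf0 : 0 < n.+1`!%:R :> R by rewrite ltr0n fact_gt0.
have mD : measurable (`]0%R, +oo[%classic : set (measurableTypeR R)).
  exact: measurable_itv.
have aI : `]a - 2^-1, a + 2^-1[%classic a by exact: a_itv.
have iI x : `]a - 2^-1, a + 2^-1[%classic x ->
  leb.-integrable `]0%R, +oo[ (EFin \o f x) by exact: intf.
have G_ge0 t : 0 <= G t by exact: normr_ge0.
have dG : is_derive a 1 (@Gamma R) (\int[leb]_(t in `]0%R, +oo[) partial1of2 f a t).
  apply: DeriveDef.
    exact: (derivable_under_integral mD aI iI derivf G_ge0 intG G_ub).
  rewrite -derive1E.
  exact: (differentiation_under_integral mD aI iI derivf G_ge0 intG G_ub).
have G0' : 0 < Gamma a by rewrite Gamma_nat.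
have := @is_derive1_comp _ (@ln R) (@Gamma R) a _ _ (is_derive1_ln G0') dG.
move=> dlnG; rewrite /digamma derive1E.
have -> : 'D_1 (fun y : R => ln (Gamma y)) a =
  (Gamma a)^-1 * (\int[leb]_(t in `]0%R, +oo[) partial1of2 f a t)%R.
  by rewrite (@derive_val _ _ _ _ _ _ _ dlnG).
have intl : leb.-integrable `]0%R, +oo[ (fun v : R => (ln v * gamma_pdf n.+1 v)%:E).
  apply: (le_integrable _ _ _ (integrableZl _ n.+1`!%:R^-1 intG)) => //.
    apply/measurable_EFinP/measurable_funTS; apply: measurable_funM.
      exact: measurable_ln.
    exact: measurable_gamma_pdf.
  move=> t; rewrite /= in_itv/= andbT => t0.
  rewrite lee_fin normrM [in leRHS]normrM /G normr_id.
  have xI : a - 2^-1 < a < a + 2^-1 by have := a_itv; rewrite in_itv.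
  have := lnfG t0 xI; rewrite f_a// mulrCA normrM (ger0_norm (ltW nf0)).
  move=> h; rewrite [in leRHS]gtr0_norm ?invr_gt0//.
  rewrite ler_pdivlMl// -normrM; apply: (le_trans h); exact: ler_norm.
rewrite -[LHS]fineK; last exact: integrable_fin_num.
congr (_%:E); rewrite Gamma_nat.
rewrite (_ : Rintegral _ _ _ =
  \int[leb]_(v in `]0%R, +oo[) (n.+1`!%:R * (ln v * gamma_pdf n.+1 v))).
  by rewrite RintegralZl// mulrA mulVf ?mul1r// gt_eqF.
apply: eq_Rintegral => t; rewrite inE/= in_itv/= andbT => t0.
by rewrite d1f// f_a// mulrCA.
Qed.

End digamma_integral.

(** * The score *)

Section gev_score.
Context d (T : measurableType d) (R : realType) (P : probability T R).
Notation leb := (@lebesgue_measure R).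
Variables (mu sigma xi : R) (n : nat) (X : T -> n.+2.-tuple R).
Hypothesis sigma0 : 0 < sigma.
Hypothesis mX : measurable_fun setT X.
Hypothesis lawX : has_gev_r_law P mu sigma xi X.
Hypothesis lawX' : has_gev_r_law P mu sigma xi
  (fun w => [tuple nth 0 (X w) j | j < n.+1]).

Let u := gev_u mu sigma xi.
Let U w := u (nth 0 (X w) n.+1).
Let U' w := u (nth 0 (X w) n).

Lemma YfunE xp x : Yfun mu sigma xi xp x =
  - ln sigma - u x + u xp + (1 + xi) * ln (u x).
Proof.
rewrite /Yfun /u /gev_u; have [->|xi0] := eqVneq xi 0.
  by rewrite addr0 mul1r expRK.
by rewrite ln_powR; field.
Qed.

Lemma measurable_nth_tuple m (k : nat) : (k < m)%N ->
  measurable_fun setT (fun t : m.-tuple R => nth 0 t k).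
Proof.
move=> km; have -> : (fun t : m.-tuple R => nth 0 t k) = (@tnth _ _ ^~ (Ordinal km)).
  by apply/funext => t; rewrite (tnth_nth 0).
exact: measurable_tnth.
Qed.

Let mXr : measurable_fun setT (fun w => nth 0 (X w) n.+1).
Proof. exact: (measurableT_comp (measurable_nth_tuple (ltnSn _)) mX). Qed.

Let mXr' : measurable_fun setT (fun w => nth 0 (X w) n).
Proof. exact: (measurableT_comp (measurable_nth_tuple (ltnW (ltnSn _))) mX). Qed.

Let X' w : n.+1.-tuple R := [tuple nth 0 (X w) j | j < n.+1].

Let X'E w : nth 0 (X' w) n = nth 0 (X w) n.
Proof. by rewrite -[n in LHS]/(nat_of_ord (@ord_max n)) -tnth_nth tnth_mktuple. Qed.

Let mX' : measurable_fun setT (fun w => nth 0 (X' w) n).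
Proof. by under eq_fun do rewrite X'E; exact: mXr'. Qed.

Let mU : measurable_fun setT U.
Proof. exact: (measurableT_comp (measurable_gev_u mu sigma xi) mXr). Qed.

Let mU' : measurable_fun setT U'.
Proof. exact: (measurableT_comp (measurable_gev_u mu sigma xi) mXr'). Qed.

Let mlnU : measurable_fun setT (fun w => ln (U w)).
Proof. exact: (measurableT_comp (@measurable_ln R) mU). Qed.

Let EU (phi : R -> R) : measurable_fun setT phi ->
  (\int[P]_w (phi (U w))%:E =
   \int[leb]_(v in `]0%R, +oo[) (phi v * gamma_pdf n.+1 v)%:E)%E.
Proof. by move=> mphi; exact: (expectation_gev_last sigma0 mXr lawX). Qed.

Let EU' (phi : R -> R) : measurable_fun setT phi ->
  (\int[P]_w (phi (U' w))%:E =
   \int[leb]_(v in `]0%R, +oo[) (phi v * gamma_pdf n v)%:E)%E.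
Proof.
move=> mphi; rewrite -(expectation_gev_last sigma0 mX' lawX')//.
by apply: eq_integral => w _; rewrite X'E.
Qed.

Let intU (phi : R -> R) : measurable_fun setT phi ->
  leb.-integrable `]0%R, +oo[ (fun v => (phi v * gamma_pdf n.+1 v)%:E) ->
  P.-integrable setT (fun w => (phi (U w))%:E).
Proof. by move=> mphi; exact: (integrable_gev_last sigma0 mXr lawX). Qed.

Let intU' (phi : R -> R) : measurable_fun setT phi ->
  leb.-integrable `]0%R, +oo[ (fun v => (phi v * gamma_pdf n v)%:E) ->
  P.-integrable setT (fun w => (phi (U' w))%:E).
Proof.
move=> mphi /(integrable_gev_last sigma0 mX' lawX' mphi).
by apply: eq_integrable => // w _; rewrite X'E.
Qed.

Let mexp k : measurable_fun setT (fun v : R => v ^+ k).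
Proof. exact: measurable_funX. Qed.

Let intU4 : P.-integrable setT (fun w => (U w ^+ 4)%:E).
Proof. by apply: (intU (mexp 4)); exact: integrable_exp_gamma_pdf. Qed.

Let intU'4 : P.-integrable setT (fun w => (U' w ^+ 4)%:E).
Proof. by apply: (intU' (mexp 4)); exact: integrable_exp_gamma_pdf. Qed.

Let intlnU4 : P.-integrable setT (fun w => (ln (U w) ^+ 4)%:E).
Proof.
apply: (intU (phi := fun v => ln v ^+ 4)); last exact: integrable_ln_gamma_pdf.
by apply: measurable_funX; exact: measurable_ln.
Qed.

Let norm4 (x : R) : `|x| ^+ 4 = x ^+ 4.
Proof. by rewrite -normrX ger0_norm// exprn_even_ge0. Qed.

Lemma norm_le_1Dexp4 (x : R) : `|x| <= 1 + x ^+ 4.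
Proof.
rewrite -norm4; have x4 : 0 <= `|x| ^+ 4 by rewrite exprn_ge0.
have [x1|/ltW x1] := leP `|x| 1; first lra.
have h : `|x| ^+ 1 <= `|x| ^+ 4 by rewrite ler_weXn2l.
by rewrite expr1 in h; lra.
Qed.

Let int1 (V : T -> R) : measurable_fun setT V ->
  P.-integrable setT (fun w => (V w ^+ 4)%:E) ->
  P.-integrable setT (fun w => (V w)%:E).
Proof.
move=> mV i4.
have i : P.-integrable setT (fun w => (1 + V w ^+ 4)%:E).
  under eq_fun do rewrite EFinD.
  by apply: integrableD => //; exact: finite_measure_integrable_cst.
apply: (le_integrable _ _ _ i) => //; first exact/measurable_EFinP.
move=> w _; rewrite lee_fin; apply: le_trans (norm_le_1Dexp4 _) _.
exact: ler_norm.
Qed.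

Let Y w := Yfun mu sigma xi (nth 0 (X w) n) (nth 0 (X w) n.+1).
Let eta := eta_r n.+2 sigma xi.

Let YE w : Y w = - ln sigma - U w + U' w + (1 + xi) * ln (U w).
Proof. exact: YfunE. Qed.

Let mY : measurable_fun setT Y.
Proof.
rewrite (_ : Y = fun w => - ln sigma - U w + U' w + (1 + xi) * ln (U w)).
  2: by apply/funext => w; exact: YE.
apply: measurable_funD; last exact: measurable_funM.
by apply: measurable_funD => //; exact: measurable_funB.
Qed.

Lemma gev_score_mean : (\int[P]_w (Y w - eta)%:E = 0)%E.
Proof.
have iU := int1 mU intU4; have iU' := int1 mU' intU'4.
have il := int1 mlnU intlnU4.
have eU : (\int[P]_w (U w)%:E = n.+2%:R%:E)%E.
  by rewrite (EU (phi := id))// integral_id_gamma_pdf.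
have eU' : (\int[P]_w (U' w)%:E = n.+1%:R%:E)%E.
  by rewrite (EU' (phi := id))// integral_id_gamma_pdf.
have el : (\int[P]_w (ln (U w))%:E = (digamma (n.+2%:R : R))%:E)%E.
  by rewrite (EU (phi := @ln R)) ?digamma_nat//; exact: measurable_ln.
pose A := - ln sigma - eta.
have ic : P.-integrable setT (fun=> A%:E) by exact: finite_measure_integrable_cst.
have iZ : P.-integrable setT (fun w => ((1 + xi) * ln (U w))%:E).
  by under eq_fun do rewrite EFinM; apply: integrableZl.
transitivity (\int[P]_w (A%:E - (U w)%:E + (U' w)%:E + ((1 + xi) * ln (U w))%:E))%E.
  apply: eq_integral => w _; rewrite YE -EFinB -!EFinD; congr (_%:E).
  by rewrite /A; ring.
rewrite integralD//; last first.
  by apply: integrableD => //; apply: integrableB.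
rewrite integralD//; last by apply: integrableB.
rewrite integralB//.
under [X in (_ + X)%E]eq_integral do rewrite EFinM.
rewrite integralZl// eU eU' el.
rewrite -[X in (X - _ + _ + _)%E]/(\int[P]_w (cst A%:E w))%E.
rewrite integral_cst// [X in (_ * X)%E]probability_setT mule1.
rewrite -EFinM -EFinB -!EFinD; congr (_%:E).
by rewrite /A /eta /eta_r -(natr1 n.+1); ring.
Qed.

Let add4 (x y : R) : (x + y) ^+ 4 <= 8 * (x ^+ 4 + y ^+ 4).
Proof.
have h1 : (x + y) ^+ 2 <= 2 * (x ^+ 2 + y ^+ 2).
  rewrite -subr_ge0 (_ : _ - _ = (x - y) ^+ 2) ?sqr_ge0//; ring.
have h0 : 0 <= (x + y) ^+ 2 by exact: sqr_ge0.
have h2 : ((x + y) ^+ 2) ^+ 2 <= (2 * (x ^+ 2 + y ^+ 2)) ^+ 2.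
  by rewrite lerXn2r// nnegrE (le_trans h0).
rewrite -exprM in h2; apply: (le_trans h2).
rewrite -subr_ge0 (_ : _ - _ = 4 * (x ^+ 2 - y ^+ 2) ^+ 2).
  by rewrite mulr_ge0// sqr_ge0.
by ring.
Qed.

Lemma gev_score_int4 (c : R) : P.-integrable setT (fun w => ((Y w - c) ^+ 4)%:E).
Proof.
pose A := - ln sigma - c; pose b := (1 + xi) ^+ 4.
(* The four terms of the score are split by two rounds of [add4], whence [64 = 8 * 8]. *)
have i1 : P.-integrable setT (fun w => (64 * b * ln (U w) ^+ 4)%:E).
  by under eq_fun do rewrite EFinM; apply: integrableZl.
have i2 : P.-integrable setT (fun w => (64 * U w ^+ 4)%:E).
  by under eq_fun do rewrite EFinM; apply: integrableZl.
have i3 : P.-integrable setT (fun w => (64 * U' w ^+ 4)%:E).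
  by under eq_fun do rewrite EFinM; apply: integrableZl.
have i4 : P.-integrable setT (fun=> (64 * A ^+ 4)%:E).
  exact: finite_measure_integrable_cst.
have i : P.-integrable setT (fun w => (64 * A ^+ 4)%:E + (64 * U w ^+ 4)%:E
   + ((64 * U' w ^+ 4)%:E + (64 * b * ln (U w) ^+ 4)%:E))%E.
  by apply: integrableD => //; apply: integrableD.
apply: (le_integrable _ _ _ i) => //.
  by apply/measurable_EFinP; apply: measurable_funX; exact: measurable_funB.
move=> w _; rewrite -!EFinD !abse_EFin lee_fin.
rewrite ger0_norm ?exprn_even_ge0//; apply: le_trans (ler_norm _).
have -> : Y w - c = (A - U w) + (U' w + (1 + xi) * ln (U w)).
  by rewrite YE /A; ring.
apply: (le_trans (add4 _ _)).
have h1 := add4 A (- U w); have h2 := add4 (U' w) ((1 + xi) * ln (U w)).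
have e1 : (- U w) ^+ 4 = U w ^+ 4 by rewrite exprNn -signr_odd expr0 mul1r.
have e2 : ((1 + xi) * ln (U w)) ^+ 4 = b * ln (U w) ^+ 4 by rewrite exprMn.
by rewrite e1 in h1; rewrite e2 in h2; rewrite -mulrA; lra.
Qed.

(** The density vanishes wherever the last two coordinates are not ordered in this way, so the
    integrand is identically zero. *)
Let ordered_as : P (~` [set w | 0 < U' w < U w]) = 0%E.
Proof.
pose A : set (n.+2.-tuple R) := ~` [set t | 0 < u (nth 0 t n) < u (nth 0 t n.+1)].
have mA : measurable A.
  apply: measurableC; rewrite -[X in measurable X]setTI.
  have mun : measurable_fun setT (fun t : n.+2.-tuple R => u (nth 0 t n)).
    apply: (measurableT_comp (measurable_gev_u mu sigma xi)).
    exact: measurable_nth_tuple (ltnW (ltnSn _)).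
  have mun1 : measurable_fun setT (fun t : n.+2.-tuple R => u (nth 0 t n.+1)).
    apply: (measurableT_comp (measurable_gev_u mu sigma xi)).
    exact: measurable_nth_tuple (ltnSn _).
  have mb : measurable_fun setT (fun t : n.+2.-tuple R =>
      0 < u (nth 0 t n) < u (nth 0 t n.+1)).
    by apply: measurable_and; apply: measurable_fun_ltr.
  exact: (mb measurableT [set true]).
rewrite -[LHS]/(P (X @^-1` A)) lawX// -[RHS](tint0 (R := R) n.+2).
apply: eq_tint => t; congr (_%:E).
have [->|/gev_r_pdf_neq0[dec supp]] := eqVneq (gev_r_pdf mu sigma xi t) 0.
  by rewrite mulr0.
rewrite indicE memNset ?mul0r// /A /=; apply; apply/andP; split.
  by apply: gev_u_gt0; apply: supp; rewrite ltnW.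
rewrite gev_u_lt//; first by apply: dec; rewrite !ltnSn.
  by apply: supp; rewrite ltnW.
exact: supp.
Qed.

Let small_pos (e : R) : 0 < e -> (0 < P [set w | (U w < e)%R])%E.
Proof.
move=> e0.
pose e' := e / 2; have e20 : 0 < e' by rewrite divr_gt0.
have e2 : e' < e by rewrite /e'; lra.
have mB : measurable (`]-oo, e[%classic : set R) by exact: measurable_itv.
have mE : measurable (U @^-1` `]-oo, e[%classic).
  by rewrite -[X in measurable X]setTI; exact: mU.
have BE : [set w | U w < e] = U @^-1` `]-oo, e[%classic.
  by apply/seteqP; split => w /=; rewrite in_itv.
have -> : P [set w | U w < e] = (\int[P]_w (\1_(`]-oo, e[%classic : set R) (U w))%:E)%E.
  have h := @integral_indic _ _ _ P setT measurableT _ mE.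
  rewrite setIT in h; rewrite BE -h.
  by apply: eq_integral => w _; rewrite !indicE.
rewrite (EU (phi := \1_(`]-oo, e[%classic : set R))).
  2: exact: measurable_indic.
(* A lower bound of the Gamma density on []e', e[]: the power is taken at the left end and the
   exponential at the right end. *)
pose c := e' ^+ n.+1 * expR (- e) / n.+1`!%:R.
have nf : 0 < n.+1`!%:R :> R by rewrite ltr0n fact_gt0.
have c0 : 0 < c.
  by rewrite /c divr_gt0// mulr_gt0// ?expR_gt0// exprn_gt0.
have mg : measurable_fun setT (gamma_pdf (R := R) n.+1) by exact: measurable_gamma_pdf.
apply: (@lt_le_trans _ _ (\int[leb]_(v in `]e', e[) c%:E)%E).
  rewrite -[X in (_ < X)%E]/(\int[leb]_(v in `]e', e[) cst c%:E v)%E.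
  rewrite integral_cst//= lebesgue_measure_itv/= lte_fin e2 -EFinB -EFinM lte_fin.
  by rewrite mulr_gt0// subr_gt0.
apply: (@le_trans _ _ (\int[leb]_(v in `]e', e[)
    (\1_(`]-oo, e[%classic : set R) v * gamma_pdf n.+1 v)%:E)%E).
  apply: ge0_le_integral => //.
  - by move=> v _; rewrite lee_fin ltW.
  - apply/measurable_EFinP/measurable_funTS/measurable_funM => //.
  - move=> v; rewrite /= in_itv/= => /andP[v1 v2].
    rewrite indicE mem_set/= ?in_itv// mul1r lee_fin /c /gamma_pdf.
    rewrite ler_pM2r ?invr_gt0//.
    have h1 : e' ^+ n.+1 <= v ^+ n.+1.
      by rewrite lerXn2r ?nnegrE ?(ltW e20) ?(ltW (lt_trans e20 v1)) ?ltW.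
    have h2 : expR (- e) <= expR (- v) by rewrite ler_expR lerN2 ltW.
    by apply: ler_pM => //; rewrite ?expR_ge0// exprn_ge0// ltW.
apply: ge0_subset_integral => //.
- apply/measurable_EFinP/measurable_funTS/measurable_funM => //.
- move=> v; rewrite /= in_itv/= andbT => v0; rewrite lee_fin mulr_ge0//.
  exact: gamma_pdf_ge0.
- move=> v; rewrite /= !in_itv/= andbT => /andP[v1 _]; exact: lt_trans v1.
Qed.

(* Near [v = 0] the logarithmic term blows up when [b != 0], and [v' - v] is
   negative but small when [b = 0]. *)
Let no_constant_score (A b : R) : exists2 e : R, 0 < e &
  forall v v' : R, v < e -> 0 < v' < v -> A - v + v' + b * ln v != 0.
Proof.
have [->|b0] := eqVneq b 0.
  (* If [A > 0], then [v < A] keeps [A - v + v'] positive; otherwise [v' < v] makes it negative for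
     any [v]. *)
  exists (if 0 < A then A else 1); first by case: ifP.
  move=> v v' ve /andP[v'0 vv]; rewrite mul0r addr0; apply/eqP.
  by case: (ltP 0 A) ve => A0 ve h; lra.
have nb : 0 < `|b| by rewrite normr_gt0.
have A0 : 0 <= `|A| by [].
(* For [v < expR (- q)] the logarithmic term exceeds [1 + |A|] in absolute value, whereas
   [|v - v' - A| < 1 + |A|]. *)
pose q := (1 + `|A|) / `|b|.
have q0 : 0 < q by rewrite divr_gt0//; lra.
exists (expR (- q)); first exact: expR_gt0.
move=> v v' ve /andP[v'0 vv]; have v0 : 0 < v by exact: lt_trans vv.
have v1 : v < 1 by apply: (lt_trans ve); rewrite -expR0 ltr_expR; lra.
have lv : ln v < - q by rewrite -[ltRHS]expRK ltr_ln// posrE expR_gt0.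
have lb : 1 + `|A| < `|b * ln v|.
  rewrite normrM -ltr_pdivrMl// mulrC -/q ltr0_norm; lra.
apply/eqP => h; have hb : b * ln v = (v - v') - A by lra.
rewrite hb in lb; have := ler_normB (v - v') A.
by rewrite [X in _ <= X + _]ger0_norm; lra.
Qed.

(** Otherwise [Y = c] almost surely. By [no_constant_score] the event [U < e], of positive
    probability, would then lie in the union of two null sets. *)
Lemma gev_score_var_gt0 (c : R) : (0 < \int[P]_w ((Y w - c) ^+ 2)%:E)%E.
Proof.
have ge0 : (0 <= \int[P]_w ((Y w - c) ^+ 2)%:E)%E.
  by apply: integral_ge0 => w _; rewrite lee_fin sqr_ge0.
rewrite lt_neqAle ge0 andbT; apply/eqP => I0.
have mYc : measurable_fun setT (fun w => ((Y w - c) ^+ 2)%:E).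
  by apply/measurable_EFinP; apply: measurable_funX; exact: measurable_funB.
have I0' : (\int[P]_w `|((Y w - c) ^+ 2)%:E| = 0)%E.
  by rewrite [RHS]I0; apply: eq_integral => w _; rewrite gee0_abs// lee_fin sqr_ge0.
have [N [mN PN YN]] := (ae_eq_integral_abs P measurableT mYc).1 I0'.
have [e e0 he] := no_constant_score (- ln sigma - c) (1 + xi).
pose B := [set w | U w < e].
have mB : measurable B.
  have mb : measurable_fun setT (fun w => U w < e).
    by apply: measurable_fun_ltr.
  by rewrite -[B]setTI; exact: (mb measurableT [set true]).
pose C := ~` [set w | 0 < U' w < U w].
have mC : measurable C.
  apply: measurableC; rewrite -[X in measurable X]setTI.
  have mb : measurable_fun setT (fun w => 0 < U' w < U w).
    by apply: measurable_and; apply: measurable_fun_ltr.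
  exact: (mb measurableT [set true]).
have BNC : B `<=` N `|` C.
  move=> w Bw; have [Cw|nCw] := pselect (C w); [by right|left].
  apply: YN => /= /(_ I) /eqP; rewrite eqe sqrf_eq0 => /eqP Yc.
  have := he (U w) (U' w) Bw.
  have -> : 0 < U' w < U w by move: nCw; rewrite /C /= => /contrapT.
  move=> /(_ isT) /eqP; apply; rewrite -[RHS]Yc YE; ring.
have := small_pos e0; rewrite ltNge => /negP; apply.
have mNC : measurable (N `|` C) by exact: measurableU.
apply: (@le_trans _ _ (P (N `|` C))); first by apply: le_measure; rewrite ?inE.
have PN0 : P N = 0%E := PN.
have PC0 : P C = 0%E := ordered_as.
apply: (@le_trans _ _ (P N + P C)%E); first exact: measureU2.
by rewrite PN0 PC0 adde0.
Qed.

End gev_score.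

(** Studentization cancels a positive scale, so the limit theorem for standardized variables applies
    to the scores themselves. *)
Lemma student_affine d (T : measurableType d) (R : realType) (Y : nat -> T -> R) (e s : R) n w :
  0 < s -> (0 < n)%N ->
  let Ybar := n%:R^-1 * \sum_(i < n) Y i w in
  student (fun i w => s^-1 * (Y i w - e)) n w =
  Num.sqrt n%:R * (Ybar - e) /
  Num.sqrt ((n.-1)%:R^-1 * \sum_(i < n) (Y i w - Ybar) ^+ 2).
Proof.
move=> s0 n0 Ybar; rewrite /student.
have n1 : n%:R != 0 :> R by rewrite pnatr_eq0 -lt0n.
have -> : scaled_sum (fun i w => s^-1 * (Y i w - e)) n%:R^-1 n w = s^-1 * (Ybar - e).
  rewrite /scaled_sum -mulr_sumr sumrB sumr_const card_ord -[e *+ n]mulr_natl.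
  rewrite mulrCA; congr (_ * _).
  by rewrite mulrBr mulKf.
have -> : \sum_(i < n) (s^-1 * (Y i w - e) - s^-1 * (Ybar - e)) ^+ 2 =
    s^-1 ^+ 2 * \sum_(i < n) (Y i w - Ybar) ^+ 2.
  by rewrite mulr_sumr; apply: eq_bigr => i _; ring.
have sV0 : 0 <= s^-1 by rewrite invr_ge0 ltW.
set V := \sum_(i < n) _; set k : R := (n.-1)%:R^-1.
rewrite (_ : k * _ = s^-1 ^+ 2 * (k * V)); last by rewrite mulrCA.
rewrite sqrtrM ?exprn_ge0// sqrtr_sqr ger0_norm// invfM invrK.
(* The reciprocal is kept opaque, which includes the degenerate case of zero sample deviation, where
   it equals 0. *)
set c := (Num.sqrt (k * V))^-1; set a := Num.sqrt n%:R.
by field; rewrite gt_eqF.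
Qed.

Theorem theorem1 (R : realType) (d : measure_display) (T : measurableType d)
  (P : probability T R) (r : nat) (mu sigma xi : R)
  (X : nat -> T -> r.-tuple R) :
  (2 <= r)%N -> 0 < sigma ->
  (forall i, measurable_fun [set: T] (X i)) ->
  mutually_independent P X ->
  (forall i, has_gev_r_law P mu sigma xi (X i)) ->
  (forall i, has_gev_r_law P mu sigma xi
               (fun w => [tuple nth 0 (X i w) j | j < r.-1])) ->
  cvg_in_distribution P (Tstat mu sigma xi X) (@normal_prob R 0 1).
Proof.
case: r X => [|[|n]]// X _ sigma0 mX indX lawX lawX' x _.
pose eta := eta_r n.+2 sigma xi.
pose f (t : n.+2.-tuple R) := Yfun mu sigma xi (nth 0 t n) (nth 0 t n.+1).
have mf : measurable_fun setT f.
  have mu1 : measurable_fun setT (fun t : n.+2.-tuple R => gev_u mu sigma xi (nth 0 t n)).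
    apply: (measurableT_comp (measurable_gev_u mu sigma xi)).
    exact: measurable_nth_tuple (ltnW (ltnSn _)).
  have mu2 : measurable_fun setT (fun t : n.+2.-tuple R => gev_u mu sigma xi (nth 0 t n.+1)).
    apply: (measurableT_comp (measurable_gev_u mu sigma xi)).
    exact: measurable_nth_tuple (ltnSn _).
  rewrite (_ : f = fun t : n.+2.-tuple R => - ln sigma - gev_u mu sigma xi (nth 0 t n.+1)
     + gev_u mu sigma xi (nth 0 t n) + (1 + xi) * ln (gev_u mu sigma xi (nth 0 t n.+1))).
    2: by apply/funext => t; exact: YfunE.
  apply: measurable_funD.
    by apply: measurable_funD => //; exact: measurable_funB.
  by apply: measurable_funM => //; exact: (measurableT_comp (@measurable_ln R) mu2).
have f_mean := gev_score_mean sigma0 (mX 0) (lawX 0) (lawX' 0).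
have f_int4 := gev_score_int4 sigma0 (mX 0) (lawX 0) (lawX' 0) eta.
have f_var := gev_score_var_gt0 sigma0 (mX 0) (lawX 0) eta.
pose Z w := f (X 0 w) - eta.
have mZ : measurable_fun setT Z.
  by apply: measurable_funB => //; exact: (measurableT_comp mf (mX 0)).
have iZ2 : P.-integrable setT (fun w => (Z w ^+ 2)%:E).
  have i : P.-integrable setT (fun w => (1 + Z w ^+ 4)%:E).
    under eq_fun do rewrite EFinD.
    by apply: integrableD => //; exact: finite_measure_integrable_cst.
  apply: (le_integrable _ _ _ i) => //.
    by apply/measurable_EFinP; exact: measurable_funX.
  move=> w _; rewrite lee_fin !ger0_norm ?sqr_ge0 ?addr_ge0 ?exprn_even_ge0//.
  rewrite -subr_ge0 (_ : _ - _ = (Z w ^+ 2 - 2^-1) ^+ 2 + 3 / 4); last by field.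
  by rewrite addr_ge0// sqr_ge0.
have iZ : P.-integrable setT (fun w => (Z w)%:E).
  have i : P.-integrable setT (fun w => (1 + Z w ^+ 2)%:E).
    under eq_fun do rewrite EFinD.
    by apply: integrableD => //; exact: finite_measure_integrable_cst.
  apply: (le_integrable _ _ _ i) => //; first exact/measurable_EFinP.
  move=> w _; rewrite lee_fin [leRHS]ger0_norm ?addr_ge0 ?sqr_ge0//.
  rewrite -(real_normK (num_real (Z w))) -subr_ge0.
  rewrite (_ : _ - _ = (`|Z w| - 2^-1) ^+ 2 + 3 / 4); last by field.
  by rewrite addr_ge0// sqr_ge0.
pose v := fine (\int[P]_w (Z w ^+ 2)%:E).
have vE : (\int[P]_w (Z w ^+ 2)%:E = v%:E)%E.
  by rewrite fineK//; exact: integrable_fin_num.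
have v0 : 0 < v by rewrite -lte_fin -vE.
pose s := Num.sqrt v; have s0 : 0 < s by rewrite sqrtr_gt0.
pose g (t : n.+2.-tuple R) := s^-1 * (f t - eta).
have mg : measurable_fun setT g.
  by apply: measurable_funM => //; exact: measurable_funB.
have mgA A : measurable A -> measurable (g @^-1` A).
  by move=> mA; rewrite -[X in measurable X]setTI; exact: mg.
pose W i w := g (X i w).
have iidW : iid P W.
  split.
  - by move=> i; exact: (measurableT_comp mg (mX i)).
  - move=> q A uq mA; apply: (indX q (fun i => g @^-1` A i)) => // i /mA.
    exact: mgA.
  - move=> i B mB; transitivity (P (X i @^-1` (g @^-1` B))) => //.
    (* Both probabilities are the same iterated integral of the GEV density. *)
    by apply: etrans (lawX i _ (mgA B mB)) _; exact: esym (lawX 0 _ (mgA B mB)).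
have mean0 : (\int[P]_w (W 0 w)%:E = 0)%E.
  by under eq_integral do rewrite EFinM; rewrite integralZl// f_mean mule0.
have var1 : (\int[P]_w (W 0 w ^+ 2)%:E = 1)%E.
  under eq_integral do rewrite exprMn EFinM.
  rewrite integralZl// vE -EFinM exprVn sqr_sqrtr ?ltW//.
  by rewrite mulVf// gt_eqF.
have int4 : P.-integrable setT (fun w => (W 0 w ^+ 4)%:E).
  by under eq_fun do rewrite exprMn EFinM; apply: integrableZl.
have TW m : (0 < m)%N -> P [set w | Tstat mu sigma xi X m w <= x] =
    (prle P (student W m) x)%:E.
  move=> m0; have mS := measurable_student iidW m.
  have mA : measurable (student W m @^-1` `]-oo, x]%classic).
    by rewrite -[X in measurable X]setTI; exact: mS.
  rewrite /prle fineK ?fin_num_measure//; congr (P _).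
  apply/seteqP; split => w /=; rewrite in_itv/=.
    by rewrite (student_affine (fun i w => f (X i w)) eta w s0 m0).
  by rewrite (student_affine (fun i w => f (X i w)) eta w s0 m0).
have -> : normal_prob 0 1 `]-oo, x]%classic = (normal_cdf x)%:E.
  by rewrite /normal_cdf fineK// fin_num_measure.
apply: (@cvg_trans _ ((fun m => (prle P (student W m) x)%:E) @ \oo)).
  apply: near_eq_cvg; near=> m; rewrite TW//.
  by near: m; exact: nbhs_infty_gt.
apply: cvg_EFin; first exact: nearW.
apply/cvgrPdist_le => eps eps0.
have := student_cdf iidW mean0 var1 int4 x eps0.
apply: filterS => m /andP[h1 h2].
by rewrite ler_distlC; apply/andP.
Unshelve. all: by end_near.
Qed.
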